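(* Let $\mathbb F\in\{\mathbb R,\mathbb C,\mathbb H\}$, $q\ge1$, let $(G_\infty,K_\infty)$ be the Olshanski spherical pair of the infinite-dimensional Grassmannian of rank $q$ over $\mathbb F$, and let $G/K$ be $GL_+(q,\mathbb R)/SO(q)$, $GL(q,\mathbb C)/U(q)$ or $GL(q,\mathbb H)/Sp(q)$ according to $\mathbb F=\mathbb R,\mathbb C,\mathbb H$. A continuous $K_\infty$-biinvariant function $\phi:G_\infty\to\mathbb C$ is an Olshanski spherical function if and only if the function $\tilde\phi:D\to\mathbb C$ with $\phi(a_t^\infty)=\tilde\phi(\cosh\underline t)$ for $t\in C_B$ is the restriction to $D$ of a spherical function $\psi$ of $G/K$. Moreover, each spherical function $\psi$ of $G/K$ is uniquely determined by its restriction to $D$; hence the Olshanski spherical functions of $(G_\infty,K_\infty)$ correspond bijectively to the spherical functions of $G/K$.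
   Context: For $n\ge 1$ let $G_n=SO_0(n+q,q)$, $SU(n+q,q)$, $Sp(n+q,q)$ with maximal compact subgroup $K_n=SO(n+q)\times SO(q)$, $S(U(n+q)\times U(q))$, $Sp(n+q)\times Sp(q)$ for $\mathbb F=\mathbb R,\mathbb C,\mathbb H$. $G_n$ is regarded as a closed subgroup of $G_{n+1}$ via $\begin{pmatrix}A&B\\C&E\end{pmatrix}\mapsto\begin{pmatrix}A&0&B\\0&1&0\\C&0&E\end{pmatrix}$ ($A$ of size $n+q$, $E$ of size $q$), so $K_n=G_n\cap K_{n+1}$. $G_\infty=\varinjlim G_n$, $K_\infty=\varinjlim K_n$ with the inductive limit topology. A (nonzero) continuous function $\phi:G_\infty\to\mathbb C$ is an Olshanski spherical function of $(G_\infty,K_\infty)$ if it is $K_\infty$-biinvariant and $\phi(g)\phi(h)=\lim_{n\to\infty}\int_{K_n}\phi(gkh)\,dk$ for all $g,h\in G_\infty$ ($dk$ normalized Haar measure). $C_B=\{t\in\mathbb R^q:t_1\ge\dots\ge t_q\ge0\}$; $\underline t=\mathrm{diag}(t_1,\dots,t_q)$; $\cosh\underline t=\mathrm{diag}(\cosh t_1,\dots,\cosh t_q)$, similarly $\sinh\underline t$; $D=\{\cosh\underline t:t\in C_B\}$; $$a_t^\infty=\begin{pmatrix}\cosh\underline t&0&\sinh\underline t\\0&I_\infty&0\\\sinh\underline t&0&\cosh\underline t\end{pmatrix}.$$ The $a^\infty_t$, $t\in C_B$, represent the $K_\infty$-double cosets of $G_\infty$, so continuous $K_\infty$-biinvariant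 functions $\phi$ on $G_\infty$ correspond to continuous functions $\tilde\phi$ on $D$. Spherical functions of $G/K$ are the (nonzero) continuous $K$-biinvariant functions $\psi$ on $G$ with $\psi(g)\psi(h)=\int_K\psi(gkh)\,dk$ for $g,h\in G$. They are regarded as functions on $D_0=\{e^{\underline t}:t\in\mathbb R^q,\ t_1\ge\dots\ge t_q\}\supset D$, which represents the double coset space $G/\!/K$ (via ordered singular values). *)

(* Defs.v *)
From HB Require Import structures.
From mathcomp Require Import all_boot all_order all_algebra.
From mathcomp Require Import complex ring.
From mathcomp Require Import all_classical all_reals all_analysis.

Set Implicit Arguments.
Unset Strict Implicit.
Unset Printing Implicit Defensive.

Import Order.TTheory GRing.Theory Num.Theory.
Import numFieldNormedType.Exports.

Local Open Scope classical_set_scope.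
Local Open Scope ring_scope.
Local Open Scope complex_scope.

HB.instance Definition _ (R : realType) := NormedModule.copy R[i] R[i]^o.

(* The pair (z, w) is the quaternion z + w j, where j ^ 2 = -1 and
   j z = z^* j. *)
Definition quaternion (R : realType) : Type := (R[i] * R[i])%type.

Section Quaternion.
Variable R : realType.
Local Notation H := (quaternion R).

HB.instance Definition _ := GRing.Zmodule.copy H (R[i] * R[i])%type.
HB.instance Definition _ := Pointed.copy H (R[i] * R[i])%type.
HB.instance Definition _ := Topological.copy H (R[i] * R[i])%type.

Definition quat1 : H := (1, 0).
Definition quat_mul (x y : H) : H :=
  (x.1 * y.1 - x.2 * conjc y.2, x.1 * y.2 + x.2 * conjc y.1).
Definition quat_conj (x : H) : H := (conjc x.1, - x.2).

Let quat_mulA : associative quat_mul.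
Proof.
move=> [a b] [c d] [e f]; rewrite /quat_mul /=.
rewrite !(rmorphD, rmorphN, rmorphM) /= !conjcK.
by congr (_, _) => /=; ring.
Qed.
Let quat_mul1l : left_id quat1 quat_mul.
Proof.
by move=> [a b]; rewrite /quat_mul /= !mul1r !mul0r subr0 addr0.
Qed.
Let quat_mul1r : right_id quat1 quat_mul.
Proof.
move=> [a b]; rewrite /quat_mul (_ : conjc quat1.2 = 0) ?(rmorph0 conjc) //.
by rewrite (_ : conjc quat1.1 = 1) ?(rmorph1 conjc) // !mulr1 !mulr0 subr0 add0r.
Qed.
Let quat_mulDl : left_distributive quat_mul +%R.
Proof.
move=> [a b] [c d] [e f]; rewrite /quat_mul /= !mulrDl.
by congr (_, _); rewrite /= ?opprD addrACA.
Qed.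
Let quat_mulDr : right_distributive quat_mul +%R.
Proof.
move=> [a b] [c d] [e f]; rewrite /quat_mul /= !rmorphD !mulrDr.
by congr (_, _); rewrite /= ?opprD addrACA.
Qed.
Let quat1_neq0 : quat1 != 0.
Proof. by apply/eqP => -[] /eqP; rewrite oner_eq0. Qed.

HB.instance Definition _ := GRing.Zmodule_isNzRing.Build H
  quat_mulA quat_mul1l quat_mul1r quat_mulDl quat_mulDr quat1_neq0.

End Quaternion.

#[short(type="preTopologicalNzRingType")]
HB.structure Definition PreTopologicalNzRing :=
  {T of GRing.NzRing T & Topological T}.

HB.instance Definition _ (T : preTopologicalNzRingType) := isPointed.Build T 0.

HB.instance Definition _ (R : realType) := GRing.NzRing.on R.
HB.instance Definition _ (R : realType) := GRing.NzRing.on R[i].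
HB.instance Definition _ (R : realType) := GRing.NzRing.on (quaternion R).

Inductive base_field := Reals | Complexes | Quaternions.

Definition scalars (R : realType) (F : base_field) : preTopologicalNzRingType :=
  match F with
  | Reals => R
  | Complexes => R[i]
  | Quaternions => quaternion R
  end.

Definition conj_scalar (R : realType) (F : base_field) :
    scalars R F -> scalars R F :=
  match F with
  | Reals => fun x => x
  | Complexes => fun x => conjc x
  | Quaternions => fun x => quat_conj x
  end.

Definition real_scalar (R : realType) (F : base_field) (x : R) : scalars R F :=
  match F with
  | Reals => x
  | Complexes => x%:C
  | Quaternions => (x%:C, 0)
  end.

Definition cosh (R : realType) (x : R) : R := (expR x + expR (- x)) / 2.
Definition sinh (R : realType) (x : R) : R := (expR x - expR (- x)) / 2.

Section MatrixGroups.
Variables (R : realType) (F : base_field).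
Local Notation "''Mat_' N" := 'M[scalars R F]_N (at level 8, N at level 2).

Definition adj N (g : 'Mat_N) : 'Mat_N := (map_mx (@conj_scalar R F) g)^T.

Definition invertible_mx N : set 'Mat_N :=
  [set g | exists h, g *m h = 1%:M /\ h *m g = 1%:M].

Definition isometries N (J : 'Mat_N) : set 'Mat_N :=
  [set g | invertible_mx g /\ adj g *m J *m g = J].

(* O(N), U(N), Sp(N) *)
Definition unitary N : set 'Mat_N := isometries 1%:M.

Definition signature p r : 'Mat_(p + r) := block_mx 1%:M 0 0 (- 1%:M).

End MatrixGroups.

Arguments unitary R F N : clear implicits.
Arguments invertible_mx R F N : clear implicits.
Arguments signature R F p r : clear implicits.

(* SO_0(q + n, q), SU(q + n, q), Sp(q + n, q) *)
Definition group_G (R : realType) (F : base_field) (q n : nat) :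
    set 'M[scalars R F]_(q + n + q) :=
  match F with
  | Reals => connected_component
      (isometries (signature R Reals (q + n) q) `&` [set g | \det g = 1]) 1%:M
  | Complexes =>
      isometries (signature R Complexes (q + n) q) `&` [set g | \det g = 1]
  | Quaternions => isometries (signature R Quaternions (q + n) q)
  end.
Arguments group_G R F q n : clear implicits.

Definition det_condition_K (R : realType) (F : base_field) (p r : nat) :
    'M[scalars R F]_p -> 'M[scalars R F]_r -> Prop :=
  match F with
  | Reals => fun A D => \det A = 1 /\ \det D = 1
  | Complexes => fun A D => \det A * \det D = 1
  | Quaternions => fun _ _ => True
  end.

Definition group_K (R : realType) (F : base_field) (q n : nat) :
    set 'M[scalars R F]_(q + n + q) :=
  [set g | exists A D, [/\ unitary R F (q + n) A, unitary R F q D,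
     det_condition_K A D & g = block_mx A 0 0 D]].
Arguments group_K R F q n : clear implicits.

Definition group_GL (R : realType) (F : base_field) (q : nat) :
    set 'M[scalars R F]_q :=
  match F with
  | Reals => invertible_mx R Reals q `&` [set g : 'M[R]_q | 0 < \det g]
  | Complexes => invertible_mx R Complexes q
  | Quaternions => invertible_mx R Quaternions q
  end.
Arguments group_GL R F q : clear implicits.

Definition group_U (R : realType) (F : base_field) (q : nat) :
    set 'M[scalars R F]_q :=
  match F with
  | Reals => unitary R Reals q `&` [set g | \det g = 1]
  | Complexes => unitary R Complexes q
  | Quaternions => unitary R Quaternions q
  end.
Arguments group_U R F q : clear implicits.

(* The direct limit of the matrices of size q + n + q is realized by infinite
   matrices: the rows and columns of the block of size q + n are indexed by
   [inl a] with a < q + n, those of the last block of size q by [inr k].  The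
   embedding of the n-th group completes a matrix by 1 on the diagonal, so that
   the n-th embedding is the (n+1)-st one precomposed with the map inserting a
   row and a column of the identity matrix between the two blocks. *)
Definition infmx (R : realType) (F : base_field) (q : nat) : Type :=
  nat + 'I_q -> nat + 'I_q -> scalars R F.

Definition finite_index (q n : nat) (i : nat + 'I_q) : option 'I_(q + n + q) :=
  match i with
  | inl a => omap (@lshift (q + n) q) (insub a)
  | inr k => Some (rshift (q + n) k)
  end.

Section InfiniteMatrices.
Variables (R : realType) (F : base_field) (q : nat).
Local Notation infmx := (infmx R F q).

Definition embed n (g : 'M[scalars R F]_(q + n + q)) : infmx := fun i j =>
  match finite_index n i, finite_index n j with
  | Some a, Some b => g a b
  | _, _ => (i == j)%:R
  end.

Definition infmul (g h : infmx) : infmx :=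
  fun i j => \sum_(k \in [set: nat + 'I_q]) g i k * h k j.

Definition Ginf : set infmx :=
  [set g | exists2 n, (0 < n)%N & (@embed n @` group_G R F q n) g].

Definition Kinf : set infmx :=
  [set g | exists2 n, (0 < n)%N & (@embed n @` group_K R F q n) g].

(* The final topology with respect to the embeddings of the groups
   [group_G R F q n], n >= 1; on [Ginf] it induces the inductive limit
   topology. *)
Definition infmx_open : set_system infmx :=
  [set U | forall n, (0 < n)%N ->
    open (@embed n @^-1` U : set (subspace (group_G R F q n)))].

Let infmx_openT : infmx_open setT.
Proof. by move=> n _; rewrite preimage_setT; exact: openT. Qed.
Let infmx_openI : setI_closed infmx_open.
Proof. by move=> U V oU oV n n0; rewrite preimage_setI; apply: openI; auto. Qed.
Let infmx_open_bigU (I : Type) (f : I -> set infmx) :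
  (forall i, infmx_open (f i)) -> infmx_open (\bigcup_i f i).
Proof.
move=> fo n n0; rewrite preimage_bigcup; apply: bigcup_open => i _.
exact: fo.
Qed.

HB.instance Definition _ := gen_eqMixin infmx.
HB.instance Definition _ := gen_choiceMixin infmx.
HB.instance Definition _ := isOpenTopological.Build infmx
  infmx_openT infmx_openI infmx_open_bigU.

Definition a_inf (t : 'rV[R]_q) : infmx := fun i j =>
  match i, j with
  | inl a, inl b =>
      if a != b then 0
      else if insub a is Some k then real_scalar F (cosh (t 0 k)) else 1
  | inl a, inr k | inr k, inl a =>
      if a == k then real_scalar F (sinh (t 0 k)) else 0
  | inr k, inr l => if k == l then real_scalar F (cosh (t 0 k)) else 0
  end.

End InfiniteMatrices.

Arguments Ginf R F q : clear implicits.
Arguments Kinf R F q : clear implicits.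

Definition C_B (R : realType) (q : nat) : set 'rV[R]_q :=
  [set t | (forall i j : 'I_q, (i <= j)%N -> t 0 j <= t 0 i) /\
           (forall i, 0 <= t 0 i)].

Definition cosh_mx (R : realType) (F : base_field) (q : nat) (t : 'rV[R]_q) :
    'M[scalars R F]_q :=
  diag_mx (map_mx (fun x => real_scalar F (cosh x)) t).

Definition set_D (R : realType) (F : base_field) (q : nat) :
    set 'M[scalars R F]_q :=
  @cosh_mx R F q @` @C_B R q.
Arguments set_D R F q : clear implicits.

Definition borel (T : ptopologicalType) := g_sigma_algebraType (@open T).

Definition normalized_haar (R : realType) (F : base_field) (N : nat)
    (K : set 'M[scalars R F]_N)
    (mu : probability (borel 'M[scalars R F]_N) R) : Prop :=
  mu K = 1%E /\
  forall k (A : set (borel 'M[scalars R F]_N)), K k -> measurable A ->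
    mu ((fun x => k *m x) @^-1` A) = mu A.

Definition complex_integral d (T : measurableType d) (R : realType)
    (mu : {measure set T -> \bar R}) (D : set T) (f : T -> R[i]) : R[i] :=
  Rintegral mu D (fun x => complex.Re (f x)) +i*
  Rintegral mu D (fun x => complex.Im (f x)).

Section SphericalFunctions.
Variables (R : realType) (F : base_field) (q : nat).

Definition Kinf_biinvariant (phi : infmx R F q -> R[i]) : Prop :=
  forall k k' g, Kinf R F q k -> Kinf R F q k' -> Ginf R F q g ->
    phi (infmul (infmul k g) k') = phi g.

Definition olshanski_spherical
    (mu : forall n, probability (borel 'M[scalars R F]_(q + n + q)) R)
    (phi : infmx R F q -> R[i]) : Prop :=
  [/\ {within Ginf R F q, continuous phi},
      Kinf_biinvariant phi,
      exists2 g, Ginf R F q g & phi g != 0 &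
      forall g h, Ginf R F q g -> Ginf R F q h ->
        (fun n => complex_integral (mu n) (group_K R F q n)
                    (fun k => phi (infmul (infmul g (embed k)) h))) @ \oo
        --> phi g * phi h].

Definition spherical (nu : probability (borel 'M[scalars R F]_q) R)
    (psi : 'M[scalars R F]_q -> R[i]) : Prop :=
  [/\ {within group_GL R F q, continuous psi},
      forall k k' g, group_U R F q k -> group_U R F q k' -> group_GL R F q g ->
        psi (k *m g *m k') = psi g,
      exists2 g, group_GL R F q g & psi g != 0 &
      forall g h, group_GL R F q g -> group_GL R F q h ->
        psi g * psi h = complex_integral nu (group_U R F q)
                          (fun k => psi (g *m k *m h))].

Definition corresponds (phi : infmx R F q -> R[i])
    (psi : 'M[scalars R F]_q -> R[i]) : Prop :=
  forall t, C_B t -> phi (a_inf F t) = psi (cosh_mx F t).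

End SphericalFunctions.

(* Main.v *)
Require Import Defs.
From HB Require Import structures.
From mathcomp Require Import all_boot all_order all_algebra.
From mathcomp Require Import complex ring lra zify perm.
From mathcomp Require Import all_classical all_reals all_analysis measurable_realfun.

Set Implicit Arguments.
Unset Strict Implicit.
Unset Printing Implicit Defensive.

Import Order.TTheory GRing.Theory Num.Theory.
Import numFieldNormedType.Exports.

Local Open Scope classical_set_scope.
Local Open Scope ring_scope.

(* A matrix g of G_n is determined up to K_n on both sides by its last q x q
   block E(g), and the blocks that occur are the E in G with |x E| >= |x| for
   all row vectors x, that is, E = V (cosh t) W with V, W in K.  Hence
   K_infinity-biinvariant functions are phi = f o E, with f a K-biinvariant
   function on these E, continuous because V (cosh t) W depends properly on
   (V, t, W).

   For k = diag(U, V) in K_n, E(g k h) = C U B + E(g) V E(h), where C and B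
   involve only boundedly many rows and columns of U.  The entries of U have
   second moment 1 / (q + n), so the first term tends to 0 in mean, and the
   distribution of V is the Haar measure of K.  The product formula of phi
   therefore says that f(E) f(E') is the integral of f(E V E') over K.  By
   restriction every spherical function of G/K gives such an f.  Conversely
   chi(r) = f(r 1) is multiplicative and nonzero on [1, +oo[, and
   psi(E) = f(r E) / chi(r), for r large, extends f to G. *)

(** The three fields are treated at once, and the quaternions dictate the tools: factors keep their
    order and there is no determinant. Hence lengths are measured by the real number [nsq x], Witt's
    theorem is proved with quasi-reflections, and determinants enter through a relation that is void
    over the quaternions. The block E determines the double coset because an isometry with lower row
    (C, E) satisfies E E* = 1 + C C*: the Gram matrix of C is known from E, and Witt's theorem moves
    one such C to another. The unitary matrix it yields must be corrected to determinant 1 without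
    touching C, which is possible because C has q rows, q + n columns and n >= 1. Over the reals G_n
    is an identity component; that it contains K_n comes from the connectedness of SO(N), and det E
    > 0 from a sign argument. Convergence in mean suffices for the limit, because the lower blocks
    of all products g k h lie in one compact set, where f is uniformly continuous. The extension psi
    inherits the product formula because scalar matrices are central. *)

Lemma nbhs_complexP (R : realType) (x : R[i]) (U : set R[i]) :
  nbhs x U <-> exists2 e : R, 0 < e &
    forall y, complex.Re (y - x) ^+ 2 + complex.Im (y - x) ^+ 2 < e -> U y.
Proof.
have E (y : R[i]) (e : R) : 0 < e ->
    (`|x - y| < (e%:C)%C) = (complex.Re (y - x) ^+ 2 + complex.Im (y - x) ^+ 2 < e ^+ 2).
  move=> e0; rewrite distrC -(ltr_pXn2r (ltn0Sn 1)) ?nnegrE ?lecR ?(ltW e0) //;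
    last by case: (y - x) => a b /=; rewrite sqrtr_ge0.
  by rewrite -add_Re2_Im2 -rmorphXn /= ltcR.
split.
  move=> /nbhs_ballP[e /= e0 eU]; exists (complex.Re e ^+ 2).
    by apply: exprn_gt0; move: e0; rewrite ltcE /= => /andP[].
  have eE : e = ((complex.Re e)%:C)%C.
    by move: e0; rewrite ltcE /=; case: (e) => a b /= /andP[/eqP-> _].
  have e0' : 0 < complex.Re e by move: e0; rewrite ltcE /= => /andP[].
  move=> y ye; apply: eU; rewrite /ball /= eE; rewrite E //.
move=> [e e0 eU]; apply/nbhs_ballP; exists ((Num.sqrt e)%:C)%C.
  by rewrite /= ltcR sqrtr_gt0.
move=> y; rewrite /ball /= => ye; apply: eU; move: ye.
by rewrite E ?sqrtr_gt0 // sqr_sqrtr // ltW.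
Qed.

(** * The scalars, their squared absolute value and their topology *)

Definition nsq (R : realType) (F : base_field) : scalars R F -> R :=
  match F with
  | Reals => fun x => x ^+ 2
  | Complexes => fun x => complex.Re x ^+ 2 + complex.Im x ^+ 2
  | Quaternions => fun x =>
      complex.Re x.1 ^+ 2 + complex.Im x.1 ^+ 2 + complex.Re x.2 ^+ 2 + complex.Im x.2 ^+ 2
  end.

Section Scalars.
Variables (R : realType) (F : base_field).
Local Notation T := (scalars R F).
Local Notation conj := (@conj_scalar R F).
Local Notation rs := (@real_scalar R F).
Local Notation nsq := (@nsq R F).
Implicit Types (x y : T) (a b : R).

Lemma conj_scalar_is_additive : zmod_morphism conj.
Proof.
case: F => x y //=; first exact: rmorphB.
by case: x y => [a b] [c d]; congr (_, _) => /=; rewrite ?rmorphB // opprD.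
Qed.

HB.instance Definition _ := GRing.isZmodMorphism.Build T T conj conj_scalar_is_additive.

Lemma conjM x y : conj (x * y) = conj y * conj x.
Proof.
move: x y; case: F => x y /=; first exact: mulrC.
- by rewrite rmorphM mulrC.
- case: x y => [a b] [c d]; rewrite /quat_conj /GRing.mul/= /quat_mul/=.
  rewrite !(rmorphD, rmorphN, rmorphM)/= !conjcK.
  by congr (_, _) => /=; ring.
Qed.

Lemma conjK x : conj (conj x) = x.
Proof.
move: x; case: F => x //=; first exact: conjcK.
by case: x => [a b]; rewrite /quat_conj /= conjcK opprK.
Qed.

Lemma conj1 : conj 1 = 1.
Proof.
case: F => //=; first exact: (rmorph1 conjc).
rewrite -[1]/(quat1 R) /quat_conj /= oppr0.
by congr (_, _); apply/eqP; rewrite eq_complex /= oppr0 !eqxx.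
Qed.

Lemma rs_is_additive : zmod_morphism rs.
Proof.
case: F => a b //=; first by rewrite rmorphB.
by rewrite rmorphB; congr (_, _); rewrite /= subr0.
Qed.

Lemma rs_is_monoid : monoid_morphism rs.
Proof.
case: F; split => //=.
- by move=> a b /=; rewrite rmorphM.
- move=> a b /=; rewrite [RHS]/GRing.mul/= /quat_mul/=.
  by congr (_, _); rewrite ?(rmorph0, mulr0, mul0r, subr0, addr0) // rmorphM.
Qed.

HB.instance Definition _ := GRing.isZmodMorphism.Build R T rs rs_is_additive.
HB.instance Definition _ := GRing.isMonoidMorphism.Build R T rs rs_is_monoid.

Lemma conj_rs a : conj (rs a) = rs a.
Proof.
case: F => //=; first by apply/eqP; rewrite eq_complex /= oppr0 !eqxx.
by congr (_, _); rewrite /= ?oppr0 //; apply/eqP; rewrite eq_complex /= oppr0 !eqxx.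
Qed.

Lemma rsC a x : rs a * x = x * rs a.
Proof.
move: x; case: F => x /=; [exact: mulrC|exact: mulrC|].
case: x => [z w]; rewrite /GRing.mul/= /quat_mul/=.
rewrite oppr0 -[(0 +i* 0)%C]/(0 : R[i]) -[(a +i* 0)%C]/((a%:C)%C : R[i]).
by rewrite !(mulr0, mul0r, subr0, addr0, add0r); congr (_, _); rewrite mulrC.
Qed.

Lemma rs_inj : injective rs.
Proof. by case: F => a b //= []. Qed.

Lemma mul_conj x : x * conj x = rs (nsq x).
Proof.
rewrite /nsq; move: x; case: F => x /=; first by rewrite expr2.
- case: x => a b /=; apply/eqP; rewrite eq_complex /=.
  by apply/andP; split; apply/eqP; ring.
- case: x => [[a b] [c d]]; rewrite /GRing.mul/= /quat_mul/=.
  by congr (_, _); apply/eqP; rewrite eq_complex /=; apply/andP; split; apply/eqP; ring.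
Qed.

Lemma nsq_conj x : nsq (conj x) = nsq x.
Proof.
rewrite /nsq; move: x; case: F => x //=.
- by case: x => a b /=; ring.
- by case: x => [[a b] [c d]] /=; ring.
Qed.

Lemma conj_mul x : conj x * x = rs (nsq x).
Proof. by rewrite -{2}(conjK x) mul_conj nsq_conj. Qed.

Lemma nsqM x y : nsq (x * y) = nsq x * nsq y.
Proof.
apply: rs_inj; rewrite rmorphM /= -mul_conj conjM mulrA -(mulrA x) mul_conj.
by rewrite -rsC -mulrA mul_conj -rmorphM mulrC rmorphM.
Qed.

Lemma nsq_ge0 x : 0 <= nsq x.
Proof.
rewrite /nsq; move: x; case: F => x //=; first exact: sqr_ge0.
- by rewrite addr_ge0 ?sqr_ge0.
- by rewrite !addr_ge0 ?sqr_ge0.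
Qed.

Lemma nsq_eq0 x : (nsq x == 0) = (x == 0).
Proof.
apply/eqP/eqP => [|->]; last first.
  by apply: rs_inj; rewrite -mul_conj mul0r rmorph0.
rewrite /nsq; move: x; case: F => x /=.
- by move/eqP; rewrite sqrf_eq0 => /eqP.
- case: x => a b /= /eqP; rewrite paddr_eq0 ?sqr_ge0 // !sqrf_eq0.
  by move=> /andP[/eqP-> /eqP->].
- case: x => [[a b] [c d]] /= /eqP.
  rewrite !paddr_eq0 ?addr_ge0 ?sqr_ge0 // !sqrf_eq0.
  by move=> /andP[/andP[/andP[/eqP-> /eqP->] /eqP->] /eqP->].
Qed.

Lemma nsq0 : nsq 0 = 0. Proof. by apply/eqP; rewrite nsq_eq0. Qed.

Lemma nsq_rs a : nsq (rs a) = a ^+ 2.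
Proof. by apply: rs_inj; rewrite -mul_conj conj_rs -rmorphM expr2. Qed.

Lemma nsqN x : nsq (- x) = nsq x.
Proof. by apply: rs_inj; rewrite -!mul_conj raddfN mulrNN. Qed.

Lemma nsq1 : nsq 1 = 1.
Proof. by apply: rs_inj; rewrite -mul_conj conj1 mulr1 rmorph1. Qed.

Lemma nsqD_le x y : nsq (x + y) <= 2 * (nsq x + nsq y).
Proof.
(* The parallelogram law; as [nsq] is a squared length, the resulting bound takes the place of the
   triangle inequality throughout. *)
have E : nsq (x + y) + nsq (x - y) = 2 * (nsq x + nsq y).
  rewrite /nsq; move: x y; case: F => x y /=.
  - by ring.
  - by case: x y => [a b] [c d] /=; ring.
  - by case: x y => [[a b] [c d]] [[a' b'] [c' d']] /=; ring.
by rewrite -E lerDl nsq_ge0.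
Qed.

(** Gives the three topologies, of which the quaternionic one is a product topology, a common
    description; with it convergence of scalars becomes convergence of real numbers to 0. *)
Lemma nbhs_nsqP x (U : set T) :
  nbhs x U <-> exists2 e : R, 0 < e & forall y, nsq (y - x) < e -> U y.
Proof.
rewrite /nsq; move: x U; case: F => /=.
- move=> x U; split.
    move=> /nbhs_ballP[e /= e0 eU]; exists (e ^+ 2); first exact: exprn_gt0.
    move=> y ye; apply: eU; rewrite /ball /= distrC -(ltr_pXn2r (ltn0Sn 1)) ?nnegrE ?(ltW e0) //.
    by rewrite real_normK ?num_real.
  move=> [e e0 eU]; apply/nbhs_ballP; exists (Num.sqrt e); rewrite /= ?sqrtr_gt0 //.
  move=> y; rewrite /ball /= => ye; apply: eU.
  rewrite -(sqr_sqrtr (ltW e0)) -real_normK ?num_real // distrC.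
  by rewrite ltr_pXn2r // nnegrE sqrtr_ge0.
- exact: nbhs_complexP.
- move=> [x1 x2] U /=; split.
    move=> [[A B] /= [/nbhs_complexP[e1 e10 h1] /nbhs_complexP[e2 e20 h2]] AB].
    exists (Num.min e1 e2); first by rewrite lt_min e10.
    move=> [y1 y2] /=; rewrite lt_min => /andP[l1 l2]; apply: AB; split => /=.
      apply: h1; apply: le_lt_trans l1; rewrite -addrA lerDl.
      by rewrite addr_ge0 ?sqr_ge0.
    apply: h2; apply: le_lt_trans l2; rewrite -addrA lerDr.
    by rewrite addr_ge0 ?sqr_ge0.
  move=> [e e0 h]; pose B (z : R[i]) := [set y : R[i] |
    complex.Re (y - z) ^+ 2 + complex.Im (y - z) ^+ 2 < e / 2].
  exists (B x1, B x2) => /=.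
    by split; apply/nbhs_complexP; exists (e / 2) => //; rewrite divr_gt0.
  move=> [y1 y2] [/= l1 l2]; apply: h => /=; rewrite -addrA [e]splitr.
  exact: ltrD.
Qed.

End Scalars.

Section ScalarTopology.
Variables (R : realType) (F : base_field).
Local Notation T := (scalars R F).
Local Notation conj := (@conj_scalar R F).
Local Notation rs := (@real_scalar R F).
Local Notation nsq := (@nsq R F).

Lemma cvg_nsqP {X : Type} (G : set_system X) {FG : Filter G} (f : X -> T) (l : T) :
  f x @[x --> G] --> l <-> nsq (f x - l) @[x --> G] --> (0 : R).
Proof.
split=> [fl|fl].
  apply/cvgrPdist_lt => e e0.
  have : nbhs l [set y | nsq (y - l) < e] by apply/nbhs_nsqP; exists e.
  move=> h; apply: (@filterS X G FG _ _ _ (fl _ h)) => x /=.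
  by rewrite sub0r normrN ger0_norm ?nsq_ge0.
move=> U /nbhs_nsqP[e e0 eU]; move/cvgrPdist_lt : fl => /(_ _ e0).
by apply: filterS => x; rewrite sub0r normrN ger0_norm ?nsq_ge0 //; exact: eU.
Qed.

Lemma squeeze0 {X : Type} (G : set_system X) {FG : Filter G} (f g : X -> R) :
  (forall z : X, 0 <= f z <= g z) -> g x @[x --> G] --> (0 : R) -> f x @[x --> G] --> (0 : R).
Proof.
move=> fg g0; apply: (@squeeze_cvgr _ _ _ _ (fun=> 0) g) => //.
  by near=> x; exact: fg.
exact: cvg_cst.
Unshelve. all: by end_near. Qed.

Lemma cvgTD {X : Type} (G : set_system X) {FG : Filter G} (f g : X -> T) (a b : T) :
  f x @[x --> G] --> a -> g x @[x --> G] --> b -> f x + g x @[x --> G] --> a + b.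
Proof.
move=> /cvg_nsqP fa /cvg_nsqP gb; apply/cvg_nsqP.
apply: (@squeeze0 X G FG _ (fun x => 2 * (nsq (f x - a) + nsq (g x - b)))).
  by move=> x; rewrite nsq_ge0 /= opprD addrACA nsqD_le.
rewrite -[0](mulr0 2) -[X in 2 * X](addr0 0).
by apply: cvgMr; exact: cvgD.
Qed.

Lemma cvgTM {X : Type} (G : set_system X) {FG : Filter G} (f g : X -> T) (a b : T) :
  f x @[x --> G] --> a -> g x @[x --> G] --> b -> f x * g x @[x --> G] --> a * b.
Proof.
move=> /cvg_nsqP fa /cvg_nsqP gb; apply/cvg_nsqP.
apply: (@squeeze0 X G FG _ (fun x => 2 * (nsq (f x - a) * (2 * (nsq (g x - b) + nsq b)) +
   nsq a * nsq (g x - b)))).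
  move=> x; rewrite nsq_ge0 /=.
  (* Both summands keep the order of the factors; [nsq (g x)] is then bounded through
     [g x = (g x - b) + b]. *)
  have -> : f x * g x - a * b = (f x - a) * g x + a * (g x - b).
    by rewrite mulrBl mulrBr addrA subrK.
  apply: le_trans (nsqD_le _ _) _; rewrite ler_pM2l // !nsqM lerD2r.
  by rewrite ler_wpM2l ?nsq_ge0 // -{1}[g x](subrK b) nsqD_le.
rewrite -[0](mulr0 2) -[X in 2 * X](addr0 0); apply: cvgMr; apply: cvgD.
  rewrite -[0 in X in _ --> X](mul0r (2 * (0 + nsq b))); apply: cvgM => //.
  apply: cvgMr; apply: cvgD => //; exact: cvg_cst.
by rewrite -[0](mulr0 (nsq a)); exact: cvgMr.
Qed.

Lemma cvg_conj {X : Type} (G : set_system X) {FG : Filter G} (f : X -> T) (a : T) :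
  f x @[x --> G] --> a -> conj (f x) @[x --> G] --> conj a.
Proof.
move=> /cvg_nsqP fa; apply/cvg_nsqP.
by under eq_fun do rewrite -raddfB nsq_conj.
Qed.

Lemma cvg_rs {X : Type} (G : set_system X) {FG : Filter G} (f : X -> R) (a : R) :
  f x @[x --> G] --> a -> rs (f x) @[x --> G] --> rs a.
Proof.
move=> fa; apply/cvg_nsqP.
under eq_fun do rewrite -rmorphB nsq_rs expr2.
rewrite -[0](mulr0 0); apply: cvgM; rewrite -[0](subrr a); apply: cvgB => //; exact: cvg_cst.
Qed.

Lemma cvg_nsq {X : Type} (G : set_system X) {FG : Filter G} (f : X -> T) (a : T) :
  f x @[x --> G] --> a -> nsq (f x) @[x --> G] --> nsq a.
Proof.
move=> fa; have := @cvgTM X G FG _ _ _ _ fa (@cvg_conj X G FG _ _ fa); rewrite mul_conj.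
under eq_fun do rewrite mul_conj.
(* From the scalars back to the reals: the [nsq] of a difference of two real scalars is the square
   of the real difference. *)
move=> /cvg_nsqP; under eq_fun do rewrite -rmorphB nsq_rs.
move=> h; apply/cvgrPdist_lt => e e0.
move/cvgrPdist_lt : h => /(_ _ (exprn_gt0 2 e0)); apply: filterS => x.
rewrite sub0r normrN normrX ltr_pXn2r ?nnegrE ?(ltW e0) //.
by rewrite distrC.
Qed.

Lemma nsq_continuous : continuous nsq.
Proof. by move=> x; apply: cvg_nsq; exact: cvg_id. Qed.

Lemma scalars_ball_closed (M : R) : closed [set x : T | nsq x <= M].
Proof.
apply: (@closed_comp _ _ nsq [set y | y <= M]) => [x _|]; last exact: closed_le.
exact: nsq_continuous.
Qed.

End ScalarTopology.

(** A closed part of a segment over the reals, the continuous image of a closed part of a square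
    over the complexes, a closed part of a product of two discs over the quaternions. *)
Lemma scalars_ball_compact (R : realType) (F : base_field) (M : R) :
  compact [set x : scalars R F | nsq x <= M].
Proof.
have cR : compact [set x : R | x ^+ 2 <= M].
  apply: (@subclosed_compact _ _ `[- Num.sqrt M, Num.sqrt M]%classic).
  - apply: (@closed_comp _ _ (fun x : R => x ^+ 2) [set y | y <= M]) => [x _|].
      exact: exprn_continuous.
    exact: closed_le.
  - exact: segment_compact.
  - move=> x /= h; rewrite in_itv /= -ler_norml -sqrtr_sqr.
    exact: ler_wsqrtr.
have cC : compact [set x : R[i] | complex.Re x ^+ 2 + complex.Im x ^+ 2 <= M].
  pose f (p : R * R) : R[i] := (p.1 +i* p.2)%C.
  have fc : continuous f.
    move=> p U /nbhs_complexP[e e0 h].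
    have : (fun q : R * R => (q.1 - p.1) ^+ 2 + (q.2 - p.2) ^+ 2) @ p --> (0 : R).
      have h1 (g : R * R -> R) : continuous g -> (g q - g p) ^+ 2 @[q --> p] --> (0 : R).
        move=> gc; rewrite -[0](mulr0 0); apply: cvgM; rewrite -(subrr (g p));
        by apply: cvgB; [exact: gc|exact: cvg_cst].
      by rewrite -[0](addr0 0); apply: cvgD; apply: h1 => r; [exact: cvg_fst|exact: cvg_snd].
    move=> /cvgrPdist_lt /(_ e e0); apply: filterS => q.
    rewrite sub0r normrN => hq; apply: h => /=; apply: le_lt_trans hq.
    exact: ler_norm.
  have -> : [set x : R[i] | complex.Re x ^+ 2 + complex.Im x ^+ 2 <= M] =
     f @` (([set x : R | x ^+ 2 <= M] `*` [set x : R | x ^+ 2 <= M]) `&`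
       [set p | p.1 ^+ 2 + p.2 ^+ 2 <= M]).
    apply/seteqP; split=> [[a b] /= h|x /= [[a b] [[/= _ _] h] <-]] //.
    exists (a, b) => //; split => //=; split => /=; apply: le_trans h;
      rewrite ?lerDl ?lerDr sqr_ge0 //.
  apply: continuous_compact; first exact: continuous_subspaceT.
  apply: compact_closedI; first exact: compact_setX.
  apply: (@closed_comp _ _ (fun p : R * R => p.1 ^+ 2 + p.2 ^+ 2) [set y | y <= M]) => [p _|].
    by apply: cvgD; apply: cvgM; (exact: cvg_fst || exact: cvg_snd).
  exact: closed_le.
case: F => //=.
apply: (@subclosed_compact _ _ ([set x : R[i] | complex.Re x ^+ 2 + complex.Im x ^+ 2 <=
  M] `*` [set x : R[i] | complex.Re x ^+ 2 + complex.Im x ^+ 2 <= M])).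
- exact: (@scalars_ball_closed R Quaternions M).
- exact: compact_setX.
- move=> [x y] /= h; split => /=; apply: le_trans h.
   by rewrite -addrA lerDl addr_ge0 ?sqr_ge0.
  by rewrite -addrA lerDr addr_ge0 ?sqr_ge0.
Qed.

(** * Matrices over the scalars, unitary matrices and Witt's theorem *)

Section Matrices.
Variables (R : realType) (F : base_field).
Local Notation T := (scalars R F).
Local Notation conj := (@conj_scalar R F).
Local Notation rs := (@real_scalar R F).
Local Notation nsq := (@nsq R F).

(** The version of [adj] for rectangular matrices, needed for single rows and for the blocks of a
    group element. *)
Definition ct m n (A : 'M[T]_(m, n)) : 'M[T]_(n, m) := (map_mx conj A)^T.

Lemma adjE n (A : 'M[T]_n) : adj A = ct A. Proof. by []. Qed.

Lemma ctE m n (A : 'M[T]_(m, n)) i j : ct A i j = conj (A j i).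
Proof. by rewrite !mxE. Qed.

Lemma ctM m n p (A : 'M[T]_(m, n)) (B : 'M[T]_(n, p)) : ct (A *m B) = ct B *m ct A.
Proof.
apply/matrixP => i j; rewrite ctE !mxE raddf_sum.
by apply: eq_bigr => k _; rewrite !ctE /= conjM.
Qed.

Lemma ctK m n (A : 'M[T]_(m, n)) : ct (ct A) = A.
Proof. by apply/matrixP => i j; rewrite !ctE conjK. Qed.

Lemma ct_is_additive m n : zmod_morphism (@ct m n).
Proof. by move=> A B; apply/matrixP => i j; rewrite !mxE raddfB. Qed.

HB.instance Definition _ m n :=
  GRing.isZmodMorphism.Build 'M[T]_(m, n) 'M[T]_(n, m) (@ct m n) (@ct_is_additive m n).

Lemma ctB m n (A B : 'M[T]_(m, n)) : ct (A - B) = ct A - ct B.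
Proof. exact: raddfB. Qed.

Lemma ct_scalar n a : ct (a%:M : 'M[T]_n) = (conj a)%:M.
Proof. by apply/matrixP => i j; rewrite !mxE eq_sym raddfMn. Qed.

Lemma ct1 n : ct (1%:M : 'M[T]_n) = 1%:M.
Proof. by rewrite ct_scalar conj1. Qed.

Lemma ct_block m1 m2 n1 n2 (A : 'M[T]_(m1, n1)) B C (D : 'M[T]_(m2, n2)) :
  ct (block_mx A B C D) = block_mx (ct A) (ct C) (ct B) (ct D).
Proof. by rewrite /ct map_block_mx tr_block_mx. Qed.

Lemma mx_rsC m n (A : 'M[T]_(m, n)) a : A *m (rs a)%:M = (rs a)%:M *m A.
Proof.
apply/matrixP => i j; rewrite !mxE (bigD1 j) //= (bigD1 i) //= !mxE !eqxx !mulr1n.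
rewrite rsC !big1 ?addr0 // => k kn; rewrite !mxE.
  by rewrite eq_sym (negbTE kn) mulr0n mul0r.
by rewrite (negbTE kn) mulr0n mulr0.
Qed.

(** The square of the Frobenius norm; for a row, its squared Euclidean length. *)
Definition fro m n (A : 'M[T]_(m, n)) : R := \sum_i \sum_j nsq (A i j).

Lemma fro_ge0 m n (A : 'M[T]_(m, n)) : 0 <= fro A.
Proof. by apply: sumr_ge0 => i _; apply: sumr_ge0 => j _; exact: nsq_ge0. Qed.

Lemma nsq_le_fro m n (A : 'M[T]_(m, n)) i j : nsq (A i j) <= fro A.
Proof.
rewrite /fro (bigD1 i) //= (bigD1 j) //= -addrA lerDl addr_ge0 //.
  by apply: sumr_ge0 => k _; exact: nsq_ge0.
by apply: sumr_ge0 => k _; apply: sumr_ge0 => l _; exact: nsq_ge0.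
Qed.

Lemma fro_eq0 m n (A : 'M[T]_(m, n)) : (fro A == 0) = (A == 0).
Proof.
apply/eqP/eqP => [A0|->]; last first.
  by rewrite /fro big1 // => i _; rewrite big1 // => j _; rewrite mxE nsq0.
apply/matrixP => i j; rewrite mxE; apply/eqP; rewrite -nsq_eq0 eq_le nsq_ge0 andbT.
by rewrite -A0 nsq_le_fro.
Qed.

Lemma fro0 m n : fro (0 : 'M[T]_(m, n)) = 0.
Proof. by apply/eqP; rewrite fro_eq0. Qed.

Lemma froN m n (A : 'M[T]_(m, n)) : fro (- A) = fro A.
Proof. by apply: eq_bigr => i _; apply: eq_bigr => j _; rewrite mxE nsqN. Qed.

Lemma fro_ct m n (A : 'M[T]_(m, n)) : fro (ct A) = fro A.
Proof.
rewrite /fro exchange_big; apply: eq_bigr => i _; apply: eq_bigr => j _.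
by rewrite ctE nsq_conj.
Qed.

Lemma froD_le m n (A B : 'M[T]_(m, n)) : fro (A + B) <= 2 * (fro A + fro B).
Proof.
rewrite /fro -big_split mulr_sumr; apply: ler_sum => i _ /=.
rewrite -big_split mulr_sumr; apply: ler_sum => j _ /=.
by rewrite mxE nsqD_le.
Qed.

Lemma fro_row m n (A : 'M[T]_(m, n)) : fro A = \sum_i fro (row i A).
Proof.
apply: eq_bigr => i _; rewrite /fro big_ord1.
by apply: eq_bigr => j _; rewrite mxE.
Qed.

(** One factor 2 per summand, from repeated use of [nsqD_le]. *)
Lemma nsq_sum_le (I : Type) (r : seq I) (f : I -> T) :
  nsq (\sum_(i <- r) f i) <= 2 ^+ size r * \sum_(i <- r) nsq (f i).
Proof.
elim: r => [|a r IH]; first by rewrite !big_nil nsq0 mulr0.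
rewrite !big_cons /= exprS -mulrA; apply: le_trans (nsqD_le _ _) _.
rewrite ler_pM2l // mulrDr; apply: lerD => //.
by rewrite ler_peMl ?nsq_ge0 // exprn_ege1 // ler1n.
Qed.

(** The constant depends on the inner dimension only, which in the estimates below is q or q + m and
    stays fixed while the groups grow. *)
Lemma froM_le m n p (A : 'M[T]_(m, n)) (B : 'M[T]_(n, p)) :
  fro (A *m B) <= 2 ^+ n * (fro A * fro B).
Proof.
rewrite /fro mulr_suml mulr_sumr; apply: ler_sum => i _.
rewrite exchange_big /= !mulr_sumr; apply: ler_sum => j _.
rewrite mxE; apply: le_trans (nsq_sum_le _ _) _.
rewrite [X in X <= _](_ : _ = 2 ^+ n * \sum_(k < n) nsq (A i k) * nsq (B k j)); last first.
  congr (2 ^+ _ * _); last by apply: eq_bigr => k _; rewrite nsqM.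
  by rewrite /index_enum -enumT size_enum_ord.
rewrite ler_pM2l ?exprn_gt0 // mulr_sumr; apply: ler_sum => k _.
rewrite ler_wpM2r ?nsq_ge0 // (bigD1 k) //= lerDl.
by apply: sumr_ge0 => l _; exact: nsq_ge0.
Qed.

Lemma mul_ct_rV n (x : 'rV[T]_n) : x *m ct x = (rs (fro x))%:M.
Proof.
apply/matrixP => i j; rewrite !ord1 !mxE /fro big_ord1 raddf_sum eqxx mulr1n.
by apply: eq_bigr => k _; rewrite ctE mul_conj.
Qed.

Lemma fro_unitr m n (A : 'M[T]_(m, n)) (U : 'M[T]_n) : U *m ct U = 1%:M ->
  fro (A *m U) = fro A.
Proof.
move=> UU; rewrite !fro_row; apply: eq_bigr => i _; apply: (@rs_inj R F).
have E (x : 'rV[T]_n) : rs (fro x) = (x *m ct x) 0 0.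
  by rewrite mul_ct_rV mxE eqxx mulr1n.
by rewrite row_mul !E ctM mulmxA -(mulmxA _ U) UU mulmx1.
Qed.

Lemma fro_unitl m n (A : 'M[T]_(m, n)) (U : 'M[T]_m) : ct U *m U = 1%:M ->
  fro (U *m A) = fro A.
Proof.
by move=> UU; rewrite -fro_ct ctM fro_unitr ?fro_ct // ctK.
Qed.

Lemma fro_rs m n (A : 'M[T]_(m, n)) a : fro ((rs a)%:M *m A) = a ^+ 2 * fro A.
Proof.
rewrite /fro mulr_sumr; apply: eq_bigr => i _; rewrite mulr_sumr; apply: eq_bigr => j _.
rewrite mxE (bigD1 i) //= !mxE eqxx mulr1n big1 ?addr0 ?nsqM ?nsq_rs // => k kn.
by rewrite !mxE eq_sym (negbTE kn) mulr0n mul0r.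
Qed.

Lemma unitaryE n (U : 'M[T]_n) :
  unitary R F n U <-> ct U *m U = 1%:M /\ U *m ct U = 1%:M.
Proof.
rewrite /unitary /isometries /= adjE mulmx1; split.
  move=> [[h [Uh hU]] UU]; split=> //.
  suff -> : ct U = h by [].
  by rewrite -[ct U]mulmx1 -Uh mulmxA UU mul1mx.
by move=> [U1 U2]; split => //; exists (ct U).
Qed.

Lemma unitary1 n : unitary R F n 1%:M.
Proof. by apply/unitaryE; rewrite ct1 mulmx1. Qed.

Lemma unitaryM n (U V : 'M[T]_n) : unitary R F n U -> unitary R F n V ->
  unitary R F n (U *m V).
Proof.
move=> /unitaryE[U1 U2] /unitaryE[V1 V2]; apply/unitaryE; rewrite ctM; split.
  by rewrite mulmxA -(mulmxA (ct V)) U1 mulmx1.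
by rewrite mulmxA -(mulmxA U) V2 mulmx1.
Qed.

Lemma unitary_ct n (U : 'M[T]_n) : unitary R F n U -> unitary R F n (ct U).
Proof. by move=> /unitaryE[U1 U2]; apply/unitaryE; rewrite ctK. Qed.

(* When x and y have the same norm, u = x - y and b is the inverse of the
   scalar product of x and u, this matrix maps x to y; it replaces the
   reflections, which are not enough over the complexes and quaternions. *)
Definition qrefl n (u : 'rV[T]_n) (b : T) : 'M[T]_n := 1%:M - ct u *m b%:M *m u.

(** In Q Q* with Q = 1 - u* b u, the quadratic term is u* |u|^2 |b|^2 u and the linear ones add up
    to - u* (b + conj b) u; the hypothesis makes them cancel. As Q* is the same expression with conj
    b in place of b, the product in the other order follows. *)
Lemma qrefl_unitary n (u : 'rV[T]_n) (b : T) :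
  b + conj b = rs (fro u * nsq b) -> unitary R F n (qrefl u b).
Proof.
have E (w : 'rV[T]_n) (c : T) : c + conj c = rs (fro w * nsq c) ->
    qrefl w c *m ct (qrefl w c) = 1%:M.
  move=> cc; rewrite /qrefl raddfB /= ct1 !ctM ct_scalar ctK -mulmxA.
  rewrite mulmxBl mul1mx mulmxBr mulmx1.
  have -> : ct w *m (c%:M *m w) *m (ct w *m ((conj c)%:M *m w)) =
     ct w *m ((rs (fro w * nsq c))%:M *m w).
    rewrite -!mulmxA; congr (_ *m _); rewrite !mulmxA; congr (_ *m _).
    rewrite -(mulmxA _ w) mul_ct_rV mx_rsC -mulmxA -scalar_mxM mul_conj.
    by rewrite rmorphM scalar_mxM.
  have -> : (rs (fro w * nsq c))%:M = (conj c)%:M + c%:M :> 'M[T]_1.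
    by rewrite -cc addrC -raddfD.
  by rewrite mulmxDl mulmxDr opprB addrK subrK.
move=> bb; apply/unitaryE; split; last exact: E.
have -> : qrefl u b = ct (qrefl u (conj b)).
  by rewrite /qrefl raddfB /= ct1 !ctM ct_scalar ctK conjK mulmxA.
by rewrite ctK E // conjK addrC bb nsq_conj.
Qed.

Lemma row_ct m n p (A : 'M[T]_(m, n)) (B : 'M[T]_(p, n)) i j :
  (A *m ct B) i j = (row i A *m ct (row j B)) 0 0.
Proof. by rewrite !mxE; apply: eq_bigr => k _; rewrite !mxE. Qed.

(** The rows of C are moved to those of C' one after the other. With u = x - y for the current row x
    and its target y, the rows already in place are orthogonal to u because the Gram matrices agree,
    so the quasi-reflection along u keeps them. The predicate [P] records how the matrix is built
    up, which serves for the connectedness of SO. *)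
Lemma witt m n (P : 'M[T]_n -> Prop) (C C' : 'M[T]_(m, n)) : P 1%:M ->
  (forall A u b, b + conj b = rs (fro u * nsq b) -> P A -> P (A *m qrefl u b)) ->
  C *m ct C = C' *m ct C' ->
  exists U, [/\ P U, unitary R F n U & C *m U = C'].
Proof.
move=> P1 PQ CC.
suff /(_ m (leqnn m))[U [PU uU CU]] : forall k, (k <= m)%N -> exists U,
    [/\ P U, unitary R F n U &
      forall i : 'I_m, (i < k)%N -> row i (C *m U) = row i C'].
  by exists U; split => //; apply/row_matrixP => i; exact: CU.
elim=> [_|k IH km]; first by exists 1%:M; split => //; exact: unitary1.
have [U [PU uU CU]] := IH (ltnW km).
pose k' := Ordinal km; pose x := row k' (C *m U); pose y := row k' C'.
have CC' : (C *m U) *m ct (C *m U) = C' *m ct C'.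
  by have /unitaryE[_ U2] := uU; rewrite ctM mulmxA -(mulmxA C) U2 mulmx1.
have [xy|xy] := eqVneq x y.
  exists U; split => // i; rewrite ltnS leq_eqVlt => /orP[/eqP ik|]; last exact: CU.
  by have -> : i = k' by exact: val_inj.
pose u := x - y; pose a := (x *m ct u) 0 0.
have xE : fro x = fro y.
  apply: (@rs_inj R F); have := congr1 (fun M : 'M[T]_m => M k' k') CC'.
  by rewrite /= [in LHS]row_ct [in RHS]row_ct !mul_ct_rV !mxE eqxx !mulr1n.
have aM : x *m ct u = a%:M by rewrite [LHS]mx11_scalar.
(* Since x and y have equal length, a + conj a is |u|^2. So a is nonzero, and its inverse b
   satisfies the condition of [qrefl_unitary]. *)
have aa : a + conj a = rs (fro u).
  have -> : conj a = (u *m ct x) 0 0 by rewrite -[in RHS](ctK u) -ctM ctE.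
  have E (w : 'rV[T]_n) : rs (fro w) = (w *m ct w) 0 0.
    by rewrite mul_ct_rV mxE eqxx mulr1n.
  rewrite E /a; have -> : (x *m ct u) 0 0 + (u *m ct x) 0 0 = (x *m ct u + u *m ct x) 0 0.
    by rewrite [RHS]mxE.
  congr (fun_of_matrix _ 0 0).
  rewrite /u ctB !mulmxBl !mulmxBr.
  by rewrite !mul_ct_rV xE opprB.
have u0 : fro u != 0 by rewrite fro_eq0 subr_eq0.
have a0 : nsq a != 0.
  rewrite nsq_eq0; apply: contra_neq u0 => a0; apply: (@rs_inj R F).
  by rewrite -aa a0 !raddf0 addr0.
pose b := rs (nsq a)^-1 * conj a.
have bb : b + conj b = rs (fro u * nsq b).
  rewrite /b conjM conjK conj_rs -rsC -mulrDr addrC aa nsqM nsq_conj nsq_rs.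
  by rewrite -rmorphM; congr rs; field.
have ab : a * b = 1.
  by rewrite /b rsC mulrA mul_conj -rmorphM divff // rmorph1.
exists (U *m qrefl u b); split => //.
- exact: PQ.
- by apply: unitaryM => //; exact: qrefl_unitary.
move=> i; rewrite ltnS leq_eqVlt mulmxA row_mul /qrefl mulmxBr mulmx1 => /orP[/eqP ik|ik].
  have -> : i = k' by exact: val_inj.
  rewrite -/x !mulmxA aM -scalar_mxM ab mul1mx /u opprB addrC subrK //.
rewrite CU //; suff -> : row i C' *m (ct u *m b%:M *m u) = 0 by rewrite subr0.
rewrite !mulmxA; suff -> : row i C' *m ct u = 0 by rewrite !mul0mx.
rewrite /u ctB mulmxBr; apply/eqP; rewrite subr_eq0; apply/eqP.
rewrite -{1}(CU i ik); apply/matrixP => j l; rewrite !ord1.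
by rewrite -!row_ct CC'.
Qed.

End Matrices.

(** * Topology of matrices and compactness of the unitary groups *)

Section MatrixTopology.
Variables (R : realType) (F : base_field).
Local Notation T := (scalars R F).
Local Notation rs := (@real_scalar R F).
Local Notation nsq := (@nsq R F).

Lemma cvg_mxP {X : Type} (G : set_system X) {FG : Filter G} m n
    (f : X -> 'M[T]_(m, n)) (A : 'M[T]_(m, n)) :
  f x @[x --> G] --> A <-> forall i j, f x i j @[x --> G] --> A i j.
Proof.
split=> [fA i j U UA|fA U [P /= PA PU]].
  apply: (fA [set M : 'M[T]_(m, n) | U (M i j)]).
  exists (fun k l => if (k == i) && (l == j) then U else setT) => [k l|M /=].
    by case: ifP => [/andP[/eqP-> /eqP->] //|_]; exact: filterT.
  by move=> /(_ i j); rewrite !eqxx.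
apply: (@filterS X G FG [set x | forall ij : 'I_m * 'I_n, P ij.1 ij.2 (f x ij.1 ij.2)]).
  by move=> x h; apply: PU => i j; exact: (h (i, j)).
by apply: filter_forall => -[i j]; exact: (fA i j _ (PA i j)).
Qed.

Lemma cvg_mx_entry {X : Type} (G : set_system X) {FG : Filter G} m n
    (f : X -> 'M[T]_(m, n)) (A : 'M[T]_(m, n)) i j :
  f x @[x --> G] --> A -> f x i j @[x --> G] --> A i j.
Proof. by move=> /cvg_mxP. Qed.

Lemma cvg_sumT {X : Type} (G : set_system X) {FG : Filter G} (I : Type) (r : seq I)
    (f : I -> X -> T) (a : I -> T) :
  (forall i, f i x @[x --> G] --> a i) ->
  \sum_(i <- r) f i x @[x --> G] --> \sum_(i <- r) a i.
Proof.
move=> fa; elim: r => [|i r IH].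
  by under eq_fun do rewrite big_nil; rewrite big_nil; exact: cvg_cst.
by under eq_fun do rewrite big_cons; rewrite big_cons; exact: cvgTD.
Qed.

Lemma cvg_mulmx {X : Type} (G : set_system X) {FG : Filter G} m n p
    (f : X -> 'M[T]_(m, n)) (g : X -> 'M[T]_(n, p)) (A : 'M[T]_(m, n)) (B : 'M[T]_(n, p)) :
  f x @[x --> G] --> A -> g x @[x --> G] --> B -> f x *m g x @[x --> G] --> A *m B.
Proof.
move=> fA gB; apply/cvg_mxP => i j; rewrite mxE; under eq_fun do rewrite mxE.
by apply: cvg_sumT => k; apply: cvgTM; exact: cvg_mx_entry.
Qed.

Lemma cvg_addmx {X : Type} (G : set_system X) {FG : Filter G} m n
    (f g : X -> 'M[T]_(m, n)) (A B : 'M[T]_(m, n)) :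
  f x @[x --> G] --> A -> g x @[x --> G] --> B -> f x + g x @[x --> G] --> A + B.
Proof.
move=> fA gB; apply/cvg_mxP => i j; rewrite mxE; under eq_fun do rewrite mxE.
by apply: cvgTD; exact: cvg_mx_entry.
Qed.

Lemma cvg_oppmx {X : Type} (G : set_system X) {FG : Filter G} m n
    (f : X -> 'M[T]_(m, n)) (A : 'M[T]_(m, n)) :
  f x @[x --> G] --> A -> - f x @[x --> G] --> - A.
Proof.
move=> fA; apply/cvg_mxP => i j; rewrite mxE; under eq_fun do rewrite mxE.
have /cvg_nsqP h := @cvg_mx_entry X G FG m n f A i j fA; apply/cvg_nsqP.
by under eq_fun do rewrite -opprD nsqN.
Qed.

Lemma cvg_rs_mx {X : Type} (G : set_system X) {FG : Filter G} n (f : X -> R) (a : R) :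
  f x @[x --> G] --> a -> (rs (f x))%:M @[x --> G] --> ((rs a)%:M : 'M[T]_n).
Proof.
move=> fa; apply/cvg_mxP => i j; rewrite mxE; under eq_fun do rewrite mxE.
case: (i == j); last by under eq_fun do rewrite mulr0n; rewrite mulr0n; exact: cvg_cst.
by under eq_fun do rewrite mulr1n; rewrite mulr1n; exact: cvg_rs.
Qed.

Lemma cvg_ct {X : Type} (G : set_system X) {FG : Filter G} m n
    (f : X -> 'M[T]_(m, n)) (A : 'M[T]_(m, n)) :
  f x @[x --> G] --> A -> ct (f x) @[x --> G] --> ct A.
Proof.
move=> fA; apply/cvg_mxP => i j; rewrite ctE; under eq_fun do rewrite ctE.
by apply: cvg_conj; exact: cvg_mx_entry.
Qed.

Lemma cvg_fro {X : Type} (G : set_system X) {FG : Filter G} m n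
    (f : X -> 'M[T]_(m, n)) (A : 'M[T]_(m, n)) :
  f x @[x --> G] --> A -> fro (f x) @[x --> G] --> fro A.
Proof.
move=> fA; have S (I : Type) (r : seq I) (h : I -> X -> R) (a : I -> R) :
    (forall i, h i x @[x --> G] --> a i) ->
    \sum_(i <- r) h i x @[x --> G] --> \sum_(i <- r) a i.
  move=> ha; elim: r => [|i r IH].
    by under eq_fun do rewrite big_nil; rewrite big_nil; exact: cvg_cst.
  by under eq_fun do rewrite big_cons; rewrite big_cons; exact: cvgD.
by apply: (S) => i; apply: (S) => j; apply: cvg_nsq; exact: cvg_mx_entry.
Qed.

Lemma fro_continuous m n : continuous (@fro R F m n).
Proof. by move=> A; apply: (@cvg_fro _ (nbhs A)); exact: cvg_id. Qed.

Lemma closed_fro_le m n (f : 'M[T]_(m, n) -> R) (M : R) : continuous f ->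
  closed [set A | f A <= M].
Proof.
move=> fc; apply: (@closed_comp _ _ f [set y | y <= M]) => [x _|]; last exact: closed_le.
exact: fc.
Qed.

Lemma mx_hausdorff m n : hausdorff_space 'M[T]_(m, n).
Proof.
rewrite open_hausdorff => A B AB.
have h0 : 0 < fro (A - B) by rewrite lt_neqAle fro_ge0 eq_sym fro_eq0 subr_eq0 AB.
pose U (C : 'M[T]_(m, n)) := [set D : 'M[T]_(m, n) | fro (D - C) < fro (A - B) / 4].
have oU C : open (U C).
  apply: (@open_comp _ _ (fun D : 'M[T]_(m, n) => fro (D - C)) [set y : R | y < fro (A - B) /
    4]); last exact: open_lt.
  by move=> D _; apply: (@cvg_fro _ (nbhs D)); apply: cvg_addmx; [exact: cvg_id|exact: cvg_cst].
have CU C : C \in U C by rewrite inE /U /= subrr fro0 divr_gt0.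
exists (U A, U B) => //; split => //=; apply/eqP; rewrite predeqE => D; split => //= -[] /= h1 h2.
(* The radii are a quarter of [fro (A - B)] because [froD_le] costs a factor 2. *)
have : fro (A - B) < fro (A - B).
  rewrite -{1}[A](subrK D) -addrA; apply: le_lt_trans (froD_le _ _) _.
  by rewrite -(froN (A - D)) opprB; rewrite /U /= in h1 h2; lra.
by rewrite ltxx.
Qed.

Lemma mx_ball_compact m n (M : R) :
  compact [set A : 'M[T]_(m, n) | forall i j, nsq (A i j) <= M].
Proof.
have cV := @rV_compact T (m * n) (fun=> [set x : T | nsq x <= M])
  (fun=> @scalars_ball_compact R F M).
have -> : [set A : 'M[T]_(m, n) | forall i j, nsq (A i j) <= M] =
   vec_mx @` [set v : 'rV[T]_(m * n) | forall i, nsq (v ord0 i) <= M].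
  apply/seteqP; split=> [A /= h|_ /= [v h <-] i j]; last by rewrite mxE.
  exists (mxvec A); last exact: mxvecK.
  by move=> k; case/mxvec_indexP: k => i j; rewrite mxvecE.
apply: continuous_compact cV; apply: continuous_subspaceT => v.
apply/(@cvg_mxP _ (nbhs v)) => i j; rewrite mxE; under eq_fun do rewrite mxE.
by apply: (@cvg_mx_entry _ (nbhs v)); exact: cvg_id.
Qed.

Lemma bounded_closed_mx_compact m n (S : set 'M[T]_(m, n)) (M : R) :
  closed S -> (forall A, S A -> fro A <= M) -> compact S.
Proof.
move=> cS SM; apply: subclosed_compact cS (@mx_ball_compact m n M) _ => A /SM AM i j.
exact: le_trans (nsq_le_fro _ _ _) AM.
Qed.

Lemma fro_unitary n (U : 'M[T]_n) : unitary R F n U -> fro U = n%:R.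
Proof.
move=> /unitaryE[_ UU]; rewrite -[U]mul1mx fro_unitr // /fro.
rewrite (eq_bigr (fun=> 1)) => [|i _]; first by rewrite sumr_const card_ord.
rewrite (bigD1 i) //= mxE eqxx nsq1 big1 ?addr0 // => j ji.
by rewrite mxE eq_sym (negbTE ji) nsq0.
Qed.

Lemma unitary_compact n : compact (unitary R F n).
Proof.
apply: (@bounded_closed_mx_compact _ _ _ n%:R); last first.
  by move=> U /fro_unitary->.
(* Nonnegative, so that its zero set is closed as a sublevel set. *)
pose f (U : 'M[T]_n) := fro (ct U *m U - 1%:M) + fro (U *m ct U - 1%:M).
have -> : unitary R F n = [set U | f U <= 0].
  apply/seteqP; split=> U /=; rewrite /f.
    by move/unitaryE => [-> ->]; rewrite !subrr fro0 addr0.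
  move=> h; have h1 := fro_ge0 (ct U *m U - 1%:M); have h2 := fro_ge0 (U *m ct U - 1%:M).
  by apply/unitaryE; split; apply/eqP; rewrite -subr_eq0 -fro_eq0 eq_le fro_ge0 andbT; lra.
apply: closed_fro_le => U; apply: (@cvgD _ _ _ (nbhs U)).
  apply: (@cvg_fro _ (nbhs U) _ _ _ (fun U : 'M[T]_n => ct U *m U - 1%:M)).
  apply: cvg_addmx; last exact: cvg_cst.
  by apply: (@cvg_mulmx _ (nbhs U)); [apply: (@cvg_ct _ (nbhs U))|]; exact: cvg_id.
apply: (@cvg_fro _ (nbhs U) _ _ _ (fun U : 'M[T]_n => U *m ct U - 1%:M)).
apply: cvg_addmx; last exact: cvg_cst.
by apply: (@cvg_mulmx _ (nbhs U)); [|apply: (@cvg_ct _ (nbhs U))]; exact: cvg_id.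
Qed.

End MatrixTopology.

(** * Singular value decomposition *)

Section SVD.
Variables (R : realType) (F : base_field).
Local Notation T := (scalars R F).
Local Notation rs := (@real_scalar R F).
Local Notation nsq := (@nsq R F).

Lemma fro_row_mx m n1 n2 (A : 'M[T]_(m, n1)) (B : 'M[T]_(m, n2)) :
  fro (row_mx A B) = fro A + fro B.
Proof.
rewrite /fro -big_split; apply: eq_bigr => i _; rewrite big_split_ord /=.
by congr (_ + _); apply: eq_bigr => j _; rewrite ?row_mxEl ?row_mxEr.
Qed.

Lemma fro_scalar1 (a : T) : fro (a%:M : 'M[T]_1) = nsq a.
Proof. by rewrite /fro !big_ord1 mxE eqxx mulr1n. Qed.

Definition rdiag n (d : 'rV[R]_n) : 'M[T]_n := diag_mx (map_mx rs d).

Lemma rdiagE n (d : 'rV[R]_n) i j : rdiag d i j = rs (d 0 i) *+ (i == j).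
Proof. by rewrite !mxE. Qed.

Lemma fro_row_rdiag n (d : 'rV[R]_n) i : fro (row i (rdiag d)) = d 0 i ^+ 2.
Proof.
rewrite /fro big_ord1 (bigD1 i) //= !mxE eqxx mulr1n nsq_rs.
by rewrite big1 ?addr0 // => j j0; rewrite !mxE eq_sym (negbTE j0) mulr0n nsq0.
Qed.

Lemma fro_row1 n i : fro (row i (1%:M : 'M[T]_n)) = 1.
Proof.
rewrite -[RHS](expr1n _ 2) -[X in X ^+ 2](mxE tt (fun (_ : 'I_1) (_ : 'I_n) => 1) 0 i).
rewrite -fro_row_rdiag; congr (fro (row i _)); apply/matrixP => k l.
by rewrite !mxE rmorph1.
Qed.

(** x maximizes |x E| on the compact unit sphere, and other vectors are scaled to length 1. It is
    the first singular vector, found without spectral theory. *)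
Lemma max_stretch n (E : 'M[T]_n.+1) : exists x : 'rV[T]_n.+1,
  fro x = 1 /\ forall y : 'rV[T]_n.+1, fro (y *m E) <= fro (x *m E) * fro y.
Proof.
have S1 : compact [set x : 'rV[T]_n.+1 | fro x = 1].
  apply: (@bounded_closed_mx_compact _ _ _ _ _ 1) => [|x /= -> //].
  apply: (@closed_comp _ _ (@fro R F _ _) [set y | y = 1]) => [x _|]; last exact: closed_eq.
  exact: fro_continuous.
have S0 : [set x : 'rV[T]_n.+1 | fro x = 1] !=set0.
  by exists (row 0 1%:M) => /=; exact: fro_row1.
have [|x] := @compact_EVT_max _ R (fun x : 'rV[T]_n.+1 => fro (x *m E)) _ S0 S1.
  apply: continuous_subspaceT => x; apply: (@cvg_fro _ _ _ (nbhs x)).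
  by apply: (@cvg_mulmx _ _ _ (nbhs x)); [exact: cvg_id|exact: cvg_cst].
rewrite inE /= => x1 xmax; exists x; split => // y.
have [->|y0] := eqVneq y 0; first by rewrite mul0mx !fro0 mulr0.
have fy0 : 0 < fro y by rewrite lt_neqAle fro_ge0 eq_sym fro_eq0 y0.
pose s := Num.sqrt (fro y); have s0 : s != 0 by rewrite gt_eqF // sqrtr_gt0.
have ss : s ^+ 2 = fro y by rewrite sqr_sqrtr // ltW.
have := xmax ((rs s^-1)%:M *m y); rewrite inE /= -mulmxA !fro_rs -ss -exprMn mulVf //.
rewrite expr1n => /(_ erefl); rewrite exprVn ler_pdivrMl; last by rewrite ss.
by rewrite mulrC.
Qed.

Lemma unit_row_ext n (x : 'rV[T]_n.+1) : fro x = 1 ->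
  exists2 U, unitary R F n.+1 U & row 0 U = x.
Proof.
move=> x1; have [||U [_ uU eU]] := @witt R F _ _ (fun=> True) (row 0 1%:M) x I.
- by [].
- by rewrite !mul_ct_rV x1 fro_row1.
by exists U => //; rewrite -eU -row_mul mul1mx.
Qed.

Lemma unitary_block m n (U : 'M[T]_m) (V : 'M[T]_n) : unitary R F m U -> unitary R F n V ->
  unitary R F (m + n) (block_mx U 0 0 V).
Proof.
move=> /unitaryE[U1 U2] /unitaryE[V1 V2]; apply/unitaryE; rewrite ct_block !raddf0.
by rewrite !mulmx_block !mulmx0 !mul0mx !addr0 !add0r U1 U2 V1 V2 -scalar_mx_block.
Qed.

(** A unit vector x of maximal stretch s and y = x E / s are completed to unitary matrices U and W
    with these first rows. Then M = U E W* has first row (s, 0), maximality forces the rest of its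
    first column to vanish, and the induction hypothesis applies to the remaining block. *)
Lemma svd n (E : 'M[T]_n) : exists V W d, [/\ unitary R F n V, unitary R F n W,
  E = V *m rdiag d *m W, forall i, 0 <= d 0 i &
  forall i j : 'I_n, (i <= j)%N -> d 0 j <= d 0 i].
Proof.
elim: n E => [|n IH] E.
  exists 1%:M, 1%:M, 0; split; try exact: unitary1; try by case.
  by apply/matrixP => -[].
have [x [x1 xmax]] := max_stretch E.
have [xE0|xE0] := eqVneq (fro (x *m E)) 0.
  (* Maximal stretch 0 means E = 0. *)
  exists 1%:M, 1%:M, 0; split; try exact: unitary1; try by move=> *; rewrite !mxE.
  rewrite /rdiag raddf0 raddf0 mulmx0 mul0mx; apply/row_matrixP => i.
  rewrite row0 rowE; apply/eqP; rewrite -fro_eq0 eq_le fro_ge0 andbT.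
  by apply: le_trans (xmax _) _; rewrite xE0 mul0r.
have sq0 : 0 < fro (x *m E) by rewrite lt_neqAle fro_ge0 eq_sym xE0.
pose s := Num.sqrt (fro (x *m E)); have s0 : 0 < s by rewrite sqrtr_gt0.
have ss : s ^+ 2 = fro (x *m E) by rewrite sqr_sqrtr // ltW.
have [U uU Ux] := unit_row_ext x1.
pose y := (rs s^-1)%:M *m (x *m E).
have [|W uW Wy] := @unit_row_ext n y.
  by rewrite fro_rs -ss exprVn mulVf // sqrf_eq0 gt_eqF.
have xE : x *m E = (rs s)%:M *m y.
  by rewrite /y mulmxA -scalar_mxM -rmorphM divff ?gt_eqF // rmorph1 mul1mx.
have [M ME] : exists M : 'M[T]_(1 + n), M = U *m E *m ct W by exists (U *m E *m ct W).
have /unitaryE[U1 U2] := uU; have /unitaryE[W1 W2] := uW.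
have Mstretch (z : 'rV[T]_(1 + n)) : fro (z *m M) <= s ^+ 2 * fro z.
  rewrite ME !mulmxA fro_unitr ?ctK // ss; apply: le_trans (xmax _) _.
  by rewrite [fro (z *m U)]fro_unitr.
have M0 : row 0 M = (rs s)%:M *m row 0 1%:M.
  rewrite ME !row_mul Ux xE -Wy -mulmxA -row_mul; congr (_ *m _).
  by rewrite W2.
have Mul : ulsubmx M = (rs s)%:M.
  apply/matrixP => i j; rewrite !ord1 !mxE eqxx mulr1n.
  have := congr1 (fun A : 'rV[T]_(1 + n) => A 0 (lshift n 0)) M0.
  rewrite mxE => eM; transitivity (M 0 (lshift n 0)).
    by congr (M _ _); exact: val_inj.
  rewrite eM mxE big_ord1 !mxE eqxx mulr1n.
  by rewrite (_ : (_ == _) = true) ?mulr1.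
have Mur : ursubmx M = 0.
  apply/matrixP => i j; rewrite !ord1 !mxE.
  have := congr1 (fun A : 'rV[T]_(1 + n) => A 0 (rshift 1 j)) M0.
  rewrite mxE => eM; transitivity (M 0 (rshift 1 j)).
    by congr (M _ _); exact: val_inj.
  rewrite eM mxE big_ord1 !mxE eqxx mulr1n.
  by rewrite (_ : (_ == _) = false) ?mulr0.
pose c := dlsubmx M; pose M' := drsubmx M.
have Mb : M = block_mx (rs s)%:M 0 c M' by rewrite -Mul -Mur submxK.
have c0 : c = 0.
  (* The test vector (s, ct c) has squared length s^2 + |c|^2, and its image has first coordinate
     s^2 + |c|^2. Maximality of s then gives |c|^2 (s^2 + |c|^2) <= 0. *)
  apply/eqP; rewrite -fro_eq0; have := Mstretch (row_mx (rs s)%:M (ct c)).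
  rewrite Mb mul_row_block mulmx0 add0r !fro_row_mx fro_scalar1 nsq_rs fro_ct.
  have -> : (rs s)%:M *m (rs s)%:M + ct c *m c = (rs (s ^+ 2 + fro c))%:M.
    have := mul_ct_rV (ct c); rewrite ctK fro_ct => ->.
    by rewrite -scalar_mxM -rmorphM -raddfD -rmorphD expr2.
  rewrite fro_scalar1 nsq_rs => h.
  have k0 := fro_ge0 c; have k1 := fro_ge0 (ct c *m M').
  have s2 : 0 < s ^+ 2 by rewrite exprn_gt0.
  have h1 : fro c * (s ^+ 2 + fro c) <= 0 by lra.
  by rewrite eq_le k0 andbT -(@pmulr_lle0 _ (s ^+ 2 + fro c)) // ltr_wpDr.
have [V' [W' [d' [uV' uW' M'E d'0 d'le]]]] := IH M'.
pose bl (A : 'M[T]_n) : 'M[T]_n.+1 := block_mx (1%:M : 'M[T]_1) 0 0 A.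
pose d : 'rV[R]_n.+1 := row_mx (const_mx s : 'rV[R]_1) d'.
have dl (j : 'I_1) : d 0 (@lshift 1 n j) = s by rewrite /d mxE (unsplitK (inl j)) mxE.
have dr (j : 'I_n) : d 0 (@rshift 1 n j) = d' 0 j by rewrite /d mxE (unsplitK (inr j)).
have ubl A : unitary R F n A -> unitary R F n.+1 (bl A).
  by move=> uA; exact: (@unitary_block 1 n 1%:M A (unitary1 _ _ _) uA).
exists (ct U *m bl V'), (bl W' *m W), d.
split.
- by apply: unitaryM; [exact: unitary_ct|exact: ubl].
- by apply: unitaryM => //; exact: ubl.
- have -> : E = ct U *m M *m W.
    by rewrite ME !mulmxA U1 mul1mx -mulmxA W1 mulmx1.
  rewrite !mulmxA; congr (_ *m _); rewrite -!mulmxA; congr (_ *m _).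
  have -> : rdiag d = block_mx (rs s)%:M 0 0 (rdiag d') :> 'M[T]_(1 + n).
    apply/matrixP => i j; rewrite rdiagE.
    case: (split_ordP i) => i' ->; case: (split_ordP j) => j' ->;
      rewrite ?block_mxEul ?block_mxEur ?block_mxEdl ?block_mxEdr ?rdiagE ?dl ?dr
        ?eq_lshift ?eq_lrshift ?eq_rlshift ?eq_rshift ?mxE //.
  have eM : block_mx (1%:M : 'M[T]_1) 0 0 V' *m
      (block_mx (rs s)%:M 0 0 (rdiag d') *m block_mx (1%:M : 'M[T]_1) 0 0 W') = M.
    rewrite !mulmx_block !(mulmx0, mul0mx, mulmx1, mul1mx, addr0, add0r) mulmxA -M'E.
    by rewrite Mb c0.
  exact/esym/eM.
- by move=> i; case: (@split_ordP 1 n i) => j ->; rewrite ?dl ?dr // ltW.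
- move=> i j; case: (@split_ordP 1 n i) => i' ->; case: (@split_ordP 1 n j) => j' ->;
    rewrite ?dl ?dr //; last first.
  + by rewrite leq_add2l; exact: d'le.
  + by rewrite !ord1.
  (* Row j' of the adjoint of V', preceded by 0, is a unit vector whose image has length d'_j', so s
     bounds this singular value. *)
  + move=> _; have := Mstretch (row_mx 0 (row j' (ct V'))).
    have /unitaryE[V1 V2] := uV'; have /unitaryE[W'1 W'2] := uW'.
    rewrite Mb mul_row_block !mul0mx !add0r c0 mulmx0 !fro_row_mx !fro0 !add0r.
    rewrite M'E !mulmxA fro_unitr // -!row_mul V1 mul1mx fro_row_rdiag.
    rewrite -[ct V']mul1mx row_mul fro_unitr ?ctK // fro_row1 mulr1.
    by rewrite ler_pXn2r ?nnegrE ?d'0 ?(ltW s0).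
Qed.

End SVD.

(** * Continuity on subsets and identity components *)

Section Within.
Context {X Y Z : topologicalType}.

Lemma within_continuousP (A : set X) (f : X -> Y) :
  {within A, continuous f} <->
  forall x, A x -> f y @[y --> within A (nbhs x)] --> f x.
Proof. exact: subspace_continuousP. Qed.

Lemma cvg_within_in (B : set X) (W : set Y) (g : X -> Y) x :
  (forall y, B y -> W (g y)) ->
  g y @[y --> within B (nbhs x)] --> g x ->
  g y @[y --> within B (nbhs x)] --> within W (nbhs (g x)).
Proof.
move=> gW gx U /= WU.
have h : nbhs x [set y | B y -> W (g y) -> U (g y)] := gx _ WU.
have : nbhs x [set y | B y -> U (g y)].
  by apply: filterS h => y h By; apply: h => //; exact: gW.
by [].
Qed.

End Within.

Lemma comp_within_continuous {X Y Z : topologicalType} (B : set X) (W : set Y)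
    (g : X -> Y) (f : Y -> Z) :
  (forall y, B y -> W (g y)) -> {within B, continuous g} ->
  {within W, continuous f} -> {within B, continuous (f \o g)}.
Proof.
move=> gW /within_continuousP cg /within_continuousP cf; apply/within_continuousP => x Bx.
apply: cvg_comp (cf _ (gW _ Bx)).
exact: (@cvg_within_in _ _ B W g x gW (cg x Bx)).
Qed.

Section Components.
Variables (R : realType) (F : base_field) (N : nat).
Local Notation T := (scalars R F).

(** If A and B are connected sets through 1 containing a and b, then A and a B are connected and
    share the point a, and a b lies in their union. *)
Lemma connected_component_mul (S : set 'M[T]_N) (a b : 'M[T]_N) :
  (forall x y, S x -> S y -> S (x *m y)) ->
  connected_component S 1%:M a -> connected_component S 1%:M b ->
  connected_component S 1%:M (a *m b).
Proof.
move=> SM [Ca [Ca1 CaS Cac] Caa] [Cb [Cb1 CbS Cbc] Cbb].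
exists (Ca `|` (fun x => a *m x) @` Cb); last by right; exists b.
split; first by left.
  by move=> x [/CaS //|[y /CbS Sy <-]]; apply: SM => //; exact: CaS.
apply: connectedU => //; first by exists a; split => //; exists 1%:M => //; rewrite mulmx1.
apply: connected_continuous_connected => //; apply: continuous_subspaceT => x.
by apply: (@cvg_mulmx _ _ _ (nbhs x)); [exact: cvg_cst|exact: cvg_id].
Qed.

Lemma connected_component_image (M : nat) (S : set 'M[T]_N) (S' : set 'M[T]_M)
    (f : 'M[T]_N -> 'M[T]_M) (x a : 'M[T]_N) :
  continuous f -> (forall y, S y -> S' (f y)) ->
  connected_component S x a -> connected_component S' (f x) (f a).
Proof.
move=> fc fS [C [Cx CS Cc] Ca]; exists (f @` C); last by exists a.
split; first by exists x.
  by move=> _ [y /CS Sy <-]; exact: fS.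
by apply: connected_continuous_connected => //; exact: continuous_subspaceT.
Qed.

Lemma connected_component_path (S : set 'M[T]_N) (x : 'M[T]_N) (f : R -> 'M[T]_N) :
  {within `[0, 1]%classic, continuous f} ->
  (forall s, 0 <= s <= 1 -> S (f s)) -> f 0 = x ->
  connected_component S x (f 1).
Proof.
move=> fc fS f0; exists (f @` `[0, 1]%classic); last first.
  by exists 1 => //=; rewrite in_itv /= ler01 lexx.
split; first by exists 0 => //=; rewrite in_itv /= ler01 lexx.
  by move=> _ [s /= s01 <-]; apply: fS; rewrite in_itv /= in s01.
by apply: connected_continuous_connected => //; exact: segment_connected.
Qed.

End Components.

(** Sylvester's identity: both sides are the determinant of the block matrix with rows (1, A) and
    (B, 1). With n = 1 it yields the determinants of quasi-reflections. *)
Lemma det_sub_mulmxC (K : comNzRingType) m n (A : 'M[K]_(m, n)) (B : 'M[K]_(n, m)) :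
  \det (1%:M - A *m B) = \det (1%:M - B *m A).
Proof.
have E1 : block_mx 1%:M A B 1%:M = block_mx 1%:M 0 B 1%:M *m block_mx 1%:M A 0 (1%:M - B *m A).
  by rewrite mulmx_block !(mulmx1, mul1mx, mulmx0, mul0mx, addr0, add0r) addrC subrK.
have E2 : block_mx 1%:M A B 1%:M = block_mx 1%:M A 0 1%:M *m block_mx (1%:M - A *m B) 0 B 1%:M.
  by rewrite mulmx_block !(mulmx1, mul1mx, mulmx0, mul0mx, addr0, add0r) subrK.
have := congr1 determinant E1; rewrite {1}E2 !det_mulmx !det_lblock !det_ublock !det1.
by rewrite !mul1r !mulr1.
Qed.

(** * Connectedness of the special orthogonal group *)

Section SpecialOrthogonal.
Variable R : realType.
Local Notation T := (scalars R Reals).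
Local Notation "''Mat_' N" := 'M[T]_N (at level 8, N at level 2).

Lemma rs1_mx n : (real_scalar Reals 1)%:M = 1%:M :> 'Mat_n.
Proof. by []. Qed.

Lemma rs0_mx n : (real_scalar Reals 0)%:M = 0 :> 'Mat_n.
Proof. by apply/matrixP => i j; rewrite !mxE /= mul0rn. Qed.

Lemma rsN_mx n (a : R) :
  (real_scalar Reals (- a))%:M = - (real_scalar Reals a)%:M :> 'Mat_n.
Proof. by apply/matrixP => i j; rewrite !mxE /= mulNrn. Qed.

Lemma det_real1 N : \det (1%:M : 'Mat_N) = 1.
Proof. exact: (@det1 R). Qed.

Lemma det_realM N (A B : 'Mat_N) : \det (A *m B) = \det A * \det B.
Proof. exact: (@det_mulmx R). Qed.

Definition SO N : set 'Mat_N := unitary R Reals N `&` [set g | \det g = 1].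

(** The Householder reflection; for u nonzero, 2 / |u|^2 is the only nonzero real parameter allowed
    by [qrefl_unitary]. *)
Definition refl N (u : 'rV[T]_N) : 'Mat_N := qrefl u (2 / fro u : R).

Lemma refl_unitary N (u : 'rV[T]_N) : u != 0 -> unitary R Reals N (refl u).
Proof.
move=> u0; apply: qrefl_unitary => /=; rewrite /nsq.
have f0 : fro u != 0 by rewrite fro_eq0.
by field.
Qed.

Lemma reflK N (u : 'rV[T]_N) : u != 0 -> refl u *m refl u = 1%:M.
Proof.
move=> u0; have /unitaryE[_] := refl_unitary u0.
suff -> : ct (refl u) = refl u by [].
by rewrite /refl /qrefl ctB ct1 !ctM ctK ct_scalar mulmxA.
Qed.

Lemma reflZ N (u : 'rV[T]_N) (c : R) : c != 0 -> u != 0 ->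
  refl ((real_scalar Reals c)%:M *m u) = refl u.
Proof.
move=> c0 u0; rewrite /refl /qrefl; congr (_ - _).
rewrite fro_rs ctM ct_scalar conj_rs -!mulmxA; congr (_ *m _).
rewrite !mulmxA -!scalar_mxM; congr (_%:M *m _) => /=.
have f0 : fro u != 0 by rewrite fro_eq0.
have : (c * (2 / (c ^+ 2 * fro u)) * c : R) = 2 / fro u by field; rewrite c0 f0.
by [].
Qed.

Lemma det_refl N (u : 'rV[T]_N) : u != 0 -> \det (refl u) = -1.
Proof.
move=> u0; have f0 : fro u != 0 by rewrite fro_eq0.
rewrite /refl /qrefl; have := @det_sub_mulmxC R N 1 (ct u *m (2 / fro u : T)%:M) u.
have -> : (u : 'M[R]_(1, N)) *m (ct u *m (2 / fro u : T)%:M) = (2 : R)%:M.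
  have := mul_ct_rV u => /= e; rewrite [LHS](mulmxA u) e -[LHS]scalar_mxM.
  by congr (_%:M); rewrite /= mulrC divfK.
by rewrite -raddfB det_scalar expr1 => ->; rewrite (_ : 2 = 1 + 1) // opprD addrA subrr add0r.
Qed.

Lemma SO1 N : SO (1%:M : 'Mat_N).
Proof. by split; [exact: unitary1|exact: det_real1]. Qed.

Lemma SOM N (A B : 'Mat_N) : SO A -> SO B -> SO (A *m B).
Proof.
move=> [uA dA] [uB dB]; split; first exact: unitaryM.
by rewrite /= det_realM dA dB mulr1.
Qed.

(** Along the segment w from u to v, [refl u *m refl (w s)] joins 1 to the product. If w vanishes
    somewhere, then v is a multiple of u and the product is 1 itself. *)
Lemma refl_comp N (u v : 'rV[T]_N) : u != 0 -> v != 0 ->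
  connected_component (@SO N) 1%:M (refl u *m refl v).
Proof.
move=> u0 v0.
pose w (s : R) : 'rV[T]_N := (real_scalar Reals (1 - s))%:M *m u + (real_scalar Reals s)%:M *m v.
have w0 : w 0 = u by rewrite /w subr0 rs1_mx rs0_mx mul1mx mul0mx addr0.
have w1 : w 1 = v by rewrite /w subrr rs1_mx rs0_mx mul1mx mul0mx add0r.
have [[s s01 ws0]|wn0] := pselect (exists2 s, 0 <= s <= 1 & w s = 0).
  have s0 : s != 0 by apply: contra_neq u0 => s0; rewrite -w0 -s0.
  pose c := - (s^-1 * (1 - s)).
  have vE : v = (real_scalar Reals c)%:M *m u.
    have : (real_scalar Reals s^-1)%:M *m w s = 0 by rewrite ws0 mulmx0.
    rewrite /w mulmxDr !mulmxA -!scalar_mxM -!rmorphM mulVf // rs1_mx mul1mx addrC.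
    by move=> /eqP; rewrite addr_eq0 => /eqP ->; rewrite /c rsN_mx mulNmx.
  have c0 : c != 0 by apply: contra_neq v0 => c0; rewrite vE c0 rs0_mx mul0mx.
  rewrite vE reflZ // reflK //; apply: connected_component_refl; exact: SO1.
have wn s : 0 <= s <= 1 -> w s != 0.
  by move=> s01; apply/eqP => ws; apply: wn0; exists s.
rewrite -w1; apply: (@connected_component_path _ _ _ _ _ (fun s => refl u *m refl (w s))).
- apply/within_continuousP => s /=; rewrite in_itv /= => /wn ws.
  set G := within _ _; have FG : Filter G by exact: within_filter.
  have cw : w x @[x --> G] --> w s.
    have : {for s, continuous w}.
      apply: (@cvg_addmx _ _ _ (nbhs s)); apply: (@cvg_mulmx _ _ _ (nbhs s)); try exact: cvg_cst;
        apply: (@cvg_rs_mx _ _ _ (nbhs s)); last exact: cvg_id.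
      by apply: cvgB; [exact: cvg_cst|exact: cvg_id].
    by move=> h; apply: cvg_within_filter h.
  apply: (@cvg_mulmx R Reals _ G FG); first exact: cvg_cst.
  apply: (@cvg_addmx R Reals _ G FG); first exact: cvg_cst.
  apply: (@cvg_oppmx R Reals _ G FG); apply: (@cvg_mulmx R Reals _ G FG) => //.
  apply: (@cvg_mulmx R Reals _ G FG); first exact: cvg_ct.
  apply: (@cvg_rs_mx R Reals _ G FG).
  apply: cvgM; first exact: cvg_cst.
  by apply: cvgV; [rewrite fro_eq0|exact: cvg_fro].
- move=> s /wn ws; split; first by apply: unitaryM; exact: refl_unitary.
  by rewrite /= det_realM !det_refl // mulrNN mulr1.
- by rewrite w0 reflK.
Qed.

(** Witt's construction writes U as a product of reflections. Products of two reflections lie in the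
    component of 1, so any product of reflections lies in it up to one fixed factor [refl e], and
    the determinant excludes this factor for U. *)
Lemma SO_connected N (U : 'Mat_N) : SO U -> connected_component (@SO N) 1%:M U.
Proof.
case: N U => [|N] U [uU dU].
  rewrite (_ : U = 1%:M); last by apply/matrixP => -[].
  by apply: connected_component_refl; exact: SO1.
pose e : 'rV[T]_N.+1 := row 0 1%:M.
have e0 : e != 0 by rewrite -fro_eq0 fro_row1 oner_eq0.
pose C := connected_component (@SO N.+1) 1%:M.
have CM A B : C A -> C B -> C (A *m B).
  by apply: connected_component_mul; exact: SOM.
have C1 : C 1%:M by apply: connected_component_refl; exact: SO1.
have [|A u b bb||A [CA uA]] := @witt R Reals N.+1 N.+1 (fun A => C A \/ C (A *m refl e)) 1%:M U.
- by left.
(* Over the reals the condition on b is 2 b = |u|^2 b^2, so b is 0 or 2 / |u|^2. *)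
- have [->|b0] := eqVneq b 0.
    by rewrite /qrefl (rs0_mx 1) mulmx0 mul0mx subr0 mulmx1.
  have u0 : u != 0.
    apply: contra_neq b0 => u0; move: bb; rewrite u0 fro0 mul0r /= => h.
    by have {}h : b + b = 0 := h; move/eqP: h; rewrite -mulr2n mulrn_eq0 /= => /eqP.
  have -> : qrefl u b = refl u.
    rewrite /refl; congr qrefl; move: bb => /= h.
    have {}h : (b : R) + b = fro u * b ^+ 2 := h.
    have f0 : fro u != 0 by rewrite fro_eq0.
    have b0' : (b : R) != 0 := b0.
    have : fro u * (b : R) = 2 by apply: (mulIf b0'); rewrite -mulrA -expr2 -h; ring.
    by move=> /(canRL (mulKf f0)) ->; rewrite mulrC.
  move=> [CA|CA]; first by right; rewrite -mulmxA; apply: CM => //; exact: refl_comp.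
  left; rewrite -[A]mulmx1 -(reflK e0) mulmxA -mulmxA; apply: CM => //.
  exact: refl_comp.
- by rewrite ct1 mulmx1; have /unitaryE[_ ->] := uU.
rewrite mul1mx => AU; rewrite -AU; case: CA => //.
move=> [D [D1 DS Dc] DA]; have [_ /=] := DS _ DA.
rewrite det_realM AU dU det_refl // mul1r => /eqP.
by rewrite -subr_eq0 -opprD oppr_eq0 (_ : 1 + 1 = 2) // pnatr_eq0.
Qed.

End SpecialOrthogonal.

(** * Isometries of the form of signature (p, r) *)

Section Isometries.
Variables (R : realType) (F : base_field) (p r : nat).
Local Notation T := (scalars R F).
Local Notation J := (signature R F p r).
Local Notation iso := (@isometries R F (p + r) J).

Lemma signatureK : J *m J = 1%:M.
Proof.
rewrite mulmx_block !(mulmx0, mul0mx, mulmx1, addr0, add0r) mulmxN mulmx1 opprK.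
by rewrite -scalar_mx_block.
Qed.

Lemma ct_signature : ct J = J.
Proof. by rewrite ct_block !raddf0 raddfN /= !ct1. Qed.

(** The inverse of g is J g* J, so g* is an isometry as well. The second identity concerns the rows
    of g, hence its lower blocks C and E. *)
Lemma isoE (g : 'M[T]_(p + r)) :
  iso g <-> ct g *m J *m g = J /\ g *m J *m ct g = J.
Proof.
rewrite /isometries /= adjE; split.
  move=> [[h [gh hg]] gJg]; split=> //.
  have hE : J *m ct g *m J = h.
    have -> : h = J *m (ct g *m J *m g) *m h by rewrite gJg signatureK mul1mx.
    by rewrite -[LHS]mulmx1 -gh !mulmxA.
  have e : g *m J *m ct g *m J = 1%:M by rewrite -gh -hE !mulmxA.
  by rewrite -[LHS]mulmx1 -signatureK mulmxA e mul1mx.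
move=> [h1 h2]; split=> //; exists (J *m ct g *m J); split.
  by rewrite !mulmxA h2 signatureK.
by rewrite -!mulmxA (mulmxA (ct g)) h1 signatureK.
Qed.

Lemma isoM (g h : 'M[T]_(p + r)) : iso g -> iso h -> iso (g *m h).
Proof.
move=> /isoE[g1 g2] /isoE[h1 h2]; apply/isoE; rewrite ctM; split.
  by rewrite -!mulmxA (mulmxA J) (mulmxA (ct g)) (mulmxA (ct g)) g1 mulmxA h1.
by rewrite -!mulmxA (mulmxA J) (mulmxA h) (mulmxA h) h2 mulmxA g2.
Qed.

Lemma iso_inv (g : 'M[T]_(p + r)) : iso g -> exists h, [/\ iso h, g *m h = 1%:M & h *m g = 1%:M].
Proof.
move=> gi; have /isoE[g1 g2] := gi; exists (J *m ct g *m J).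
have JJ m (x : 'M[T]_(p + r, m)) : J *m (J *m x) = x by rewrite mulmxA signatureK mul1mx.
have g1' m (x : 'M[T]_(p + r, m)) : ct g *m (J *m (g *m x)) = J *m x by rewrite !mulmxA g1.
have g2' m (x : 'M[T]_(p + r, m)) : g *m (J *m (ct g *m x)) = J *m x by rewrite !mulmxA g2.
split.
- apply/isoE; rewrite !ctM ctK !ct_signature -!mulmxA !JJ.
  by rewrite g2' g1' signatureK mulmx1.
- by rewrite !mulmxA g2 signatureK.
- by rewrite -!mulmxA (mulmxA (ct g)) g1 signatureK.
Qed.

Lemma iso_diag (A : 'M[T]_p) (D : 'M[T]_r) : unitary R F p A -> unitary R F r D ->
  iso (block_mx A 0 0 D).
Proof.
move=> /unitaryE[A1 A2] /unitaryE[D1 D2]; apply/isoE.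
rewrite ct_block !raddf0 !mulmx_block !(mulmx0, mul0mx, mulmx1, addr0, add0r).
by rewrite !mulmxN !mulNmx !mulmx1 A1 A2 D1 D2.
Qed.

(** The lower right block of g J g* = J. It makes the Gram matrix of C a function of E. *)
Lemma iso_lower (g : 'M[T]_(p + r)) : iso g ->
  drsubmx g *m ct (drsubmx g) = 1%:M + dlsubmx g *m ct (dlsubmx g).
Proof.
move=> /isoE[_]; rewrite -{1 2}[g]submxK ct_block !mulmx_block.
move=> /(congr1 drsubmx); rewrite !block_mxKdr !(mulmx0, mulmx1, addr0, add0r).
by rewrite mulmxN mulmx1 mulNmx => /eqP; rewrite subr_eq => /eqP ->; rewrite addrA subrr add0r.
Qed.

Lemma iso_expanding (g : 'M[T]_(p + r)) (x : 'rV[T]_r) : iso g ->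
  fro (x *m drsubmx g) = fro x + fro (x *m dlsubmx g).
Proof.
move=> /iso_lower e; apply: (@rs_inj R F).
have E n (w : 'rV[T]_n) : real_scalar F (fro w) = (w *m ct w) 0 0.
  by rewrite mul_ct_rV mxE eqxx mulr1n.
rewrite E !ctM !mulmxA -(mulmxA x) e mulmxDr mulmx1 mulmxDl rmorphD /= !E ctM !mulmxA.
by rewrite [LHS]mxE.
Qed.

Lemma ct_mul_eq0 m n (B : 'M[T]_(m, n)) : ct B *m B = 0 -> B = 0.
Proof.
move=> B0; rewrite -[B]ctK; suff -> : ct B = 0 by rewrite raddf0.
apply/row_matrixP => i; rewrite row0; apply/eqP; rewrite -fro_eq0; apply/eqP.
apply: (@rs_inj R F); rewrite rmorph0 /=.
have := congr1 (fun M : 'M[T]_n => M i i) B0; rewrite /= -{2}[B]ctK row_ct mul_ct_rV.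
by rewrite !mxE eqxx mulr1n.
Qed.

(** The quotient m of h by g has lower row (0, 1). The lower right block of m* J m = J then reads B*
    B - 1 = -1 for its upper right block B, so B = 0. *)
Lemma iso_same_lower (g h : 'M[T]_(p + r)) : iso g -> iso h ->
  dlsubmx g = dlsubmx h -> drsubmx g = drsubmx h ->
  exists2 A, unitary R F p A & h = block_mx A 0 0 1%:M *m g.
Proof.
move=> gi hi dl dr; have [g' [gi' gg' g'g]] := iso_inv gi.
pose m := h *m g'; have mi : iso m by exact: isoM.
have mg : h = m *m g by rewrite /m -mulmxA g'g mulmx1.
have md : dsubmx m = row_mx 0 1%:M.
  rewrite /m -mul_dsub_mx.
  have -> : dsubmx h = dsubmx g by rewrite -[LHS]hsubmxK -[RHS]hsubmxK; congr row_mx.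
  by rewrite mul_dsub_mx gg' scalar_mx_block block_mxEv col_mxKd.
have mdl : dlsubmx m = 0 by rewrite /dlsubmx md row_mxKl.
have mdr : drsubmx m = 1%:M by rewrite /drsubmx md row_mxKr.
have /isoE[m1 m2] := mi.
have mE : m = block_mx (ulsubmx m) (ursubmx m) 0 1%:M by rewrite -mdl -mdr submxK.
have Mur : ursubmx m = 0.
  apply: ct_mul_eq0; move: m1; set B := ursubmx m; rewrite mE.
  rewrite ct_block !raddf0 ct1 !mulmx_block !(mulmx0, mul0mx, mulmx1, addr0, add0r).
  move=> /(congr1 drsubmx); rewrite !block_mxKdr mul1mx => /eqP.
  by rewrite -[X in _ == X]add0r -subr_eq opprK subrK => /eqP.
exists (ulsubmx m); last by rewrite {1}mg {1}mE Mur.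
apply/unitaryE; move: m1 m2; rewrite mE Mur ct_block !raddf0 ct1 !mulmx_block.
rewrite !(mulmx0, mul0mx, mulmx1, addr0, add0r).
by move=> /(congr1 ulsubmx) + /(congr1 ulsubmx); rewrite !block_mxKul.
Qed.

End Isometries.

(** * Determinants of unitary matrices and their correction *)

Lemma kernel_col (K : fieldType) m p (C : 'M[K]_(m, p)) : (m < p)%N ->
  exists2 v : 'cV[K]_p, v != 0 & C *m v = 0.
Proof.
move=> mp; have /rowV0Pn[v vk v0] : kermx C^T != 0.
  rewrite kermx_eq0 /row_free neq_ltn mxrank_tr.
  by rewrite (leq_ltn_trans (rank_leq_row _) mp).
exists v^T; first by rewrite -(inj_eq (@trmx_inj _ _ _)) trmxK trmx0.
by apply: trmx_inj; rewrite trmx_mul trmxK trmx0; exact/sub_kermxP.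
Qed.

(** A relation rather than a function, so that it can hold for every z over the quaternions, where
    the groups carry no determinant condition. *)
Definition det_is (R : realType) (F : base_field) N :
    'M[scalars R F]_N -> scalars R F -> Prop :=
  match F with
  | Reals => fun g z => \det g = z
  | Complexes => fun g z => \det g = z
  | Quaternions => fun _ _ => True
  end.

Section Determinants.
Variables (R : realType) (F : base_field).
Local Notation T := (scalars R F).
Local Notation conj := (@conj_scalar R F).
Local Notation rs := (@real_scalar R F).
Local Notation nsq := (@nsq R F).

Lemma det_is1 N : det_is (1%:M : 'M[T]_N) 1.
Proof. by rewrite /det_is; case: F => //=; [exact: (@det1 R)|exact: (@det1 R[i])]. Qed.

Lemma det_isM N (g h : 'M[T]_N) z w : det_is g z -> det_is h w -> det_is (g *m h) (z * w).
Proof.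
rewrite /det_is; move: g h z w; case: F => //= g h z w <- <-.
  exact: (@det_mulmx R).
exact: (@det_mulmx R[i]).
Qed.

Lemma det_is_diag m n (A : 'M[T]_m) (D : 'M[T]_n) z w : det_is A z -> det_is D w ->
  det_is (block_mx A 0 0 D) (z * w).
Proof.
rewrite /det_is; move: A D z w; case: F => //= A D z w <- <-.
  exact: (@det_lblock R).
exact: (@det_lblock R[i]).
Qed.

Lemma det_is_cancel m n (A : 'M[T]_m) (g : 'M[T]_(m + n)) :
  det_is g 1 -> det_is (block_mx A 0 0 1%:M *m g) 1 -> det_is A 1.
Proof.
rewrite /det_is; move: A g; case: F => //= A g g1.
  rewrite [X in X = _](@det_mulmx R) g1 mulr1 [X in X = _](@det_lblock R).
  by rewrite [X in _ * X](@det1 R) mulr1.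
rewrite [X in X = _](@det_mulmx R[i]) g1 mulr1 [X in X = _](@det_lblock R[i]).
by rewrite [X in _ * X](@det1 R[i]) mulr1.
Qed.

Lemma det_is_unitary N (U : 'M[T]_N) : unitary R F N U -> exists2 z, nsq z = 1 & det_is U z.
Proof.
move=> /unitaryE[_]; rewrite /det_is; move: U; case: F => /= U UU.
- exists (\det (U : 'M[R]_N)) => //.
  have := congr1 (@determinant R N) UU; rewrite det1 => <-.
  by rewrite det_mulmx det_tr /nsq expr2; congr (_ * \det _); apply/matrixP => i j; rewrite mxE.
- have e : (\det (U : 'M[R[i]]_N)) * conjc (\det (U : 'M[R[i]]_N)) = 1.
    have := congr1 (@determinant R[i] N) UU; rewrite det1 => <-.
    by rewrite det_mulmx det_tr det_map_mx.
  exists (\det (U : 'M[R[i]]_N)) => //; apply: (@rs_inj R Complexes).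
  by rewrite rmorph1; apply: etrans e; rewrite -(@mul_conj R Complexes).
- by exists (1 : scalars R Quaternions) => //; exact: (@nsq1 R Quaternions).
Qed.

(** The map that multiplies w by z and fixes its orthogonal complement: b is (1 - z) / |w|^2, and
    Sylvester's identity gives the determinant 1 - (1 - z). *)
Lemma qrefl_phase N (w : 'rV[T]_N) (z : T) : w != 0 -> nsq z = 1 ->
  exists U, [/\ unitary R F N U, det_is U z &
    forall m (C : 'M[T]_(m, N)), C *m ct w = 0 -> C *m U = C].
Proof.
move=> w0 z1; have f0 : fro w != 0 by rewrite fro_eq0.
pose b := rs (fro w)^-1 * (1 - z).
have bb : b + conj b = rs (fro w * nsq b).
  rewrite /b conjM conj_rs -rsC -mulrDr nsqM nsq_rs exprVn expr2 mulrA.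
  have -> : fro w * (fro w * fro w)^-1 = (fro w)^-1 by field.
  rewrite rmorphM /=; congr (_ * _); rewrite -mul_conj raddfB /= conj1.
  rewrite mulrBl mulrBr !mul1r mulrBr mulr1 mul_conj z1 rmorph1.
  by rewrite opprB addrC.
exists (qrefl w b); split; first exact: qrefl_unitary.
  have E : w *m (ct w *m b%:M) = (1 - z)%:M.
    by rewrite mulmxA mul_ct_rV -scalar_mxM /b mulrA -rmorphM mulfV // rmorph1 mul1r.
  move: E; rewrite /det_is /qrefl; clear; move: w z b; case: F => //= w z b E.
    rewrite [LHS](@det_sub_mulmxC R) [X in _ - X]E -raddfB [LHS](@det_scalar R) expr1.
    by rewrite opprB addrC subrK.
  rewrite [LHS](@det_sub_mulmxC R[i]) [X in _ - X]E -raddfB [LHS](@det_scalar R[i]) expr1.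
  by rewrite opprB addrC subrK.
by move=> m C Cw; rewrite /qrefl mulmxBr mulmx1 !mulmxA Cw !mul0mx subr0.
Qed.

(** With fewer rows than columns, some nonzero w is orthogonal to all rows of C, and [qrefl_phase]
    acts along w. This repairs the determinant of a matrix found by [witt] without disturbing its
    effect on C; over the quaternions the identity matrix will do. *)
Lemma det_correction m p (C : 'M[T]_(m, p)) (z : T) : (m < p)%N -> nsq z = 1 ->
  exists U, [/\ unitary R F p U, det_is U z & C *m U = C].
Proof.
move=> mp z1; have [w w0 Cw] : exists2 w : 'rV[T]_p, w != 0 & C *m ct w = 0 \/ F = Quaternions.
  move: C; case: F => C.
  - have [v v0 Cv] := @kernel_col R m p C mp; exists (@ct R Reals p 1 v); last by left; rewrite ctK.
    by rewrite -fro_eq0 fro_ct fro_eq0.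
  - have [v v0 Cv] := @kernel_col R[i] m p C mp; exists (@ct R Complexes p 1 v); last by left;
    rewrite ctK.
    by rewrite -fro_eq0 fro_ct fro_eq0.
  - exists (row (Ordinal mp) 1%:M); last by right.
    by rewrite -fro_eq0 fro_row1 oner_eq0.
case: Cw => [Cw|FQ].
  by have [U [uU dU CU]] := qrefl_phase w0 z1; exists U; split=> //; exact: CU.
exists 1%:M; split; [exact: unitary1| |by rewrite mulmx1].
by clear -FQ; move: z; rewrite FQ.
Qed.

End Determinants.

Section BlockContinuity.
Variables (R : realType) (F : base_field).
Local Notation T := (scalars R F).

Lemma cvg_block_mx {X : Type} (G : set_system X) {FG : Filter G} m1 m2 n1 n2
    (fa : X -> 'M[T]_(m1, n1)) (fb : X -> 'M[T]_(m1, n2))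
    (fc : X -> 'M[T]_(m2, n1)) (fd : X -> 'M[T]_(m2, n2)) (a : 'M[T]_(m1, n1)) (b : 'M[T]_(m1, n2))
    (c : 'M[T]_(m2, n1)) (d : 'M[T]_(m2, n2)) :
  fa x @[x --> G] --> a -> fb x @[x --> G] --> b ->
  fc x @[x --> G] --> c -> fd x @[x --> G] --> d ->
  block_mx (fa x) (fb x) (fc x) (fd x) @[x --> G] --> block_mx a b c d.
Proof.
move=> ca cb cc cd; apply/cvg_mxP => i j.
case: (split_ordP i) => i' ->; case: (split_ordP j) => j' ->.
- rewrite block_mxEul; under eq_fun do rewrite block_mxEul; exact: cvg_mx_entry.
- rewrite block_mxEur; under eq_fun do rewrite block_mxEur; exact: cvg_mx_entry.
- rewrite block_mxEdl; under eq_fun do rewrite block_mxEdl; exact: cvg_mx_entry.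
- rewrite block_mxEdr; under eq_fun do rewrite block_mxEdr; exact: cvg_mx_entry.
Qed.

Lemma drsubmx_continuous m1 m2 n1 n2 :
  continuous (@drsubmx T m1 m2 n1 n2).
Proof.
move=> A; apply/(@cvg_mxP _ _ _ (nbhs A)) => i j; rewrite !mxE.
under eq_fun do rewrite !mxE.
by apply: (@cvg_mx_entry _ _ _ (nbhs A)); exact: cvg_id.
Qed.

End BlockContinuity.

Section DeterminantContinuity.
Variables (R : realType) (F : base_field).
Local Notation T := (scalars R F).

Lemma det_continuous n : continuous (fun A : 'M[T]_n => \det A).
Proof.
move=> A; rewrite /determinant; apply: (@cvg_sumT _ _ _ (nbhs A)) => s.
apply: (@cvgTM _ _ _ (nbhs A)); first exact: cvg_cst.
elim: (index_enum 'I_n) => [|i r IH].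
  by under eq_fun do rewrite big_nil; rewrite big_nil; exact: cvg_cst.
under eq_fun do rewrite big_cons; rewrite big_cons.
apply: (@cvgTM _ _ _ (nbhs A)) => //.
by apply: (@cvg_mx_entry _ _ _ (nbhs A)); exact: cvg_id.
Qed.

End DeterminantContinuity.

(** * Real diagonal matrices and matrices that do not shorten vectors *)

Section Expanding.
Variables (R : realType) (F : base_field).
Local Notation T := (scalars R F).

Lemma rdiagM n (d e : 'rV[R]_n) :
  rdiag F d *m rdiag F e = rdiag F (\row_i (d 0 i * e 0 i)).
Proof.
rewrite /rdiag mulmx_diag; congr diag_mx; apply/rowP => i.
by rewrite !mxE rmorphM.
Qed.

Lemma rdiag1 n : rdiag F (const_mx 1 : 'rV[R]_n) = 1%:M.
Proof. by apply/matrixP => i j; rewrite !mxE rmorph1. Qed.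

Lemma rdiagV n (d : 'rV[R]_n) : (forall i, d 0 i != 0) ->
  rdiag F d *m rdiag F (\row_i (d 0 i)^-1) = 1%:M /\
  rdiag F (\row_i (d 0 i)^-1) *m rdiag F d = 1%:M.
Proof.
move=> d0; rewrite !rdiagM -rdiag1.
by split; congr (rdiag F _); apply/rowP => i; rewrite !mxE ?divff ?mulVf.
Qed.

Lemma ct_rdiag n (d : 'rV[R]_n) : ct (rdiag F d) = rdiag F d.
Proof.
apply/matrixP => i j; rewrite ctE !rdiagE raddfMn /= conj_rs eq_sym.
by case: eqP => [->|].
Qed.

(** Row i of V* is the i-th left singular vector; evaluating at it turns bounds on |x E| into bounds
    on d_i. *)
Lemma svd_entry n (E V W : 'M[T]_n) (d : 'rV[R]_n) i :
  unitary R F n V -> unitary R F n W -> E = V *m rdiag F d *m W ->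
  fro (row i (ct V) *m E) = d 0 i ^+ 2 /\ fro (row i (ct V)) = 1.
Proof.
move=> /unitaryE[V1 V2] /unitaryE[_ W2] ->; split.
  by rewrite !mulmxA -!row_mul V1 mul1mx row_mul fro_unitr // fro_row_rdiag.
by rewrite -[ct V]mul1mx row_mul fro_unitr ?ctK // fro_row1.
Qed.

Lemma expanding_svd n (E V W : 'M[T]_n) (d : 'rV[R]_n) c : 0 <= c ->
  (forall x : 'rV[T]_n, c ^+ 2 * fro x <= fro (x *m E)) ->
  unitary R F n V -> unitary R F n W -> E = V *m rdiag F d *m W ->
  (forall i, 0 <= d 0 i) -> forall i, c <= d 0 i.
Proof.
move=> c0 Ex uV uW EE d0 i; have [h1 h2] := svd_entry i uV uW EE.
have := Ex (row i (ct V)); rewrite h1 h2 mulr1.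
by rewrite ler_pXn2r ?nnegrE.
Qed.

Lemma unitary_invertible n (U : 'M[T]_n) : unitary R F n U -> invertible_mx R F n U.
Proof. by move=> /unitaryE[U1 U2]; exists (ct U). Qed.

Lemma invertibleM n (U V : 'M[T]_n) : invertible_mx R F n U -> invertible_mx R F n V ->
  invertible_mx R F n (U *m V).
Proof.
move=> [A [A1 A2]] [B [B1 B2]]; exists (B *m A); split.
  by rewrite mulmxA -(mulmxA U) B1 mulmx1.
by rewrite mulmxA -(mulmxA B) A2 mulmx1.
Qed.

Lemma rdiag_invertible n (d : 'rV[R]_n) : (forall i, d 0 i != 0) ->
  invertible_mx R F n (rdiag F d).
Proof. by move=> /rdiagV[h1 h2]; exists (rdiag F (\row_i (d 0 i)^-1)). Qed.

(** The singular values are at least 1, in particular nonzero. *)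
Lemma expanding_invertible n (E : 'M[T]_n) :
  (forall x : 'rV[T]_n, fro x <= fro (x *m E)) -> invertible_mx R F n E.
Proof.
move=> Ex; have [V [W [d [uV uW EE d0 _]]]] := svd E.
have d1 i : 1 <= d 0 i.
  by apply: (expanding_svd _ _ uV uW EE d0) => // x; rewrite expr1n mul1r.
rewrite EE; apply: invertibleM; last exact: unitary_invertible.
apply: invertibleM; first exact: unitary_invertible.
by apply: rdiag_invertible => i; rewrite gt_eqF // (lt_le_trans ltr01).
Qed.

End Expanding.

(** * The groups of q x q matrices and their singular value decomposition *)

Section ScalarGroups.
Variables (R : realType) (F : base_field).
Local Notation T := (scalars R F).

Lemma unitary_group_U n V : group_U R F n V -> unitary R F n V.
Proof. by rewrite /group_U; move: V; case: F => // V []. Qed.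

Lemma group_U1 n : group_U R F n 1%:M.
Proof.
rewrite /group_U; case: F; try exact: unitary1.
by split; [exact: unitary1|exact: (@det1 R)].
Qed.

Lemma group_UM n (V W : 'M[T]_n) : group_U R F n V -> group_U R F n W ->
  group_U R F n (V *m W).
Proof.
rewrite /group_U; move: V W; case: F; try exact: unitaryM.
by move=> V W [uV dV] [uW dW]; split; [exact: unitaryM|rewrite /= det_realM dV dW mulr1].
Qed.

Lemma group_U_ct n (V : 'M[T]_n) : group_U R F n V -> group_U R F n (ct V).
Proof.
rewrite /group_U; move: V; case: F; try by move=> V; exact: unitary_ct.
move=> V [uV dV]; split; first exact: unitary_ct.
rewrite /= -[RHS]dV -[RHS](@det_tr R n V); congr (\det _).
by apply/matrixP => i j; rewrite !mxE.
Qed.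

Lemma group_U_GL n V : group_U R F n V -> group_GL R F n V.
Proof.
rewrite /group_U /group_GL; move: V; case: F; try by move=> V; exact: unitary_invertible.
by move=> V [uV dV]; split; [exact: unitary_invertible|rewrite /= dV ltr01].
Qed.

Lemma group_GLM n V W : group_GL R F n V -> group_GL R F n W -> group_GL R F n (V *m W).
Proof.
rewrite /group_GL; move: V W; case: F; try exact: invertibleM.
move=> V W [uV dV] [uW dW]; split; first exact: invertibleM.
by rewrite /= det_realM mulr_gt0.
Qed.

Lemma group_GL_invertible n V : group_GL R F n V -> invertible_mx R F n V.
Proof. by rewrite /group_GL; move: V; case: F => // V []. Qed.

Lemma rdiag_GL n (d : 'rV[R]_n) : (forall i, 0 < d 0 i) -> group_GL R F n (rdiag F d).
Proof.
move=> d0; have := @rdiag_invertible R F n d (fun i => lt0r_neq0 (d0 i)).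
rewrite /group_GL; case: F => // h; split => //=.
rewrite /rdiag [X in 0 < X](@det_diag R); apply: prodr_gt0 => i _.
suff -> : map_mx (@real_scalar R Reals) d 0 i = d 0 i by [].
by rewrite mxE.
Qed.

End ScalarGroups.

Section GLsvd.
Variables (R : realType) (F : base_field).
Local Notation T := (scalars R F).

(* In the real case the two orthogonal factors can be given determinant 1:
   their determinants agree because the given matrix has positive
   determinant, and the sign of the first basis vector can be changed on both
   sides of the diagonal factor. *)
Lemma GL_svd n (E : 'M[T]_n) : group_GL R F n E ->
  exists V W d, [/\ group_U R F n V, group_U R F n W,
  E = V *m rdiag F d *m W, forall i, 0 < d 0 i &
  forall i j : 'I_n, (i <= j)%N -> d 0 j <= d 0 i].
Proof.
move=> GE; have [V [W [d [uV uW EE d0 dle]]]] := svd E.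
have dp i : 0 < d 0 i.
  rewrite lt_neqAle d0 andbT eq_sym; apply/eqP => di0.
  (* A zero singular value would give a unit vector killed by the invertible matrix E. *)
  have [h1 h2] := svd_entry i uV uW EE.
  have [h [Eh _]] := group_GL_invertible GE.
  move: h1; rewrite di0 expr0n /= => /eqP; rewrite fro_eq0 => /eqP r0.
  have : fro (row i (ct V) *m E *m h) = 0 by rewrite r0 mul0mx fro0.
  by rewrite -mulmxA Eh mulmx1 h2 => /eqP; rewrite oner_eq0.
move: V W uV uW E GE EE; rewrite /group_GL /group_U; case: F => V W uV uW E GE EE;
  try by exists V, W, d.
have [z z1 dz] := det_is_unitary uV; have [w w1 dw] := det_is_unitary uW.
rewrite /= in dz dw; have [_ /= dP] := @rdiag_GL R Reals n d dp.
have pm1 (x : scalars R Reals) : nsq x = 1 -> (x : R) = 1 \/ (x : R) = -1.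
  move=> x1; have /eqP : (x : R) ^+ 2 = 1 := x1.
  by rewrite sqrf_eq1 => /orP[/eqP|/eqP]; [left|right].
have zw : 0 < (z : R) * w.
  have [_] := GE; rewrite /= EE !det_realM dz dw.
  by rewrite mulrAC pmulr_lgt0.
have [zE|zE] := pm1 _ z1.
  have [wE|wE] := pm1 _ w1.
    by exists V, W, d; split => //; split => //=; rewrite ?dz ?dw.
  by move: zw; rewrite zE wE mul1r oppr_gt0 ltr10.
have {}wE : (w : R) = -1.
  have [wE|//] := pm1 _ w1.
  by move: zw; rewrite zE wE mulr1 oppr_gt0 ltr10.
pose s : 'rV[R]_n := \row_i (if val i == 0%N then -1 else 1).
have ss : rdiag Reals s *m rdiag Reals s = 1%:M.
  rewrite rdiagM -rdiag1; congr rdiag; apply/rowP => i; rewrite !mxE.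
  by case: ifP => _; rewrite ?mulrNN mulr1.
have ds : \det (rdiag Reals s) = -1.
  rewrite [LHS](@det_diag R); under eq_bigr do rewrite !mxE.
  (* For n = 0 the determinant of V is 1, which excludes z = -1. *)
  clear -dz zE; case: n V dz => [|n] V dz.
    by move: dz; rewrite [LHS](@det_mx00 R) zE big_ord0.
  by rewrite big_ord_recl /= big1 ?mulr1.
have us : unitary R Reals n (rdiag Reals s) by apply/unitaryE; rewrite ct_rdiag.
exists (V *m rdiag Reals s), (rdiag Reals s *m W), d; split => //.
- by split; [exact: unitaryM|rewrite /= det_realM dz ds zE mulrNN mulr1].
- by split; [exact: unitaryM|rewrite /= det_realM dw ds wE mulrNN mulr1].
rewrite EE -!mulmxA; congr (_ *m _); rewrite !mulmxA; congr (_ *m _).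
have e : rdiag Reals s *m rdiag Reals d *m rdiag Reals s = rdiag Reals d.
  rewrite !rdiagM; congr rdiag; apply/rowP => i; rewrite !mxE.
  by case: ifP => _; rewrite ?mulN1r ?mulrN1 ?opprK ?mul1r ?mulr1.
exact/esym/e.
Qed.

End GLsvd.

(** * The groups G_n and K_n *)

Section RealComponent.
Variables (R : realType) (p r : nat).
Local Notation T := (scalars R Reals).

(** The image of C under the determinant is an interval that contains 1 and not 0. *)
Lemma connected_det_pos (C : set 'M[T]_r) : connected C -> C 1%:M ->
  (forall g, C g -> \det g != 0) -> forall g, C g -> 0 < (\det g : R).
Proof.
move=> Cc C1 C0 g Cg; rewrite ltNge; apply/negP => gle0.
have : connected ((fun h : 'M[T]_r => \det h : R) @` C).
  apply: connected_continuous_connected => //; apply: continuous_subspaceT.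
  exact: (@det_continuous R Reals).
move=> /connected_intervalP /(_ (\det g) 1) iC.
have [|||h Ch /eqP] := iC _ _ 0; [by exists g|by exists 1%:M => //; exact: det_real1| |].
  by rewrite gle0 ler01.
by rewrite (negbTE (C0 _ Ch)).
Qed.

End RealComponent.

Section GroupG.
Variables (R : realType) (F : base_field) (q n : nat).
Local Notation T := (scalars R F).
Local Notation J := (signature R F (q + n) q).
Local Notation iso := (@isometries R F (q + n + q) J).

Lemma group_G_iso g : group_G R F q n g -> iso g /\ det_is g 1.
Proof.
rewrite /group_G /det_is; move: g; case: F => // g.
by move=> [C [C1 CS Cc] /CS].
Qed.

Lemma group_GM g h : group_G R F q n g -> group_G R F q n h -> group_G R F q n (g *m h).
Proof.
rewrite /group_G; move: g h; case: F => g h.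
- apply: connected_component_mul => x y [xi xd] [yi yd]; split; first exact: isoM.
  by rewrite /= det_realM xd yd mulr1.
- move=> [gi gd] [hi hd]; split; first exact: isoM.
  by rewrite /= [LHS](@det_mulmx R[i]) gd hd mulr1.
- exact: isoM.
Qed.

Lemma group_K_unitary g : group_K R F q n g -> unitary R F (q + n + q) g.
Proof. by move=> [A [D [uA uD _ ->]]]; exact: unitary_block. Qed.

Lemma group_K_det A D : det_condition_K A D -> det_is (block_mx A 0 0 D : 'M[T]_(q + n + q)) 1.
Proof.
rewrite /det_is /det_condition_K; move: A D; case: F => //= A D.
  by move=> [dA dD]; rewrite [LHS](@det_lblock R) dA dD mulr1.
by move=> dAD; rewrite [LHS](@det_lblock R[i]).
Qed.

Lemma group_KM g h : group_K R F q n g -> group_K R F q n h -> group_K R F q n (g *m h).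
Proof.
move=> [A [D [uA uD AD ->]]] [A' [D' [uA' uD' AD' ->]]].
exists (A *m A'), (D *m D'); split; try exact: unitaryM; last first.
  by rewrite mulmx_block !(mulmx0, mul0mx, addr0, add0r).
move: A D A' D' AD AD' {uA uD uA' uD'}; rewrite /det_condition_K; case: F => //= A D A' D'.
  by move=> [a d] [a' d']; rewrite !det_realM a d a' d' mulr1.
move=> ad ad'; rewrite [X in X * _](@det_mulmx R[i]) [X in _ * X](@det_mulmx R[i]).
by rewrite mulrACA ad ad' mulr1.
Qed.

Lemma group_K1 : group_K R F q n 1%:M.
Proof.
exists 1%:M, 1%:M; split; try exact: unitary1; last by rewrite -scalar_mx_block.
rewrite /det_condition_K; case: F => //=; first by split; exact: (@det1 R).
by rewrite [X in X * _](@det1 R[i]) [X in _ * X](@det1 R[i]) mulr1.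
Qed.

End GroupG.

Section GroupK.
Variables (R : realType) (F : base_field) (q n : nat).
Local Notation T := (scalars R F).

(** The real case needs an argument, G_n being an identity component there: diag(A, D) is the
    product of diag(A, 1) and diag(1, D), which lie in continuous images of the connected groups
    SO(q + n) and SO(q). *)
Lemma group_K_G g : group_K R F q n g -> group_G R F q n g.
Proof.
move=> [A [D [uA uD AD ->]]]; have i := @iso_diag R F _ _ A D uA uD.
have := @group_K_det R F q n A D AD.
have e : block_mx A 0 0 D = block_mx A 0 0 1%:M *m block_mx 1%:M 0 0 D.
  by rewrite mulmx_block !(mulmx0, mul0mx, mulmx1, mul1mx, addr0, add0r).
rewrite {}e in i *; rewrite /det_is /group_G; move: A D uA uD AD i; case: F => A D uA uD AD i d //.
have [dA dD] := AD.
apply: connected_component_mul.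
  move=> x y [xi xd] [yi yd]; split; first exact: isoM.
  by rewrite /= det_realM xd yd mulr1.
  have -> : 1%:M = block_mx 1%:M 0 0 1%:M :> 'M[scalars R Reals]_(q + n + q).
    exact: scalar_mx_block.
  apply: (@connected_component_image R Reals _ _ (@SO R (q + n)) _ (fun X => block_mx X 0 0 1%:M)).
  - move=> x; apply: (@cvg_block_mx R Reals _ (nbhs x)); try exact: cvg_cst; exact: cvg_id.
  - move=> y [uy dy]; split; first by apply: iso_diag => //; exact: unitary1.
    by rewrite /= [LHS](@det_lblock R) dy [X in _ * X](@det1 R) mulr1.
  - exact: SO_connected.
have -> : 1%:M = block_mx 1%:M 0 0 1%:M :> 'M[scalars R Reals]_(q + n + q).
  exact: scalar_mx_block.
apply: (@connected_component_image R Reals _ _ (@SO R q) _ (fun X => block_mx 1%:M 0 0 X)).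
- move=> x; apply: (@cvg_block_mx R Reals _ (nbhs x)); try exact: cvg_cst; exact: cvg_id.
- move=> y [uy dy]; split; first by apply: iso_diag => //; exact: unitary1.
  by rewrite /= [LHS](@det_lblock R) dy [X in X * _](@det1 R) mulr1.
- exact: SO_connected.
Qed.

Lemma group_G_expanding g (x : 'rV[T]_q) : group_G R F q n g -> fro x <= fro (x *m drsubmx g).
Proof. by move=> /group_G_iso[/iso_expanding -> _]; rewrite lerDl fro_ge0. Qed.

(** E is invertible because it does not shorten vectors. Over the reals its determinant is also
    positive: along a connected set of isometries through 1 all blocks E are invertible, so the sign
    cannot change. *)
Lemma group_G_GL g : group_G R F q n g -> group_GL R F q (drsubmx g).
Proof.
move=> Gg; have Ei : invertible_mx R F q (drsubmx g).
  by apply: expanding_invertible => x; exact: group_G_expanding.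
move: g Gg Ei; rewrite /group_G /group_GL; case: F => // g Gg Ei; split => //=.
have [C [C1 CS Cc] Cg] := Gg.
apply: (@connected_det_pos R q (@drsubmx _ (q + n) q (q + n) q @` C)); last by exists g.
- by apply: connected_continuous_connected => //; apply: continuous_subspaceT;
  exact: (@drsubmx_continuous R Reals).
- by exists 1%:M => //; rewrite scalar_mx_block block_mxKdr.
move=> _ [h /CS[hi _] <-].
have [h' [hh' _]] : invertible_mx R Reals q (drsubmx h).
  by apply: expanding_invertible => x; rewrite iso_expanding // lerDl fro_ge0.
apply/eqP => d0; have := congr1 (fun M : 'M[scalars R Reals]_q => \det M) hh'.
rewrite /= det_realM d0 mul0r det_real1 => /eqP.
by rewrite eq_sym oner_eq0.
Qed.

Lemma group_K_ul (A : 'M[T]_(q + n)) : unitary R F _ A -> det_is A 1 ->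
  group_K R F q n (block_mx A 0 0 1%:M).
Proof.
move=> uA dA; exists A, 1%:M; split => //; first exact: unitary1.
move: A uA dA; rewrite /det_is /det_condition_K; clear; case: F => //= A _ dA.
  by split => //; exact: (@det1 R).
by rewrite dA [X in _ * X](@det1 R[i]) mulr1.
Qed.

(** C C* = E E* - 1 is the same for g and h, so Witt's theorem gives U mapping the block C of g to
    that of h. Once U has determinant 1, g diag(U, 1) and h share both lower blocks and differ by
    some diag(A, 1) on the left, where A has determinant 1 because all the other factors have. *)
Lemma group_K_same_lower g h : (0 < n)%N -> group_G R F q n g -> group_G R F q n h ->
  drsubmx g = drsubmx h ->
  exists k k', [/\ group_K R F q n k, group_K R F q n k' & h = k *m g *m k'].
Proof.
move=> n0 Gg Gh gh; have [gi gd] := group_G_iso Gg; have [hi hd] := group_G_iso Gh.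
have CC : dlsubmx g *m ct (dlsubmx g) = dlsubmx h *m ct (dlsubmx h).
  have := iso_lower gi; rewrite gh iso_lower //.
  by move=> /(congr1 (fun M => M - 1%:M)); rewrite ![1%:M + _]addrC !addrK.
have [|U [_ uU CU]] := @witt R F q (q + n) (fun=> True) _ _ I _ CC; first by [].
have [z z1 dU] := det_is_unitary uU.
have zz : z * conj_scalar z = 1 by rewrite mul_conj z1 rmorph1.
have [||U' [uU' dU' CU']] := @det_correction R F q (q + n) (dlsubmx h) (conj_scalar z).
(* C has q rows and q + n columns: n > 0 leaves room to correct the determinant. *)
- by rewrite -{1}[q]addn0 ltn_add2l.
- by rewrite nsq_conj.
pose k' : 'M[T]_(q + n + q) := block_mx (U *m U') 0 0 1%:M.
have dUU : det_is (U *m U') 1 by rewrite -zz; exact: det_isM.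
have Kk' : group_K R F q n k' by apply: group_K_ul => //; exact: unitaryM.
have gkE : g *m k' = block_mx (ulsubmx g *m (U *m U')) (ursubmx g) (dlsubmx h) (drsubmx g).
  rewrite -{1}[g]submxK /k' mulmx_block !(mulmx0, mulmx1, addr0, add0r).
  by rewrite (mulmxA (dlsubmx g)) CU CU'.
have Ggk : group_G R F q n (g *m k') by apply: group_GM => //; exact: group_K_G.
have [gki gkd] := group_G_iso Ggk.
have [||A uA hE] := @iso_same_lower R F _ _ (g *m k') h gki hi.
- by rewrite gkE block_mxKdl.
- by rewrite gkE block_mxKdr gh.
exists (block_mx A 0 0 1%:M), k'; split => //; last by rewrite hE mulmxA.
by apply: group_K_ul => //; apply: (det_is_cancel gkd); rewrite -hE.
Qed.

Lemma group_K_lift V : (0 < q + n)%N -> group_U R F q V ->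
  exists2 A, unitary R F (q + n) A & group_K R F q n (block_mx A 0 0 V).
Proof.
move=> qn0 UV; have uV := unitary_group_U UV; have [z z1 dV] := det_is_unitary uV.
(* A matrix without rows imposes no condition, so this merely produces a unitary A whose determinant
   cancels that of V. *)
have [|A [uA dA _]] := @det_correction R F 0 (q + n) 0 (conj_scalar z) qn0.
  by rewrite nsq_conj.
have zz : z * conj_scalar z = 1 by rewrite mul_conj z1 rmorph1.
move: V UV uV dV A uA dA zz; rewrite /group_U /det_is /det_condition_K /group_K /=.
move: z z1; case: F => z z1 V UV uV dV A uA dA zz.
- exists 1%:M; first exact: unitary1.
  exists 1%:M, V; split => //; [exact: unitary1|split; [exact: (@det1 R)|by case: UV]].
- by exists A => //; exists A, V; split => //; rewrite /det_condition_K dA dV mulrC.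
- by exists A => //; exists A, V; split.
Qed.

Lemma group_K_lower_U k : group_K R F q n k -> group_U R F q (drsubmx k).
Proof.
move=> [A [D [uA uD AD ->]]]; rewrite block_mxKdr.
by rewrite /group_U; move: A D uA uD AD; case: F => //= A D uA uD [_ dD].
Qed.

End GroupK.

(** * Embedding of the groups G_n into the infinite matrices *)

Lemma det_mxsub_bij (K : comNzRingType) m n (f : 'I_m -> 'I_n) (B : 'M[K]_n) :
  bijective f -> \det (mxsub f f B) = \det B.
Proof.
move=> fb; have mn : m = n by have := bij_eq_card fb; rewrite !card_ord.
subst m; have fi := bij_inj fb.
(* Rows and columns undergo the same permutation, so its sign enters squared. *)
have -> : mxsub f f B = row_perm (perm fi) (col_perm (perm fi) B).
  by apply/matrixP => i j; rewrite !mxE !permE.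
rewrite row_permE col_permE !det_mulmx !det_perm mulrA mulrAC.
by rewrite odd_permV -expr2 sqrr_sign mul1r.
Qed.

Section Reindexing.
Variables (R : realType) (F : base_field).
Local Notation T := (scalars R F).

Lemma mxsub_bijM m n (f : 'I_m -> 'I_n) (A B : 'M[T]_n) : bijective f ->
  mxsub f f A *m mxsub f f B = mxsub f f (A *m B).
Proof.
move=> fb; apply/matrixP => i j; rewrite !mxE [RHS](reindex f) /=; last exact: onW_bij.
by apply: eq_bigr => k _; rewrite !mxE.
Qed.

Lemma det_is_mxsub m n (f : 'I_m -> 'I_n) (A : 'M[T]_n) z : bijective f ->
  det_is A z -> det_is (mxsub f f A) z.
Proof.
move=> fb; rewrite /det_is; move: A z; case: F => //= A z <-.
  exact: (@det_mxsub_bij R).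
exact: (@det_mxsub_bij R[i]).
Qed.

End Reindexing.

Section Embedding.
Variables (R : realType) (F : base_field) (q : nat).
Local Notation T := (scalars R F).

Definition unindex n (a : 'I_(q + n + q)) : nat + 'I_q :=
  match fintype.split a with inl i => inl (val i) | inr k => inr k end.

Lemma unindexK n : pcancel (@unindex n) (@finite_index q n).
Proof.
move=> a; rewrite /unindex /finite_index; case: (split_ordP a) => i ->.
  by rewrite /= valK.
by [].
Qed.

Lemma finite_indexK n i a : finite_index n i = Some a -> @unindex n a = i.
Proof.
rewrite /finite_index; case: i => [i|k]; last by move=> [<-]; rewrite /unindex (unsplitK (inr k)).
case: insubP => //= u ui uE [<-]; rewrite /unindex (unsplitK (inl u)) /=.
by rewrite uE.
Qed.

Lemma finite_index_inj n i j a : finite_index n i = Some a -> @finite_index q n j = Some a -> i = j.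
Proof. by move=> /finite_indexK <- /finite_indexK <-. Qed.

Lemma embed_inj n : injective (@embed R F q n).
Proof.
move=> g h gh; apply/matrixP => a b.
have := congr1 (fun m => m (unindex a) (unindex b)) gh.
by rewrite /embed !unindexK.
Qed.

(** Outside the finite block both factors agree with the identity, so the sum over the infinite
    index set has finite support: the single index i if i lies outside the block, the indices of the
    block otherwise. *)
Lemma infmul_embed n (g h : 'M[T]_(q + n + q)) :
  infmul (embed g) (embed h) = embed (g *m h).
Proof.
apply/funext => i; apply/funext => j; rewrite /infmul.
case Ei : (finite_index n i) => [a|]; last first.
  rewrite (fsbigE [:: i]) //; last first.
    move=> k _; rewrite inE => ki; rewrite {1}/embed Ei eq_sym (negbTE ki) mul0r //.
  rewrite big_cons big_nil in_setT /= addr0 {1}/embed Ei eqxx mul1r /embed Ei.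
  by case: (finite_index n j).
pose r := map (@unindex n) (enum 'I_(q + n + q)).
have inr_ k a' : finite_index n k = Some a' -> k \in r.
  by move=> /finite_indexK <-; apply: map_f; rewrite mem_enum.
rewrite (fsbigE r) //; first last.
- move=> k _ kr; rewrite {1}/embed Ei.
  case Ek : (finite_index n k) => [b|]; first by rewrite (inr_ _ _ Ek) in kr.
  by case: eqP => [ik|_]; [rewrite ik Ek in Ei|rewrite mul0r].
- by rewrite map_inj_uniq ?enum_uniq //; exact: pcan_inj (@unindexK n).
rewrite big_map big_enum_cond /=.
case Ej : (finite_index n j) => [b|].
  have -> : embed (g *m h) i j = (g *m h) a b by rewrite /embed Ei Ej.
  rewrite mxE; apply: eq_big => [k|k _]; first by rewrite in_setT.
  by rewrite /embed Ei unindexK Ej.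
have ij : (i == j) = false by apply/eqP => ij; rewrite ij Ej in Ei.
have -> : embed (g *m h) i j = 0 by rewrite /embed Ei Ej ij.
rewrite big1 // => k _; rewrite /embed Ej Ei unindexK.
have -> : (unindex k == j) = false; last by rewrite mulr0.
by apply/eqP => kj; have := unindexK k; rewrite kj Ej.
Qed.

Definition lower (m : infmx R F q) : 'M[T]_q := \matrix_(k, l) m (inr k) (inr l).

Lemma lower_embed n (g : 'M[T]_(q + n + q)) : lower (embed g) = drsubmx g.
Proof. by apply/matrixP => k l; rewrite !mxE. Qed.

Section Enlarge.
Variables n d : nat.

(* Sends the d indices following the first q + n ones to the end. *)
Definition enlarge_index (a : 'I_(q + (n + d) + q)) : 'I_(q + n + q + d) :=
  match fintype.split a with
  | inl a' => match fintype.split (cast_ord (addnA q n d) a') with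
              | inl y => lshift d (lshift q y)
              | inr z => rshift (q + n + q) z
              end
  | inr k => lshift d (rshift (q + n) k)
  end.

Lemma enlarge_index_bij : bijective enlarge_index.
Proof.
apply: inj_card_bij; last by rewrite !card_ord addnA addnAC.
(* The map in terms of numbers, which reduces injectivity to linear arithmetic. *)
have vE a : val (enlarge_index a) = if (a < q + n)%N then val a else
    if (a < q + (n + d))%N then (a + q)%N else (a - d)%N.
  rewrite /enlarge_index; case: (split_ordP a) => a' -> /=.
  - case: (split_ordP (cast_ord (addnA q n d) a')) => y e /=;
      by have ye := congr1 val e; rewrite /= in ye; lia.
  - by case: ifP; lia.
move=> a b /(congr1 val); rewrite !vE => e; apply: val_inj => /=.
have := ltn_ord a; have := ltn_ord b; move: e.
by rewrite /=; do 4?[case: ifP => ?]; lia.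
Qed.

(** The inclusion of the n-th group in the (n + d)-th one: diag(g, 1) with the d new indices moved
    between the two blocks. *)
Definition enlarge (g : 'M[T]_(q + n + q)) : 'M[T]_(q + (n + d) + q) :=
  mxsub enlarge_index enlarge_index (block_mx g 0 0 1%:M).

Lemma finite_index_enlarge i :
  match @finite_index q (n + d) i with
  | Some a => match fintype.split (enlarge_index a) with
              | inl a0 => finite_index n i = Some a0
              | inr _ => finite_index n i = None
              end
  | None => finite_index n i = None
  end.
Proof.
case: i => [i|k] /=; last first.
  rewrite /enlarge_index (unsplitK (inr k)) /=.
  by rewrite (unsplitK (inl (rshift (q + n) k))).
case: insubP => [u ui uE|]; last first.
  move=> h; rewrite insubF //; apply/negbTE; apply: contra h => h.
  by apply: leq_trans h _; rewrite leq_add2l leq_addr.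
rewrite /= /enlarge_index (unsplitK (inl u)).
case: (split_ordP (cast_ord (addnA q n d) u)) => y e.
  rewrite (unsplitK (inl (lshift q y))).
  have iE : val y = i by rewrite -uE; exact/esym/(congr1 val e).
  by rewrite -iE valK.
rewrite (unsplitK (inr y)).
have iE : i = (q + n + y)%N by rewrite -uE; exact: (congr1 val e).
by rewrite insubF // iE ltnNge leq_addr.
Qed.

Lemma embed_enlarge g : embed (enlarge g) = embed g.
Proof.
apply/funext => i; apply/funext => j; rewrite /embed /enlarge.
have := finite_index_enlarge i; have := finite_index_enlarge j.
case Ei : (@finite_index q (n + d) i) => [a|] hj hi; last by rewrite hi.
case Ej : (@finite_index q (n + d) j) hj => [b|] hj; last first.
  by rewrite hj; case: (finite_index n i).
rewrite mxE; move: hi hj.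
case: (split_ordP (enlarge_index a)) => a' ea;
case: (split_ordP (enlarge_index b)) => b' eb hi hj; rewrite ?ea ?eb.
- by rewrite hi hj block_mxEul.
- rewrite hi hj block_mxEur mxE; case: eqP => // ij.
  by move: hj; rewrite -ij hi.
- rewrite hi block_mxEdl mxE; case: eqP => // ij.
  by move: hj; rewrite -ij hi.
- rewrite hi block_mxEdr mxE; congr ((nat_of_bool _)%:R); apply/eqP/eqP => [ab|ij].
    have ab' : a = b by apply: (bij_inj enlarge_index_bij); rewrite ea eb ab.
    by apply: finite_index_inj Ei _; rewrite ab'.
  by apply: (@rshift_inj (q + n + q)); rewrite -ea -eb; congr enlarge_index; move: Ej;
    rewrite -ij Ei => -[].
Qed.

End Enlarge.

End Embedding.

Section EnlargeGroup.
Variables (R : realType) (F : base_field) (q n d : nat).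
Local Notation T := (scalars R F).
Local Notation enlarge := (@enlarge R F q n d).

(** The right side does not involve m; as [embed] is injective, [enlarge] therefore maps signature
    matrices to signature matrices. *)
Lemma embed_signature m i j : embed (signature R F (q + m) q) i j =
  if i == j then (if i is inl _ then 1 else -1) else 0.
Proof.
rewrite /embed /finite_index /signature.
case: i => [i|k]; case: j => [j|l] /=.
- case: insubP => [u _ uE|/=]; last by move=> _; case: eqP.
  case: insubP => [v _ vE|/=]; last by move=> _; case: eqP.
  rewrite /= block_mxEul mxE -uE -vE.
  by rewrite -(inj_eq val_inj); case: eqP => [->|ne]; rewrite ?eqxx //; case: eqP => // -[].
- by case: insubP => [u _ uE|] //=; rewrite block_mxEur mxE.
- by case: insubP => [u _ uE|] //=; rewrite block_mxEdl mxE.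
- rewrite block_mxEdr !mxE; case: eqP => [->|ne]; first by rewrite eqxx.
  by case: eqP => [[]|] //; rewrite mulr0n oppr0.
Qed.

Lemma enlarge_signature : enlarge (signature R F (q + n) q) = signature R F (q + (n + d)) q.
Proof.
apply: (@embed_inj R F q (n + d)); rewrite embed_enlarge.
by apply/funext => i; apply/funext => j; rewrite !embed_signature.
Qed.

Lemma enlargeM g h : enlarge g *m enlarge h = enlarge (g *m h).
Proof.
rewrite /enlarge mxsub_bijM; last exact: enlarge_index_bij.
by rewrite mulmx_block !(mulmx0, mul0mx, mulmx1, addr0, add0r).
Qed.

Lemma enlarge1 : enlarge 1%:M = 1%:M.
Proof.
rewrite /enlarge -scalar_mx_block; apply/matrixP => i j; rewrite !mxE.
by rewrite (bij_eq (@enlarge_index_bij q n d)).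
Qed.

Lemma enlarge_ct g : ct (enlarge g) = enlarge (ct g).
Proof.
rewrite /enlarge.
have -> : block_mx (ct g) 0 0 1%:M = ct (block_mx g 0 0 1%:M : 'M[T]_(q + n + q + d)).
  by rewrite ct_block !raddf0 ct1.
by apply/matrixP => i j; rewrite !mxE.
Qed.

Lemma enlarge_iso g : isometries (signature R F (q + n) q) g ->
  isometries (signature R F (q + (n + d)) q) (enlarge g).
Proof.
by move=> /isoE[g1 g2]; apply/isoE; rewrite -enlarge_signature enlarge_ct !enlargeM g1 g2.
Qed.

Lemma enlarge_det g z : det_is g z -> det_is (enlarge g) z.
Proof.
move=> gz; apply: det_is_mxsub; first exact: enlarge_index_bij.
by rewrite -[z]mulr1; apply: det_is_diag => //; exact: det_is1.
Qed.

Lemma enlarge_continuous : continuous enlarge.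
Proof.
move=> A; apply/(@cvg_mxP _ _ _ (nbhs A)) => i j; rewrite mxE; under eq_fun do rewrite mxE.
apply: (@cvg_mx_entry _ _ _ (nbhs A)).
by apply: (@cvg_block_mx _ _ _ (nbhs A)); try exact: cvg_cst; exact: cvg_id.
Qed.

End EnlargeGroup.

Section InfiniteGroup.
Variables (R : realType) (F : base_field) (q : nat).
Local Notation T := (scalars R F).
Local Notation lower := (@lower R F q).

(** Over the reals [enlarge] is continuous and maps 1 to 1, so it respects identity components. *)
Lemma enlarge_G n d g : group_G R F q n g -> group_G R F q (n + d) (enlarge d g).
Proof.
have I := @enlarge_iso R F q n d g; have D := @enlarge_det R F q n d g.
move: g I D; rewrite /group_G /det_is; case: F => g I D.
- rewrite -(enlarge1 R Reals q n d); apply: connected_component_image.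
    exact: enlarge_continuous.
  move=> y [yi yd]; split; first exact: enlarge_iso.
  exact: (@enlarge_det R Reals q n d y 1).
- by move=> [gi gd]; split; [exact: I|exact: D].
- exact: I.
Qed.

(** Elements of levels m and n are both enlarged to level m + n or beyond, where products of finite
    matrices and [group_K_same_lower] apply. *)
Lemma Ginf_common g h : Ginf R F q g -> Ginf R F q h -> exists m, (0 < m)%N /\
  forall d, exists g' h', [/\ group_G R F q (m + d) g', group_G R F q (m + d) h',
     g = embed g' & h = embed h'].
Proof.
move=> [m m0 [g' Gg <-]] [n n0 [h' Gh <-]]; exists (m + n)%N; split; first by rewrite addn_gt0 m0.
move=> d; have Gg2 := @enlarge_G m (n + d) g' Gg.
have Gh2 := @enlarge_G n (m + d) h' Gh.
have e1 : (m + (n + d) = m + n + d)%N by rewrite addnA.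
have e2 : (n + (m + d) = m + n + d)%N by rewrite addnCA addnA.
have [g2 [Gg3 E3]] : exists g2, group_G R F q (m + n + d) g2 /\ embed g' = embed g2.
  by rewrite -e1; exists (enlarge (n + d) g'); rewrite embed_enlarge.
have [h2 [Gh3 E4]] : exists h2, group_G R F q (m + n + d) h2 /\ embed h' = embed h2.
  by rewrite -e2; exists (enlarge (m + d) h'); rewrite embed_enlarge.
by exists g2, h2; split.
Qed.

Lemma Ginf_embed n g : (0 < n)%N -> group_G R F q n g -> Ginf R F q (embed g).
Proof. by move=> n0 Gg; exists n => //; exists g. Qed.

Lemma Kinf_embed n g : (0 < n)%N -> group_K R F q n g -> Kinf R F q (embed g).
Proof. by move=> n0 Gg; exists n => //; exists g. Qed.

Lemma GinfM g h : Ginf R F q g -> Ginf R F q h -> Ginf R F q (infmul g h).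
Proof.
move=> Gg Gh; have [m [m0 /(_ 0%N) [g' [h' [Gg' Gh' -> ->]]]]] := Ginf_common Gg Gh.
rewrite infmul_embed; apply: Ginf_embed; last exact: group_GM.
by rewrite addn0.
Qed.

Lemma Kinf_G g : Kinf R F q g -> Ginf R F q g.
Proof. by move=> [n n0 [k Kk <-]]; apply: Ginf_embed => //; exact: group_K_G. Qed.

Lemma Ginf_lower_GL g : Ginf R F q g -> group_GL R F q (lower g).
Proof. by move=> [n n0 [k Gk <-]]; rewrite lower_embed; exact: (@group_G_GL _ _ _ n). Qed.

Lemma Ginf_lower_expanding g (x : 'rV[T]_q) : Ginf R F q g -> fro x <= fro (x *m lower g).
Proof. by move=> [n n0 [k Gk <-]]; rewrite lower_embed; exact: (@group_G_expanding _ _ _ n). Qed.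

Lemma biinvariant_lower phi g h : Kinf_biinvariant phi -> Ginf R F q g -> Ginf R F q h ->
  lower g = lower h -> phi g = phi h.
Proof.
move=> Kphi Gg Gh; have [m [m0 /(_ 0%N) [g' [h' [Gg' Gh' gE hE]]]]] := Ginf_common Gg Gh.
rewrite addn0 in g' h' Gg' Gh' gE hE.
rewrite gE hE !lower_embed => /(group_K_same_lower m0 Gg' Gh') [k [k' [Kk Kk' ->]]].
by rewrite -!infmul_embed Kphi //; [exact: Kinf_embed|exact: Kinf_embed|exact: Ginf_embed].
Qed.

End InfiniteGroup.

(** * Hyperbolic functions and the matrices a_t *)

Section Hyperbolic.
Variable R : realType.
Implicit Types x y d : R.

Lemma coshD x y : cosh (x + y) = cosh x * cosh y + sinh x * sinh y.
Proof. by rewrite /cosh /sinh opprD !expRD; field. Qed.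

Lemma sinhD x y : sinh (x + y) = cosh x * sinh y + sinh x * cosh y.
Proof. by rewrite /cosh /sinh opprD !expRD; field. Qed.

Lemma cosh0 : cosh (0 : R) = 1.
Proof. by rewrite /cosh oppr0 expR0; field. Qed.

Lemma sinh0 : sinh (0 : R) = 0.
Proof. by rewrite /sinh oppr0 subrr mul0r. Qed.

Lemma coshN x : cosh (- x) = cosh x.
Proof. by rewrite /cosh opprK addrC. Qed.

Lemma sinhN x : sinh (- x) = - sinh x.
Proof. by rewrite /sinh opprK; field. Qed.

Lemma cosh_ge1 x : 1 <= cosh x.
Proof.
have e : expR x * expR (- x) = 1 by rewrite -expRD subrr expR0.
have p := expR_gt0 x; have p' := expR_gt0 (- x).
have sq := sqr_ge0 (expR x - expR (- x)).
rewrite /cosh ler_pdivlMr // mul1r -(@ler_pXn2r _ 2) ?nnegrE ?addr_ge0 ?(ltW p) ?(ltW p') //.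
by rewrite !expr2 in sq *; nra.
Qed.

Lemma cosh_continuous : continuous (@cosh R).
Proof.
move=> x; apply: cvgM; last exact: cvg_cst.
apply: cvgD; first exact: continuous_expR.
apply: continuous_comp; [exact: opp_continuous|exact: continuous_expR].
Qed.

Lemma sinh_continuous : continuous (@sinh R).
Proof.
move=> x; apply: cvgM; last exact: cvg_cst.
apply: cvgB; first exact: continuous_expR.
apply: continuous_comp; [exact: opp_continuous|exact: continuous_expR].
Qed.

Definition arcosh d := ln (d + Num.sqrt (d ^+ 2 - 1)).

Lemma arcoshK d : 1 <= d -> cosh (arcosh d) = d.
Proof.
move=> d1; have d2 : 0 <= d ^+ 2 - 1 by rewrite subr_ge0 exprn_ege1.
set s := Num.sqrt (d ^+ 2 - 1); have s0 : 0 <= s by exact: sqrtr_ge0.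
have ss : s ^+ 2 = d ^+ 2 - 1 by rewrite sqr_sqrtr.
have u0 : 0 < d + s by lra.
rewrite /cosh expRN lnK ?posrE //.
have -> : (d + s)^-1 = d - s.
  apply: (mulfI (lt0r_neq0 u0)); rewrite mulfV ?lt0r_neq0 //.
  by rewrite (_ : (d + s) * (d - s) = d ^+ 2 - s ^+ 2); [rewrite ss; ring|ring].
by rewrite -/s; field.
Qed.

Lemma arcosh_ge0 d : 1 <= d -> 0 <= arcosh d.
Proof.
move=> d1; rewrite ln_ge0 //; have := sqrtr_ge0 (d ^+ 2 - 1); lra.
Qed.

Lemma ler_arcosh d d' : 1 <= d -> d <= d' -> arcosh d <= arcosh d'.
Proof.
move=> d1 dd'; have s0 := sqrtr_ge0 (d ^+ 2 - 1); have s0' := sqrtr_ge0 (d' ^+ 2 - 1).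
rewrite /arcosh ler_ln ?posrE; [|lra|lra].
by apply: lerD => //; apply: ler_wsqrtr; rewrite lerD2r ler_pXn2r ?nnegrE //; lra.
Qed.

End Hyperbolic.

Section Cartan.
Variables (R : realType) (F : base_field) (q : nat).
Local Notation T := (scalars R F).
Implicit Types t : 'rV[R]_q.

Definition ch t : 'M[T]_q := rdiag F (map_mx (@cosh R) t).
Definition sh t : 'M[T]_q := rdiag F (map_mx (@sinh R) t).

Lemma cosh_mxE t : cosh_mx F t = ch t.
Proof. by rewrite /cosh_mx /ch /rdiag; congr diag_mx; apply/rowP => i; rewrite !mxE. Qed.

Lemma chD s t : ch s *m ch t + sh s *m sh t = ch (s + t).
Proof.
rewrite !rdiagM; apply/matrixP => i j; rewrite mxE !rdiagE -mulrnDl -rmorphD !mxE.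
by rewrite coshD.
Qed.

Lemma shD s t : ch s *m sh t + sh s *m ch t = sh (s + t).
Proof.
rewrite !rdiagM; apply/matrixP => i j; rewrite mxE !rdiagE -mulrnDl -rmorphD !mxE.
by rewrite sinhD.
Qed.

Definition a_mx n t : 'M[T]_(q + n + q) :=
  block_mx (block_mx (ch t) 0 0 1%:M) (col_mx (sh t) 0) (row_mx (sh t) 0) (ch t).

Lemma embed_a n t : embed (a_mx n t) = a_inf F t.
Proof.
have insub_big (i : nat) : (q <= i)%N -> (insub i : option 'I_q) = None.
  by move=> qi; rewrite insubF // ltnNge qi.
have ltF (m : nat) (k : 'I_q) : (q + m == k)%N = false.
  by apply/negbTE; rewrite neq_ltn (leq_trans (ltn_ord k) (leq_addr _ _)) orbT.
have geF (i : nat) (k : 'I_q) : ~~ (i < q + n)%N -> (i == k) = false.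
  rewrite -leqNgt => qi; apply/negbTE; rewrite neq_ltn.
  by rewrite (leq_trans (ltn_ord k) (leq_trans (leq_addr _ _) qi)) orbT.
apply/funext => i; apply/funext => j; rewrite /embed /finite_index /a_mx /a_inf.
case: i => [i|k]; case: j => [j|l] /=.
- rewrite -[inl i == inl j]/(i == j).
  case: insubP => [u ui uE|ni] /=; last first.
    rewrite insub_big; last by rewrite -leqNgt in ni; exact: leq_trans (leq_addr _ _) ni.
    by case: eqP.
  case: insubP => [v vj vE|nj] /=; last first.
    by case: eqP => // ij; rewrite ij (negbTE nj) in ui.
  rewrite block_mxEul -uE -vE.
  case: (split_ordP u) => u' ->; case: (split_ordP v) => v' ->.
  + rewrite block_mxEul /ch rdiagE mxE /= valK (inj_eq val_inj).
    by case: (u' == v').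
  + rewrite block_mxEur mxE /=.
    by rewrite (eq_sym (u' : nat)) ltF.
  + by rewrite block_mxEdl mxE /= ltF.
  + rewrite block_mxEdr mxE /= eqn_add2l (inj_eq val_inj) insub_big ?leq_addr //.
    by case: (u' == v').
- case: insubP => [u ui uE|ni] /=; last by rewrite geF.
  rewrite block_mxEur -uE; case: (split_ordP u) => u' ->.
  + rewrite col_mxEu /sh rdiagE mxE /= (inj_eq val_inj).
    by case: eqP => // ->.
  + by rewrite col_mxEd mxE /= ltF.
- case: insubP => [v vj vE|nj] /=; last by rewrite geF.
  rewrite block_mxEdl -vE; case: (split_ordP v) => v' ->.
  + rewrite row_mxEl /sh rdiagE mxE /= (inj_eq val_inj) eq_sym.
    by case: eqP => // ->.
  + by rewrite row_mxEr mxE /= ltF.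
- by rewrite block_mxEdr /ch rdiagE mxE; case: (k == l).
Qed.

Lemma a_mxD n s t : a_mx n s *m a_mx n t = a_mx n (s + t).
Proof.
rewrite /a_mx !mulmx_block !mul_col_row !mul_block_col !mul_row_block !mul_row_col.
rewrite !mul_col_mx !mul_mx_row !(mulmx0, mul0mx, mulmx1, mul1mx).
have e1 : sh s *m ch t + ch s *m sh t = sh (s + t) by rewrite addrC shD.
have e2 : sh s *m sh t + ch s *m ch t = ch (s + t) by rewrite addrC chD.
by rewrite add_block_mx add_col_mx add_row_mx !addr0 !add0r chD shD e1 e2.
Qed.

Lemma ct_a n t : ct (a_mx n t) = a_mx n t.
Proof.
rewrite /a_mx ct_block; congr block_mx.
- by rewrite ct_block !raddf0 ct1 ct_rdiag.
- by apply/matrixP => i j; rewrite ctE; case: (split_ordP i) => k ->;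
    rewrite ?row_mxEl ?row_mxEr ?col_mxEu ?col_mxEd -?ctE ?ct_rdiag // !mxE raddf0.
- by apply/matrixP => i j; rewrite ctE; case: (split_ordP j) => k ->;
    rewrite ?row_mxEl ?row_mxEr ?col_mxEu ?col_mxEd -?ctE ?ct_rdiag // !mxE raddf0.
- exact: ct_rdiag.
Qed.

(** Conjugation by J inverts a_t; as a_t is its own adjoint, a_t J a_t = J follows. *)
Lemma a_signature n t : a_mx n t *m signature R F (q + n) q =
  signature R F (q + n) q *m a_mx n (- t).
Proof.
have shN : sh (- t) = - sh t.
  by apply/matrixP => i j; rewrite [RHS]mxE !rdiagE !mxE sinhN raddfN mulNrn.
have chN : ch (- t) = ch t.
  by apply/matrixP => i j; rewrite !rdiagE !mxE coshN.
rewrite /a_mx /signature !mulmx_block !(mulmx0, mul0mx, mulmx1, mul1mx, addr0, add0r) shN chN.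
rewrite !mulmxN !mulNmx mulmx1 mul1mx.
by rewrite opp_col_mx opp_row_mx opprK !oppr0 mulmx1 mul1mx.
Qed.

Lemma a_mx0 n : a_mx n 0 = 1%:M.
Proof.
have sh0 : sh 0 = 0 by apply/matrixP => i j; rewrite !rdiagE !mxE sinh0 raddf0 mul0rn.
have ch0 : ch 0 = 1%:M by apply/matrixP => i j; rewrite !rdiagE !mxE cosh0 rmorph1.
by rewrite /a_mx sh0 ch0 -scalar_mx_block col_mx0 row_mx0 -scalar_mx_block.
Qed.

Lemma a_iso n t : isometries (signature R F (q + n) q) (a_mx n t).
Proof.
apply/isoE; rewrite ct_a a_signature -mulmxA a_mxD addrC subrr a_mx0 mulmx1.
by split.
Qed.

Lemma a_continuous n : continuous (a_mx n).
Proof.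
have cr (f : R -> R) : continuous f ->
    continuous (fun t => rdiag F (map_mx f t) : 'M[T]_q).
  move=> fc t; apply/(@cvg_mxP _ _ _ (nbhs t)) => i j; rewrite rdiagE;
    under eq_fun do rewrite rdiagE.
  case: (i == j); last by under eq_fun do rewrite mulr0n; rewrite mulr0n; exact: cvg_cst.
  under eq_fun do rewrite mulr1n; rewrite mulr1n; apply: (@cvg_rs _ _ _ (nbhs t)).
  rewrite mxE; under eq_fun do rewrite mxE.
  by apply: continuous_comp; [exact: coord_continuous|exact: fc].
have cch : continuous ch := cr _ (@cosh_continuous R).
have csh : continuous sh := cr _ (@sinh_continuous R).
move=> t; rewrite /a_mx.
apply: (@cvg_block_mx _ _ _ (nbhs t)).
- by apply: (@cvg_block_mx _ _ _ (nbhs t)); try exact: cvg_cst; exact: cch.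
- apply/(@cvg_mxP _ _ _ (nbhs t)) => i j; case: (split_ordP i) => k ->.
    rewrite col_mxEu; under eq_fun do rewrite col_mxEu.
    by apply: (@cvg_mx_entry _ _ _ (nbhs t)); exact: csh.
  by rewrite col_mxEd; under eq_fun do rewrite col_mxEd; exact: cvg_cst.
- apply/(@cvg_mxP _ _ _ (nbhs t)) => i j; case: (split_ordP j) => k ->.
    rewrite row_mxEl; under eq_fun do rewrite row_mxEl.
    by apply: (@cvg_mx_entry _ _ _ (nbhs t)); exact: csh.
  by rewrite row_mxEr; under eq_fun do rewrite row_mxEr; exact: cvg_cst.
- exact: cch.
Qed.

(** Taking determinants in g J g = J and J^2 = 1 gives (det g)^2 = 1. *)
Lemma det_is_iso_sqr n (g : 'M[T]_(q + n + q)) :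
  isometries (signature R F (q + n) q) g -> ct g = g -> det_is (g *m g) 1.
Proof.
move=> /isoE[e _] cg; rewrite {}cg in e.
have J1 := @signatureK R F (q + n) q.
suff D (K : comNzRingType) m (A B : 'M[K]_m) : A *m B *m A = B -> B *m B = 1%:M ->
    \det (A *m A) = 1.
  rewrite /det_is; move: g e J1; case: F => // g e J1.
    exact: (@D R _ _ _ e J1).
  exact: (@D R[i] _ _ _ e J1).
move=> ABA /(congr1 determinant); have := congr1 determinant ABA.
rewrite !det_mulmx det1 => AB BB; rewrite -[LHS]mulr1 -BB.
by rewrite mulrA -(mulrA (\det A)) (mulrC (\det A) (\det B)) mulrA AB BB.
Qed.

Lemma a_det n t : det_is (a_mx n t) 1.
Proof.
(* a_t is the square of its value at t / 2, which removes the sign ambiguity of the determinant. *)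
have -> : t = (2^-1 *: t) + (2^-1 *: t).
  by apply/rowP => i; rewrite !mxE; field.
by rewrite -a_mxD; apply: det_is_iso_sqr; [exact: a_iso|exact: ct_a].
Qed.

Lemma lower_a_mx n t : drsubmx (a_mx n t) = ch t.
Proof. by rewrite block_mxKdr. Qed.

End Cartan.

(** * Cartan decomposition of the lower blocks *)

Section CartanDecomposition.
Variables (R : realType) (F : base_field) (q : nat).
Local Notation T := (scalars R F).
Local Notation lower := (@lower R F q).
Implicit Types t : 'rV[R]_q.

(** Over the reals the path of the matrices a at s t, for s in [0, 1], joins 1 to a_t within the
    isometries of determinant 1. *)
Lemma a_G n t : group_G R F q n (a_mx F n t).
Proof.
have i := @a_iso R F q n t; have d := @a_det R F q n t.
move: i d; rewrite /group_G /det_is; case: F => // i d.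
rewrite -[t]scale1r -(a_mx0 R Reals q n).
apply: (@connected_component_path R Reals _ _ _ (fun s => a_mx Reals n (s *: t))).
- apply: continuous_subspaceT => s; apply: continuous_comp; last exact: (@a_continuous R Reals q n).
  exact: scalel_continuous.
- by move=> s _; split; [exact: a_iso|exact: (@a_det R Reals q n)].
- by rewrite scale0r.
Qed.

Lemma a_inf_G t : Ginf R F q (a_inf F t).
Proof. by rewrite -(embed_a F 1); apply: Ginf_embed => //; exact: a_G. Qed.

Lemma lower_a t : lower (a_inf F t) = cosh_mx F t.
Proof. by rewrite -(embed_a F 1) lower_embed lower_a_mx cosh_mxE. Qed.

(* By the singular value decomposition these are the lower right blocks of the
   elements of G_infinity. *)
Definition expanding : set 'M[T]_q :=
  [set E | group_GL R F q E /\ forall x : 'rV[T]_q, fro x <= fro (x *m E)].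

Lemma Ginf_expanding g : Ginf R F q g -> expanding (lower g).
Proof. by move=> Gg; split; [exact: Ginf_lower_GL|move=> x; exact: Ginf_lower_expanding]. Qed.

(** The singular values are at least 1, hence hyperbolic cosines of nonnegative numbers, and
    [arcosh] preserves their order. *)
Lemma expanding_cosh E : expanding E -> exists V W t, [/\ group_U R F q V, group_U R F q W,
  C_B t & E = V *m cosh_mx F t *m W].
Proof.
move=> [GE Ex]; have [V [W [d [UV UW EE d0 dle]]]] := GL_svd GE.
have d1 i : 1 <= d 0 i.
  apply: (expanding_svd _ _ (unitary_group_U UV) (unitary_group_U UW) EE) => //.
    by move=> x; rewrite expr1n mul1r.
  by move=> j; exact: ltW.
exists V, W, (map_mx (@arcosh R) d); split => //.
  split=> [i j ij|i]; rewrite !mxE; first by apply: ler_arcosh => //; exact: dle.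
  exact: arcosh_ge0.
rewrite cosh_mxE /ch EE; congr (_ *m rdiag F _ *m _); apply/rowP => i.
by rewrite !mxE arcoshK.
Qed.

Lemma group_U_lift V : (0 < q)%N -> group_U R F q V -> exists2 k, Kinf R F q k &
  exists2 A, k = embed (block_mx A 0 0 V : 'M[T]_(q + 1 + q)) & group_K R F q 1 (block_mx A 0 0 V).
Proof.
move=> q0 UV; have [|A uA KA] := @group_K_lift R F q 1 V _ UV; first by rewrite addn1.
exists (embed (block_mx A 0 0 V : 'M[T]_(q + 1 + q))); first exact: Kinf_embed.
by exists A.
Qed.

Lemma lower_lift n (A B : 'M[T]_(q + n)) (V W : 'M[T]_q) (g : 'M[T]_(q + n + q)) :
  drsubmx (block_mx A 0 0 V *m g *m block_mx B 0 0 W) = V *m drsubmx g *m W.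
Proof.
rewrite -{1}[g]submxK !mulmx_block !(mulmx0, mul0mx, addr0, add0r).
by rewrite block_mxKdr.
Qed.

(** V (cosh t) W is the lower block of k a_t k' when k and k' have the lower blocks V and W. *)
Lemma expanding_lift E : (0 < q)%N -> expanding E -> exists2 g, Ginf R F q g & lower g = E.
Proof.
move=> q0 /expanding_cosh[V [W [t [UV UW _ ->]]]].
have [k Kk [A kE KA]] := group_U_lift q0 UV; have [k' Kk' [B kE' KB]] := group_U_lift q0 UW.
exists (infmul (infmul k (a_inf F t)) k').
  by apply: GinfM; [apply: GinfM; [exact: Kinf_G|exact: a_inf_G]|exact: Kinf_G].
by rewrite kE kE' -(embed_a F 1) !infmul_embed lower_embed lower_lift lower_a_mx cosh_mxE.
Qed.

Lemma cosh_expanding t : expanding (cosh_mx F t).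
Proof. by rewrite -lower_a; exact/Ginf_expanding/a_inf_G. Qed.

Lemma unitary_expanding V E W : group_U R F q V -> group_U R F q W -> expanding E ->
  expanding (V *m E *m W).
Proof.
move=> UV UW [GE Ex]; split.
  by apply: group_GLM; [apply: group_GLM|]; rewrite //; exact: group_U_GL.
move=> x; have /unitaryE[_ V2] := unitary_group_U UV; have /unitaryE[_ W2] := unitary_group_U UW.
rewrite !mulmxA fro_unitr //; apply: le_trans (Ex _).
by rewrite fro_unitr.
Qed.

Lemma expandingM E E' : expanding E -> expanding E' -> expanding (E *m E').
Proof.
move=> [GE Ex] [GE' Ex']; split; first exact: group_GLM.
by move=> x; rewrite mulmxA; apply: le_trans (Ex _) (Ex' _).
Qed.

End CartanDecomposition.

(** From a compact set to a Hausdorff space p is closed, hence a quotient map onto its image.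
    Concretely, the points of K that [f \o p] does not send into an open set B form a compact set C,
    whose image is closed and misses p x0; outside that image f takes values in B. *)
Lemma quotient_within_continuous {X Y Z : topologicalType} (K : set X) (p : X -> Y) (f : Y -> Z) :
  hausdorff_space Y -> compact K -> {within K, continuous p} ->
  {within K, continuous (f \o p)} -> {within p @` K, continuous f}.
Proof.
move=> hY cK cp cf; apply/within_continuousP => _ [x0 Kx0 <-] U.
rewrite nbhsE => -[B [oB Bx0] BU].
have [W oW WK] : exists2 W, open W & K `&` W = K `&` (f \o p) @^-1` B.
  have /continuousP /(_ _ oB) := cf.
  move=> /open_subspaceP[W oW e]; exists W => //.
  by rewrite setIC e setIC.
pose C := K `&` ~` W.
have cC : compact C by apply: compact_closedI => //; rewrite closedC.
have clC : closed (p @` C).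
  apply: compact_closed => //; apply: continuous_compact => //.
  by apply: continuous_subspaceW cp; exact: subIsetl.
have nC : ~ (p @` C) (p x0).
  move=> [x [Kx nWx] e]; apply: nWx.
  suff [] : (K `&` W) x by [].
  by rewrite WK; split => //=; rewrite e.
have : nbhs (p x0) (~` (p @` C)) by apply: open_nbhs_nbhs; split => //; rewrite openC.
move=> h; have : nbhs (p x0) [set y | (p @` K) y -> U (f y)]; last by [].
apply: filterS h => y nCy [x Kx xy]; apply: BU.
have Wx : W x by apply: contrapT => nWx; apply: nCy; exists x.
suff [] : (K `&` (f \o p) @^-1` B) x by rewrite /= xy.
by rewrite -WK.
Qed.

(** * Factorization of biinvariant functions through the lower block *)

Section LowerProducts.
Variables (R : realType) (F : base_field) (q : nat).
Local Notation lower := (@lower R F q).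

Lemma lower_infmull k g : (forall i a, k (inr i) (inl a) = 0) ->
  lower (infmul k g) = lower k *m lower g.
Proof.
move=> k0; apply/matrixP => i j; rewrite !mxE /infmul.
rewrite (fsbigE (map inr (enum 'I_q))) //; first last.
- move=> [a|l] _; first by rewrite k0 mul0r.
  by rewrite map_f // mem_enum.
- by rewrite map_inj_uniq ?enum_uniq // => a b [].
rewrite big_map big_enum_cond /=; apply: eq_big => [l|l _]; first by rewrite in_setT.
by rewrite !mxE.
Qed.

Lemma lower_infmulr g k : (forall i a, k (inl a) (inr i) = 0) ->
  lower (infmul g k) = lower g *m lower k.
Proof.
move=> k0; apply/matrixP => i j; rewrite !mxE /infmul.
rewrite (fsbigE (map inr (enum 'I_q))) //; first last.
- move=> [a|l] _; first by rewrite k0 mulr0.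
  by rewrite map_f // mem_enum.
- by rewrite map_inj_uniq ?enum_uniq // => a b [].
rewrite big_map big_enum_cond /=; apply: eq_big => [l|l _]; first by rewrite in_setT.
by rewrite !mxE.
Qed.

Lemma Kinf_lower k : Kinf R F q k -> [/\ group_U R F q (lower k),
  forall i a, k (inr i) (inl a) = 0 & forall i a, k (inl a) (inr i) = 0].
Proof.
move=> [n n0 [k0 Kk <-]]; split; first by rewrite lower_embed; exact: group_K_lower_U Kk.
- move: Kk => [A [D [_ _ _ ->]]] i a; rewrite /embed /=.
  by case: insubP => //= u _ _; rewrite block_mxEdl mxE.
- move: Kk => [A [D [_ _ _ ->]]] i a; rewrite /embed /=.
  by case: insubP => //= u _ _; rewrite block_mxEur mxE.
Qed.

Lemma Kinf_lowerM k g k' : Kinf R F q k -> Kinf R F q k' ->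
  lower (infmul (infmul k g) k') = lower k *m lower g *m lower k'.
Proof.
move=> /Kinf_lower[_ k0 _] /Kinf_lower[_ _ k1].
by rewrite lower_infmulr // lower_infmull.
Qed.

End LowerProducts.

Section LowerTopology.
Variables (R : realType) (F : base_field) (q : nat).
Local Notation T := (scalars R F).
Local Notation lower := (@lower R F q).
Local Notation expanding := (@expanding R F q).

Lemma group_U_compact : compact (group_U R F q).
Proof.
rewrite /group_U; case: F; try exact: unitary_compact.
apply: compact_closedI; first exact: unitary_compact.
apply: (@closed_comp _ _ (fun A : 'M[scalars R Reals]_q => \det A : R) [set y | y =
  1]) => [x _|]; last exact: closed_eq.
exact: (@det_continuous R Reals).
Qed.

Lemma embed_within_continuous n : (0 < n)%N ->
  {within group_G R F q n, continuous (@embed R F q n)}.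
Proof. by move=> n0; apply/continuousP => U oU; exact: oU. Qed.

Lemma lower_continuous : continuous lower.
Proof.
apply/continuousP => U oU.
change (infmx_open (lower @^-1` U)) => n n0.
have -> : embed (n:=n) @^-1` (lower @^-1` U) = @drsubmx T (q + n) q (q + n) q @^-1` U.
  by apply/seteqP; split=> g /=; rewrite lower_embed.
apply: open_subspaceW; move/continuousP : (@drsubmx_continuous R F (q + n) q (q + n) q).
exact.
Qed.

Definition cartan (x : 'M[T]_q * 'rV[R]_q * 'M[T]_q) : 'M[T]_q :=
  x.1.1 *m cosh_mx F x.1.2 *m x.2.

(** A product of compact sets: t ranges over a cube instead of a part of [C_B], and the image under
    [cartan] still consists of expanding matrices. *)
Definition cartan_box (M : R) : set ('M[T]_q * 'rV[R]_q * 'M[T]_q) :=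
  (group_U R F q `*` [set t : 'rV[R]_q | forall i, t ord0 i \in `[0, M]]) `*` group_U R F q.

Lemma cartan_box_compact M : compact (cartan_box M).
Proof.
apply: compact_setX; last exact: group_U_compact.
apply: compact_setX; first exact: group_U_compact.
apply: (@rV_compact R q (fun=> [set x | x \in `[0, M]])) => i.
exact: segment_compact.
Qed.

Lemma cartan_continuous : continuous cartan.
Proof.
move=> x; apply: (@cvg_mulmx _ _ _ (nbhs x)); last exact: cvg_snd.
apply: (@cvg_mulmx _ _ _ (nbhs x)).
  by apply: (@cvg_comp _ _ _ fst fst); [exact: cvg_fst|exact: cvg_fst].
have cc : continuous (fun t : 'rV[R]_q => cosh_mx F t).
  have -> : (fun t : 'rV[R]_q => cosh_mx F t) = drsubmx \o @a_mx R F q 0.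
    by apply/funext => t; rewrite /= lower_a_mx cosh_mxE.
  by move=> t; apply: continuous_comp; [exact: a_continuous|exact: drsubmx_continuous].
apply: (@cvg_comp _ _ _ (fun x : 'M[T]_q * 'rV[R]_q * 'M[T]_q => x.1.2) (fun t => cosh_mx F t));
  last exact: cc.
by apply: (@cvg_comp _ _ _ fst snd); [exact: cvg_fst|exact: cvg_snd].
Qed.

Lemma cartan_expanding M : cartan @` cartan_box M `<=` expanding.
Proof.
move=> _ [[[V t] W] [[/= UV _] UW] <-].
by apply: unitary_expanding => //; exact: cosh_expanding.
Qed.

(** Properness of the decomposition: t_i <= 2 cosh t_i <= 2 (cosh t_i)^2, and (cosh t_i)^2 is the
    squared length of a row of V* E, hence at most [fro E]. *)
Lemma expanding_cartan E : expanding E -> (cartan @` cartan_box (2 * fro E)) E.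
Proof.
move=> EE; have [V [W [t [UV UW [_ t0] eE]]]] := expanding_cosh EE.
exists (V, t, W); last by rewrite eE.
split => //; split => //= i; rewrite in_itv /= t0 /=.
have eE' : E = V *m rdiag F (map_mx (@cosh R) t) *m W by rewrite eE cosh_mxE.
have [h1 h2] := svd_entry i (unitary_group_U UV) (unitary_group_U UW) eE'.
have h3 : cosh (t 0 i) ^+ 2 <= fro E.
  rewrite mxE in h1; rewrite -h1 eE -{1}[V](mul1mx).
  have /unitaryE[V1 V2] := unitary_group_U UV.
  rewrite mul1mx -eE -row_mul -[leRHS](@fro_unitl R F _ _ E (ct V)) ?ctK //.
  rewrite [leRHS]fro_row (bigD1 i) //= lerDl.
  by apply: sumr_ge0 => j _; exact: fro_ge0.
have h4 := cosh_ge1 (t 0 i).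
have h5 : t 0 i <= 2 * cosh (t 0 i).
  rewrite /cosh mulrC divfK //; have := expR_ge1Dx (t 0 i); have := expR_gt0 (- t 0 i); lra.
by apply: le_trans h5 _; rewrite ler_pM2l //; apply: le_trans h3; rewrite expr2; nra.
Qed.

Lemma cartan_box_le M N : M <= N -> cartan @` cartan_box M `<=` cartan @` cartan_box N.
Proof.
move=> MN _ [[[V t] W] [[/= UV ht] UW] <-]; exists (V, t, W) => //; split => //; split => //= i.
by have := ht i; rewrite !in_itv /= => /andP[-> /le_trans ->].
Qed.

Lemma continuous_within_expanding (Z : topologicalType) (f : 'M[T]_q -> Z) :
  (forall M, {within cartan @` cartan_box M, continuous f}) ->
  {within expanding, continuous f}.
Proof.
move=> fM; apply/within_continuousP => E EE U UE.
(* All matrices near E have [fro] below [fro E + 1], so one box covers the expanding matrices in a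
   neighbourhood. *)
pose M := 2 * (fro E + 1).
have /within_continuousP /(_ E) := fM M.
have EM : (cartan @` cartan_box M) E.
  by apply: cartan_box_le (expanding_cartan EE); rewrite /M ler_pM2l // lerDl.
move=> /(_ EM U UE) /= h.
have h1 : nbhs E [set A | (cartan @` cartan_box M) A -> U (f A)] := h.
have h2 : nbhs E [set A : 'M[T]_q | fro A < fro E + 1].
  apply: (@open_nbhs_nbhs _ E); split; last by rewrite /= ltrDl.
  apply: (@open_comp _ _ (@fro R F q q) [set y : R | y < fro E + 1]); last exact: open_lt.
  by move=> x _; exact: fro_continuous.
have : nbhs E [set A | expanding A -> U (f A)].
  apply: filterS (filterI h1 h2) => A [/= hU hA] eA; apply: hU.
  by apply: cartan_box_le (expanding_cartan eA); rewrite /M ler_pM2l // ltW.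
by [].
Qed.

Lemma biinvariant_cosh phi (f : 'M[T]_q -> R[i]) V W t : (0 < q)%N -> Kinf_biinvariant phi ->
  (forall g, Ginf R F q g -> phi g = f (lower g)) ->
  group_U R F q V -> group_U R F q W ->
  f (V *m cosh_mx F t *m W) = phi (a_inf F t).
Proof.
move=> q0 Kphi fE UV UW.
have [k Kk [A kE KA]] := group_U_lift q0 UV; have [k' Kk' [B kE' KB]] := group_U_lift q0 UW.
rewrite -(Kphi k k' _ Kk Kk' (a_inf_G F t)) fE; last first.
  by apply: GinfM; [apply: GinfM; [exact: Kinf_G|exact: a_inf_G]|exact: Kinf_G].
by rewrite Kinf_lowerM // lower_a kE kE' !lower_embed !block_mxKdr.
Qed.

(** The point is the continuity of f: on each box, f composed with [cartan] sends (V, t, W) to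
    phi(a_t), which is continuous in t, and [quotient_within_continuous] carries this down to the
    image. *)
Lemma biinvariant_factor (phi : infmx R F q -> R[i]) : (0 < q)%N ->
  {within Ginf R F q, continuous phi} -> Kinf_biinvariant phi ->
  exists2 f : 'M[T]_q -> R[i], {within expanding, continuous f} &
    forall g, Ginf R F q g -> phi g = f (lower g).
Proof.
move=> q0 cphi Kphi.
(* The value at any preimage, independent of the choice by [biinvariant_lower]; 0 is a default off
   the set of lower blocks. *)
pose f E := match pselect (exists2 g, Ginf R F q g & lower g = E) with
  | left h => phi (projT1 (cid2 h)) | right _ => 0 end.
have fE g : Ginf R F q g -> phi g = f (lower g).
  move=> Gg; rewrite /f; case: pselect => [h|[]]; last by exists g.
  by apply: biinvariant_lower => //; case: (cid2 h).
exists f => //; apply: continuous_within_expanding => M.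
apply: quotient_within_continuous.
- exact: mx_hausdorff.
- exact: cartan_box_compact.
- exact: continuous_subspaceT cartan_continuous.
have e x : cartan_box M x -> f (cartan x) = phi (a_inf F x.1.2).
  by case: x => [[V t] W] [[/= UV _] UW]; exact: biinvariant_cosh.
have ca : continuous (fun t : 'rV[R]_q => phi (a_inf F t)).
  have ce : {within group_G R F q 1, continuous phi \o @embed R F q 1}.
    apply: (@comp_within_continuous _ _ _ (group_G R F q 1) (Ginf R F q) (@embed R F q 1) phi) =>
      //.
      by move=> y; exact: Ginf_embed.
    exact: embed_within_continuous.
  have h : continuous ((phi \o @embed R F q 1) \o @a_mx R F q 1).
    apply/continuous_subspace_setT.
    apply: (@comp_within_continuous _ _ _ setT (group_G R F q 1) (@a_mx R F q 1) (phi \o @embed R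
      F q 1)) => //; first by move=> t _; exact: a_G.
    exact: continuous_subspaceT (@a_continuous R F q 1).
  move=> t.
  have -> : (fun t : 'rV[R]_q => phi (a_inf F t)) = phi \o @embed R F q 1 \o @a_mx R F q 1.
    by apply/funext => s /=; rewrite embed_a.
  exact: h.
apply: (@subspace_eq_continuous _ _ _ (fun x => phi (a_inf F x.1.2))).
  by move=> x; rewrite inE => /e.
apply: continuous_subspaceT => x.
apply: (@cvg_comp _ _ _ (fun x : 'M[T]_q * 'rV[R]_q * 'M[T]_q => x.1.2) (fun t => phi (a_inf F
  t))); last exact: ca.
by apply: (@cvg_comp _ _ _ fst snd); [exact: cvg_fst|exact: cvg_snd].
Qed.

End LowerTopology.

(** * Integrals of continuous functions over compact sets and Fubini's theorem *)

Section BorelIntegral.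
Variables (R : realType) (X : ptopologicalType) (mu : probability (borel X) R).
Implicit Types (K A : set X) (u v : X -> R).

Lemma borel_open (U : set X) : open U -> measurable (U : set (borel X)).
Proof. exact: sub_sigma_algebra. Qed.

Lemma borel_closed (U : set X) : closed U -> measurable (U : set (borel X)).
Proof. by move=> cU; rewrite -[U]setCK; apply: measurableC; apply: borel_open; rewrite openC. Qed.

Lemma borel_continuous_measurable K u : closed K -> {within K, continuous u} ->
  measurable_fun (K : set (borel X)) (u : borel X -> R).
Proof.
move=> cK /continuousP cu; apply: (measurability _ (RGenOpens.measurableE R)).
move=> _ [_ [a [b ->] <-]].
have /open_subspaceP[W oW e] : open (from_subspace K u @^-1` `]a, b[%classic).
  by apply: cu; exact: interval_open.
have -> : K `&` u @^-1` `]a, b[%classic = W `&` K by rewrite setIC e.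
by apply: measurableI; [exact: borel_open|exact: borel_closed].
Qed.

Variables (K : set X) (cK : compact K) (clK : closed K) (muK : mu K = 1%E).

Local Notation int A u := (Rintegral mu (A : set (borel X)) u).

Lemma continuous_integrable u : {within K, continuous u} ->
  mu.-integrable (K : set (borel X)) (EFin \o u).
Proof.
move=> cu; apply: measurable_bounded_integrable; first exact: borel_closed.
- by apply: (@le_lt_trans _ _ 1%E); [rewrite -[leRHS]muK|rewrite ltry].
- exact: borel_continuous_measurable.
have /compact_bounded[M [_ mrt]] := continuous_compact cu cK.
by exists M; split; rewrite ?num_real // => ? ? ? ?; exact: mrt.
Qed.

Lemma int_cst c : int K (fun=> c) = c.
Proof.
rewrite Rintegral_cst; last exact: borel_closed.
by rewrite [X in fine X](_ : _ = 1%E) ?mulr1 //; exact: muK.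
Qed.

(** Both integrands are extended by 0 outside K, which f and its inverse image preserve; then the
    image measure of mu under f is mu. *)
Lemma int_translation u (f : X -> X) : {within K, continuous u} ->
  continuous f -> (forall x, K (f x) <-> K x) ->
  (forall A : set (borel X), measurable A -> mu (f @^-1` A) = mu A) ->
  int K (u \o f) = int K u.
Proof.
move=> cu cf fK mf; rewrite Rintegral_mkcond [RHS]Rintegral_mkcond.
have mK : measurable (K : set (borel X)) by exact: borel_closed.
have mF : measurable_fun [set: borel X] (f : borel X -> borel X).
  apply: (@measurability _ _ (borel X) (borel X) setT f (@open X)); first by [].
  move=> _ [B oB <-]; rewrite setTI; apply: borel_open.
  by move/continuousP : cf; apply.
pose v : borel X -> R := u \_ K.
have mu' : measurable_fun [set: borel X] (EFin \o v).
  apply/measurable_EFinP; apply/(measurable_restrictT _ mK).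
  exact: borel_continuous_measurable.
have fKE x : (f x \in K) = (x \in K) by apply/idP/idP; rewrite !inE => /fK.
have e1 x : v (f x) = if x \in K then u (f x) else 0 by rewrite /v /patch fKE.
have cuf : {within K, continuous (u \o f)}.
  apply: (@comp_within_continuous _ _ _ K K) => //; last exact: continuous_subspaceT.
  by move=> y; rewrite fK.
rewrite /Rintegral; congr fine.
have i1 : mu.-integrable [set: borel X] ((EFin \o v) \o f).
  have -> : (EFin \o v) \o f = (EFin \o (u \o f)) \_ K.
    by apply/funext => x; rewrite /= e1 /patch; case: ifP.
  by apply/(integrable_mkcond _ mK); exact: continuous_integrable.
have := @integral_pushforward _ _ (borel X) (borel X) R f mF mu setT (EFin \o v) mu'.
rewrite preimage_setT => /(_ i1 measurableT) e2.
transitivity (\int[mu]_x ((EFin \o v) \o f) x)%E.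
  by apply: eq_integral => x _; rewrite /= e1.
rewrite -e2; apply: eq_measure_integral => A mA _; exact: mf.
Qed.

Lemma continuous_integrableS A u : measurable (A : set (borel X)) -> A `<=` K ->
  {within K, continuous u} -> mu.-integrable (A : set (borel X)) (EFin \o u).
Proof.
move=> mA AK cu; apply: (integrableS _ mA AK); first exact: borel_closed.
exact: continuous_integrable.
Qed.

Lemma int_distW A u v w : measurable (A : set (borel X)) ->
  mu.-integrable (A : set (borel X)) (EFin \o u) ->
  mu.-integrable (A : set (borel X)) (EFin \o v) ->
  mu.-integrable (A : set (borel X)) (EFin \o w) ->
  (forall x, A x -> `|u x - v x| <= w x) ->
  `|int A u - int A v| <= int A w.
Proof.
move=> mA iu iv iw uv; rewrite -RintegralB //.
have iuv : mu.-integrable (A : set (borel X)) (EFin \o (fun x => u x - v x)).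
  by have := integrableB mA iu iv; apply: eq_integrable.
apply: le_trans (le_normr_Rintegral mA iuv) _.
apply: le_Rintegral => //.
by have := integrable_norm iuv; apply: eq_integrable.
Qed.

Lemma int_dist_le A u v e : measurable (A : set (borel X)) ->
  mu.-integrable (A : set (borel X)) (EFin \o u) ->
  mu.-integrable (A : set (borel X)) (EFin \o v) ->
  (forall x, A x -> `|u x - v x| <= e) ->
  `|int A u - int A v| <= e * fine (mu A).
Proof.
move=> mA iu iv uv; rewrite -Rintegral_cst //; apply: int_distW => //.
exact: finite_measure_integrable_cst.
Qed.

Lemma int_sum (I : Type) (r : seq I) (u : I -> X -> R) :
  (forall i, {within K, continuous (u i)}) ->
  int K (fun x => \sum_(i <- r) u i x) = \sum_(i <- r) int K (u i).
Proof.
move=> cu.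
have cs (s : seq I) : {within K, continuous (fun x => \sum_(i <- s) u i x)}.
  elim: s => [|i s IH] x; first by under eq_fun do rewrite big_nil; exact: cvg_cst.
  by under eq_fun do rewrite big_cons; apply: cvgD; [exact: cu|exact: IH].
elim: r => [|i r IH]; first by under eq_Rintegral do rewrite big_nil; rewrite int_cst big_nil.
under eq_Rintegral do rewrite big_cons.
rewrite RintegralD ?IH ?big_cons //; first exact: borel_closed.
- exact: continuous_integrable.
- exact: continuous_integrable.
Qed.

Lemma fine_mu_le1 A : measurable (A : set (borel X)) -> 0 <= fine (mu A) <= 1.
Proof.
move=> mA; have h1 : (mu A <= 1)%E by exact: probability_le1.
have h2 : (0 <= mu A)%E by [].
by rewrite -!lee_fin fineK ?h1 ?h2 // ge0_fin_numE // (le_lt_trans h1) // ltry.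
Qed.

End BorelIntegral.

Section ParametricContinuity.
Variables (R : realType) (X Y : ptopologicalType) (nu : probability (borel Y) R).
Variables (K : set X) (L : set Y).
Hypotheses (cL : compact L) (clL : closed L) (nuL : nu L = 1%E).
Variable F : X -> Y -> R.
Hypothesis Fc : {within K `*` L, continuous (fun p => F p.1 p.2)}.

Lemma section_continuous x : K x -> {within L, continuous (F x)}.
Proof.
move=> Kx; apply: (@comp_within_continuous _ _ _ L (K `*` L) (fun y => (x, y)) _ _ _ Fc) => //.
apply: continuous_subspaceT => y; apply: cvg_pair => //=; exact: cvg_cst.
Qed.

(** The tube lemma: compactness of L makes the continuity in x uniform in y. *)
Lemma tube x0 e : K x0 -> 0 < e ->
  nbhs x0 [set x | K x -> forall y, L y -> `|F x y - F x0 y| < e].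
Proof.
move=> Kx0 e0; have /compact_near_coveringP := cL.
move=> /(_ X (nbhs x0) (fun x y => K x -> L y -> `|F x y - F x0 y| < e) _) h.
have : \forall x \near x0, L `<=` (fun y => K x -> L y -> `|F x y - F x0 y| < e).
  apply: h => y0 Ly0.
  have /within_continuousP /(_ (x0, y0) (conj Kx0 Ly0)) /cvgrPdist_lt := Fc.
  move=> /(_ (e / 2)); rewrite divr_gt0 // => /(_ isT) [[A B] /= [nA nB] AB].
  have Ax0 : A x0 by exact: nbhs_singleton.
  exists (B, A) => //= -[y x] [/= By Ax] Kx Ly.
  have h1 := AB (x, y) (conj Ax By) (conj Kx Ly).
  have h2 := AB (x0, y) (conj Ax0 By) (conj Kx0 Ly).
  rewrite /= in h1 h2; rewrite [e]splitr.
  have -> : F x y - F x0 y = (F x0 y0 - F x0 y) - (F x0 y0 - F x y) by ring.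
  by apply: le_lt_trans (ler_normB _ _) _; exact: ltrD.
by apply: filterS => x LK Kx y Ly; exact: LK.
Qed.

Lemma partial_int_continuous A : measurable (A : set (borel Y)) -> A `<=` L ->
  {within K, continuous (fun x => Rintegral nu (A : set (borel Y)) (F x))}.
Proof.
move=> mA AL; apply/within_continuousP => x0 Kx0; apply/cvgrPdist_lt => e e0.
have := tube Kx0 (divr_gt0 e0 (ltr0n _ 2)) => h.
have : nbhs x0 [set x | K x -> `|Rintegral nu (A : set (borel Y)) (F x0) - Rintegral nu (A : set
  (borel Y)) (F x)| < e]; last by [].
apply: filterS h => x h Kx; apply: le_lt_trans (@int_dist_le _ _ nu A _ _ (e / 2) mA _ _ _) _.
- by apply: (continuous_integrableS cL clL nuL) => //; exact: section_continuous.
- by apply: (continuous_integrableS cL clL nuL) => //; exact: section_continuous.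
- by move=> y Ay; rewrite distrC ltW //; apply: h => //; exact: AL.
have /andP[m0 m1] := fine_mu_le1 nu mA.
by apply: le_lt_trans (ler_wpM2l _ m1) _; [rewrite divr_ge0 // ltW|rewrite mulr1 ltr_pdivrMr //
  ltr_pMr // ltr1n].
Qed.

End ParametricContinuity.

Section Fubini.
Variables (R : realType) (X Y : ptopologicalType).
Variables (mu : probability (borel X) R) (nu : probability (borel Y) R).
Variables (K : set X) (L : set Y).
Hypotheses (cK : compact K) (clK : closed K) (muK : mu K = 1%E).
Hypotheses (cL : compact L) (clL : closed L) (nuL : nu L = 1%E).
Variable F : X -> Y -> R.
Hypothesis Fc : {within K `*` L, continuous (fun p => F p.1 p.2)}.

Local Notation intX A u := (Rintegral mu (A : set (borel X)) u).
Local Notation intY A u := (Rintegral nu (A : set (borel Y)) u).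

Lemma swap_continuous : {within L `*` K, continuous (fun p => F p.2 p.1)}.
Proof.
apply: (@comp_within_continuous _ _ _ (L `*` K) (K `*` L) (fun p => (p.2, p.1)) _ _ _ Fc).
  by move=> [y x] [].
by apply: continuous_subspaceT => p; apply: cvg_pair; [exact: cvg_snd|exact: cvg_fst].
Qed.

Let G := fun y x => F x y.

Let sx x : K x -> {within L, continuous (F x)}.
Proof. exact: (section_continuous Fc). Qed.

Let sy y : L y -> {within K, continuous (G y)}.
Proof. exact: (@section_continuous R Y X L K G swap_continuous). Qed.

Let px : {within K, continuous (fun x => intY L (F x))}.
Proof. by apply: (partial_int_continuous cL clL nuL Fc) => //; exact: borel_closed. Qed.

Let py (A : set X) : measurable (A : set (borel X)) -> A `<=` K ->
  {within L, continuous (fun y => intX A (G y))}.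
Proof. exact: (@partial_int_continuous R Y X mu L K cK clK muK G swap_continuous). Qed.

(** The error made by exchanging the integrals over A and L. It is additive in A, and at most 2 e
    mu(A) when F x y stays within e of some F x0 y for x in A. *)
Let defect (A : set X) := intX A (fun x => intY L (F x)) - intY L (fun y => intX A (G y)).

Let defectU (A B : set X) : measurable (A : set (borel X)) -> measurable (B : set (borel X)) ->
  A `<=` K -> B `<=` K -> A `&` B = set0 -> defect (A `|` B) = defect A + defect B.
Proof.
move=> mA mB AK BK AB; rewrite /defect.
have dAB : [disjoint A & B] by apply/eqP.
have mAB : measurable (A `|` B : set (borel X)) by exact: measurableU.
have ABK : A `|` B `<=` K by move=> x [/AK|/BK].
rewrite Rintegral_setU //; last exact: continuous_integrableS cK clK muK _ _ _ _ _.
have -> : intY L (fun y => intX (A `|` B) (G y)) = intY L (fun y => intX A (G y) + intX B (G y)).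
  apply: eq_Rintegral => y; rewrite inE => Ly; rewrite Rintegral_setU //.
  by apply: (continuous_integrableS cK clK muK) => //; exact: sy.
rewrite RintegralD; first by rewrite opprD addrACA.
- exact: borel_closed.
- by apply: (continuous_integrable cL clL nuL); exact: py.
- by apply: (continuous_integrable cL clL nuL); exact: py.
Qed.

Let defect_small e (x0 : X) (A : set X) : 0 < e -> K x0 -> measurable (A : set (borel X)) ->
  A `<=` K ->
  (forall x, A x -> forall y, L y -> `|F x y - F x0 y| <= e) ->
  `|defect A| <= 2 * e * fine (mu A).
Proof.
move=> e0 Kx0 mA AK hA; rewrite /defect.
(* Both iterated integrals are compared with those of F x0 y, which does not depend on x, so that
   the order is immaterial; each comparison costs e mu(A). *)
pose c := intY L (F x0).
have mL : measurable (L : set (borel Y)) by exact: borel_closed.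
have iA : mu.-integrable (A : set (borel X)) (EFin \o (fun x => intY L (F x))).
  exact: (continuous_integrableS cK clK muK).
have h1 : `|intX A (fun x => intY L (F x)) - intX A (fun=> c)| <= e * fine (mu A).
  apply: int_dist_le => //; first exact: finite_measure_integrable_cst.
  move=> x Ax; rewrite -[leRHS]mulr1 -[X in _ * X](_ : fine (nu L) = 1); last by rewrite nuL.
  apply: int_dist_le => //.
  - by apply: (continuous_integrable cL clL nuL); apply: sx; exact: AK.
  - by apply: (continuous_integrable cL clL nuL); exact: sx.
  - by move=> y Ly; exact: hA.
have h2 : `|intY L (fun y => intX A (G y)) - intY L (fun y => fine (mu A) * F x0 y)| <=
  e * fine (mu A).
  rewrite -[leRHS]mulr1 -[X in _ * X](_ : fine (nu L) = 1); last by rewrite nuL.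
  apply: int_dist_le => //.
  - by apply: (continuous_integrable cL clL nuL); exact: py.
  - apply: (continuous_integrable cL clL nuL) => y.
    by apply: cvgM; [exact: cvg_cst|exact: sx].
  - move=> y Ly; rewrite mulrC -Rintegral_cst //; apply: int_dist_le => //.
    + by apply: (continuous_integrableS cK clK muK) => //; exact: sy.
    + exact: finite_measure_integrable_cst.
    + by move=> x Ax; exact: hA.
have e1 : intX A (fun=> c) = intY L (fun y => fine (mu A) * F x0 y).
  rewrite Rintegral_cst // RintegralZl //; first by rewrite mulrC.
  by apply: (continuous_integrable cL clL nuL); exact: sx.
have -> : intX A (fun x => intY L (F x)) - intY L (fun y => intX A (G y)) =
  (intX A (fun x => intY L (F x)) - intX A (fun=> c)) - (intY L (fun y => intX A (G y)) - intY L
    (fun y => fine (mu A) * F x0 y)).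
  by rewrite e1; ring.
apply: le_trans (ler_normB _ _) _; lra.
Qed.

(* The product of the Borel sigma-algebras need not contain the open sets of
   X * Y, so the library's Fubini theorem does not apply.  Instead K is cut
   into finitely many Borel pieces on which F x y varies little with x. *)
Lemma compact_fubini : intX K (fun x => intY L (F x)) = intY L (fun y => intX K (fun x => F x y)).
Proof.
apply/eqP; rewrite -subr_eq0 -normr_le0; apply/ler_addgt0Pr => e e0; rewrite add0r.
pose d := e / 2; have d0 : 0 < d by rewrite divr_gt0.
pose N x0 := [set x | K x -> forall y, L y -> `|F x y - F x0 y| < d]°.
have mK : measurable (K : set (borel X)) by exact: borel_closed.
have := cK; rewrite compact_cover => /(_ X K N) [||D DK KD].
- by move=> x _; exact: open_interior.
- by move=> x Kx; exists x => //; exact: (tube cL Fc Kx d0).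
(* Induction over the centres of a finite subcover: the part of B inside the neighbourhood [N a] is
   split off. *)
have main (s : seq X) (B : set X) : (forall x, x \in s -> K x) ->
    measurable (B : set (borel X)) -> B `<=` K -> B `<=` (fun x => exists2 i, i \in s & N i x) ->
    `|defect B| <= 2 * d * fine (mu B).
  elim: s B => [|a s IH] B sK mB BK Bs.
    have -> : B = set0 by rewrite -subset0 => x /Bs[].
    rewrite /defect measure0 mulr0 Rintegral_set0.
    under eq_Rintegral do rewrite Rintegral_set0.
    by rewrite (int_cst clL nuL) subrr normr0.
  have mNa : measurable (N a : set (borel X)) by apply: borel_open; exact: open_interior.
  have dB : (B `&` N a) `&` (B `\` N a) = set0.
    by rewrite -subset0 => x [[_ ?] [_ ?]].
  have eB : B = (B `&` N a) `|` (B `\` N a) by rewrite setUIDK.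
  rewrite {1}eB defectU; first last.
  + exact: dB.
  + by move=> x [/BK].
  + by move=> x [/BK].
  + exact: measurableD.
  + exact: measurableI.
  have -> : fine (mu B) = fine (mu (B `&` N a)) + fine (mu (B `\` N a)).
    have fin A : measurable (A : set (borel X)) -> mu A \is a fin_num.
      by move=> mA; exact: fin_num_measure.
    by rewrite {1}eB measureU ?fineD ?fin //; try exact: measurableI; exact: measurableD.
  rewrite mulrDr; apply: le_trans (ler_normD _ _) _; apply: lerD.
    apply: (@defect_small d a) => //; first by apply: sK; rewrite inE eqxx.
    + exact: measurableI.
    + by move=> x [/BK].
    + move=> x [Bx Nx] y Ly; apply: ltW.
      have := interior_subset Nx => /= h; apply: h => //; exact: BK.
  apply: IH.
  + by move=> x xs; apply: sK; rewrite inE xs orbT.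
  + exact: measurableD.
  + by move=> x [/BK].
  + move=> x [Bx nN]; case: (Bs x Bx) => i; rewrite inE => /orP[/eqP -> //|is_ Ni].
    by exists i.
rewrite -[leRHS](_ : 2 * d * fine (mu K) = e); last by rewrite muK mulr1 /d mulrC divfK.
apply: (main (finmap.enum_fset D)) => //.
- by move=> x /DK; rewrite inE.
Qed.

End Fubini.

(** * Haar measures of K_n and K *)

Section CompactGroupK.
Variables (R : realType) (F : base_field) (q n : nat).
Local Notation T := (scalars R F).

Lemma group_K_compact : compact (group_K R F q n).
Proof.
pose P := [set p : 'M[T]_(q + n) * 'M[T]_q | det_condition_K p.1 p.2].
have cP : closed P.
  rewrite /P /det_condition_K; case: F.
  - apply: closedI; apply: (@closed_comp _ _ (fun p => \det _ : R) [set y | y = 1]);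
    try exact: closed_eq.
    + move=> p _; apply: (@continuous_comp _ _ _ fst (fun A => \det A));
      [exact: cvg_fst|exact: (@det_continuous R Reals)].
    + move=> p _; apply: (@continuous_comp _ _ _ snd (fun A => \det A));
      [exact: cvg_snd|exact: (@det_continuous R Reals)].
  - apply: (@closed_comp _ _ (fun p : 'M[scalars R Complexes]_(q + n) * 'M[scalars R Complexes]_q
    => \det p.1 * \det p.2 : R[i]) [set y | y = 1]) => [p _|]; last first.
      by apply: accessible_closed_set1; apply: hausdorff_accessible; exact: norm_hausdorff.
    apply: (@cvgTM R Complexes _ (nbhs p)).
    + by apply: (@continuous_comp _ _ _ fst (fun A => \det A));
      [exact: cvg_fst|exact: (@det_continuous R Complexes)].
    + by apply: (@continuous_comp _ _ _ snd (fun A => \det A));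
      [exact: cvg_snd|exact: (@det_continuous R Complexes)].
  - exact: closedT.
have -> : group_K R F q n = (fun p => block_mx p.1 0 0 p.2) @` ((unitary R F (q + n) `*` unitary
  R F q) `&` P).
  apply/seteqP; split=> g.
    by move=> [A [D [uA uD AD ->]]]; exists (A, D).
  by move=> [[A D] [[/= uA uD] AD] <-]; exists A, D.
apply: continuous_compact.
  apply: continuous_subspaceT => p; apply: (@cvg_block_mx _ _ _ (nbhs p)); try exact: cvg_cst.
  - exact: cvg_fst.
  - exact: cvg_snd.
by apply: compact_closedI => //; apply: compact_setX; exact: unitary_compact.
Qed.

Lemma group_K_closed : closed (group_K R F q n).
Proof. by apply: compact_closed; [exact: mx_hausdorff|exact: group_K_compact]. Qed.

Lemma group_U_closed : closed (group_U R F q).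
Proof. by apply: compact_closed; [exact: mx_hausdorff|exact: group_U_compact]. Qed.

Lemma group_K_ct k : group_K R F q n k -> group_K R F q n (ct k).
Proof.
move=> [A [D [uA uD AD ->]]]; exists (ct A), (ct D); split; try exact: unitary_ct.
  move: A D AD {uA uD}; rewrite /det_condition_K; case: F => //= A D.
    have trE m (M : 'M[R]_m) : ct (M : 'M[scalars R Reals]_m) = M^T by apply/matrixP => i j;
      rewrite !mxE.
    by move=> [dA dD]; rewrite !trE; split; [rewrite -dA|rewrite -dD]; exact: (@det_tr R).
  move=> AD; rewrite /ct [X in X * _](@det_tr R[i]) [X in _ * X](@det_tr R[i]).
  rewrite [X in X * _](@det_map_mx R[i]) [X in _ * X](@det_map_mx R[i]).
  by rewrite -[LHS](@rmorphM _ _ (@conjc R)) AD; exact: (conjc1 R).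
by rewrite ct_block !raddf0.
Qed.

End CompactGroupK.

Section HaarPushforward.
Variables (R : realType) (F : base_field) (q : nat).
Local Notation T := (scalars R F).
Variables (nu : probability (borel 'M[T]_q) R).
Hypothesis hnu : normalized_haar (group_U R F q) nu.

Lemma haar_U_translation (u : 'M[T]_q -> R) y : {within group_U R F q, continuous u} ->
  group_U R F q y ->
  Rintegral nu (group_U R F q : set (borel 'M[T]_q)) (fun x => u (y *m x)) =
  Rintegral nu (group_U R F q : set (borel 'M[T]_q)) u.
Proof.
move=> cu Uy; have [nu1 inv] := hnu.
have yK : ct y *m y = 1%:M by have /unitaryE[] := unitary_group_U Uy.
apply: (int_translation (@group_U_compact R F q) (@group_U_closed R F q) nu1 cu (f := mulmx y)).
- move=> x; apply: (@cvg_mulmx _ _ _ (nbhs x)); [exact: cvg_cst|exact: cvg_id].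
- move=> x; split; last exact: group_UM.
  move=> /(group_UM (group_U_ct Uy)); rewrite mulmxA yK mul1mx //.
- by move=> A mA; exact: inv.
Qed.

(** Uniqueness of the Haar measure. The integral of [u (ct y *m p x)] over x and y is evaluated in
    both orders: invariance in x removes y, and left translation of y by the adjoint of p x removes
    p x. The adjoint on the right side stems from the use of left invariance alone. *)
Lemma haar_pushforward (X : ptopologicalType) (mu : probability (borel X) R) (K : set X)
    (p : X -> 'M[T]_q) (u : 'M[T]_q -> R) :
  compact K -> closed K -> mu K = 1%E -> continuous p ->
  (forall x, K x -> group_U R F q (p x)) ->
  {within group_U R F q, continuous u} ->
  (forall y, group_U R F q y ->
    Rintegral mu (K : set (borel X)) (fun x => u (y *m p x)) =
    Rintegral mu (K : set (borel X)) (fun x => u (p x))) ->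
  Rintegral mu (K : set (borel X)) (fun x => u (p x)) =
  Rintegral nu (group_U R F q : set (borel 'M[T]_q)) (fun x => u (ct x)).
Proof.
move=> cK clK muK cp pU cu inv; have [nu1 _] := hnu.
have cU := @group_U_compact R F q; have clU := @group_U_closed R F q.
have Fc : {within K `*` group_U R F q, continuous (fun z => u (ct z.2 *m p z.1))}.
  apply: (@comp_within_continuous _ _ _ (K `*` group_U R F q) (group_U R F q) (fun z => ct z.2 *m
    p z.1) _ _ _ cu).
    by move=> [x y] [/= Kx Uy]; apply: group_UM; [exact: group_U_ct|exact: pU].
  apply: continuous_subspaceT => z; apply: (@cvg_mulmx _ _ _ (nbhs z)).
    by apply: (@cvg_ct _ _ _ (nbhs z)); exact: cvg_snd.
  by apply: (@continuous_comp _ _ _ fst p); [exact: cvg_fst|exact: cp].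
have := compact_fubini cK clK muK cU clU nu1 (F := fun x y => u (ct y *m p x)) Fc.
have -> : Rintegral nu (group_U R F q : set (borel 'M[T]_q)) (fun y => Rintegral mu (K : set
  (borel X)) (fun x => u (ct y *m p x))) = Rintegral mu (K : set (borel X)) (fun x => u (p x)).
  rewrite -[RHS](int_cst clU nu1); apply: eq_Rintegral => y; rewrite inE => Uy.
  by apply: inv; exact: group_U_ct.
move=> <-; rewrite -[RHS](int_cst clK muK); apply: eq_Rintegral => x; rewrite inE => Kx.
have cuct : {within group_U R F q, continuous (fun z => u (ct z))}.
  apply: (@comp_within_continuous _ _ _ (group_U R F q) (group_U R F q) (@ct R F q q) _ _ _ cu).
    by move=> y; exact: group_U_ct.
  by apply: continuous_subspaceT => z; apply: (@cvg_ct _ _ _ (nbhs z)); exact: cvg_id.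
rewrite -(haar_U_translation cuct (group_U_ct (pU x Kx))).
by apply: eq_Rintegral => y _; rewrite ctM ctK.
Qed.

Variables (n : nat) (mu : probability (borel 'M[T]_(q + n + q)) R).
Hypotheses (qn0 : (0 < q + n)%N) (hmu : normalized_haar (group_K R F q n) mu).

Lemma haar_K_translation (u : 'M[T]_(q + n + q) -> R) y : {within group_K R F q n, continuous u} ->
  group_K R F q n y ->
  Rintegral mu (group_K R F q n : set (borel 'M[T]_(q + n + q))) (fun x => u (y *m x)) =
  Rintegral mu (group_K R F q n : set (borel 'M[T]_(q + n + q))) u.
Proof.
move=> cu Uy; have [nu1 inv] := hmu.
have yK : ct y *m y = 1%:M by have /unitaryE[] := group_K_unitary Uy.
apply: (int_translation (@group_K_compact R F q n) (@group_K_closed R F q n) nu1 cu (f := mulmx y)).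
- move=> x; apply: (@cvg_mulmx _ _ _ (nbhs x)); [exact: cvg_cst|exact: cvg_id].
- move=> x; split; last exact: group_KM.
  move=> /(group_KM (group_K_ct Uy)); rewrite mulmxA yK mul1mx //.
- by move=> A mA; exact: inv.
Qed.

Lemma haar_K_lower (u : 'M[T]_q -> R) : {within group_U R F q, continuous u} ->
  Rintegral mu (group_K R F q n : set (borel 'M[T]_(q + n + q))) (fun x => u (drsubmx x)) =
  Rintegral nu (group_U R F q : set (borel 'M[T]_q)) u.
Proof.
move=> cu; have [nu1 _] := hnu; have [mu1 _] := hmu.
have cU := @group_U_compact R F q; have clU := @group_U_closed R F q.
have cK := @group_K_compact R F q n; have clK := @group_K_closed R F q n.
(* [haar_pushforward] is applied to the lower block on K_n and then to the identity map on K; both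
   give the same integral with adjoint. *)
rewrite (haar_pushforward cK clK mu1 (@drsubmx_continuous R F _ _ _ _) (@group_K_lower_U R F q n)
  cu).
  symmetry; apply: (haar_pushforward (p := id) cU clU nu1 _ _ cu) => //.
  - by move=> x; exact: cvg_id.
  - by move=> y Uy; exact: haar_U_translation.
move=> y Uy; have [A uA KA] := group_K_lift qn0 Uy.
have cud : {within group_K R F q n, continuous (fun x => u (drsubmx x))}.
  apply: (@comp_within_continuous _ _ _ (group_K R F q n) (group_U R F q) drsubmx _ _ _ cu).
    by move=> k; exact: group_K_lower_U.
  by apply: continuous_subspaceT; exact: drsubmx_continuous.
rewrite -(haar_K_translation cud KA); apply: eq_Rintegral => x _.
by rewrite -{2}[x]submxK mulmx_block block_mxKdr mul0mx add0r.
Qed.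

End HaarPushforward.

(** * The second moment of a matrix entry *)

Section SecondMoment.
Variables (R : realType) (F : base_field) (q n : nat).
Local Notation T := (scalars R F).
Variables (mu : probability (borel 'M[T]_(q + n + q)) R).
Hypotheses (q0 : (0 < q)%N) (n0 : (0 < n)%N) (hmu : normalized_haar (group_K R F q n) mu).

Local Notation int u := (Rintegral mu (group_K R F q n : set (borel 'M[T]_(q + n + q))) u).

Lemma entry_continuous i j : continuous (fun k : 'M[T]_(q + n + q) => nsq (k i j)).
Proof.
move=> k; apply: (@cvg_nsq _ _ _ (nbhs k)); apply: (@cvg_mx_entry _ _ _ (nbhs k)).
exact: cvg_id.
Qed.

(* Left translation by a matrix of determinant 1 exchanging two basis vectors. *)
Lemma second_moment_row (i i' : 'I_(q + n)) j :
  int (fun k => nsq (k (lshift q i) j)) = int (fun k => nsq (k (lshift q i') j)).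
Proof.
have e1 (l : 'I_(q + n)) : row l (1%:M : 'M[T]_(q + n)) *m ct (row l 1%:M) = 1%:M.
  by rewrite mul_ct_rV fro_row1 rmorph1.
have [||U [_ uU CU]] := @witt R F 1 (q + n) (fun=> True) (row i 1%:M) (row i' 1%:M) I.
- by [].
- by rewrite !e1.
have [z z1 dU] := det_is_unitary uU.
have zz : z * conj_scalar z = 1 by rewrite mul_conj z1 rmorph1.
(* A second factor that fixes row i' brings the determinant to 1; there is room for it because 1 < q
   + n. *)
have [||U' [uU' dU' CU']] := @det_correction R F 1 (q + n) (row i' 1%:M) (conj_scalar z).
- by lia.
- by rewrite nsq_conj.
have Kk : group_K R F q n (block_mx (U *m U') 0 0 1%:M).
  by apply: group_K_ul; [exact: unitaryM|rewrite -zz; exact: det_isM].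
rewrite -(haar_K_translation hmu _ Kk); last by apply: continuous_subspaceT;
  exact: entry_continuous.
apply: eq_Rintegral => k _; congr nsq.
rewrite -{1}[k]vsubmxK -[in RHS](vsubmxK k) mul_block_col !mul0mx addr0 !col_mxEu.
suff : row i (U *m U' *m usubmx k) = row i' (usubmx k).
  by move=> /matrixP /(_ 0 j); rewrite !mxE.
by rewrite !row_mul rowE -[delta_mx 0 i]mulmx1 -rowE CU CU' -row_mul mul1mx.
Qed.

(** In a column of the unitary upper block the q + n values of [nsq] add up to 1, and their means
    are equal by [second_moment_row]. *)
Lemma second_moment (i j : 'I_(q + n)) :
  int (fun k => nsq (k (lshift q i) (lshift q j))) = (q + n)%:R^-1.
Proof.
have [mu1 _] := hmu.
have cK := @group_K_compact R F q n; have clK := @group_K_closed R F q n.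
have qn : ((q + n)%:R : R) != 0 by rewrite pnatr_eq0; lia.
apply: (mulfI qn); rewrite mulfV // mulr_natl -[X in _ *+ X]card_ord -sumr_const.
rewrite (eq_bigr (fun l : 'I_(q + n) => int (fun k => nsq (k (lshift q l) (lshift q j)))));
  last first.
  by move=> l _; exact: second_moment_row.
rewrite -(int_sum cK clK mu1); last by move=> l; apply: continuous_subspaceT;
  exact: entry_continuous.
rewrite -[RHS](int_cst clK mu1); apply: eq_Rintegral => k; rewrite inE => -[A [D [uA uD _ ->]]].
have /unitaryE[A1 _] := uA; apply: (@rs_inj R F); rewrite rmorph1 raddf_sum.
transitivity ((1%:M : 'M[T]_(q + n)) j j); last by rewrite mxE eqxx.
rewrite -A1 mxE; apply: eq_bigr => l _.
by rewrite block_mxEul ctE conj_mul.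
Qed.

End SecondMoment.

(** * Convergence of the integrals over K_n *)

Section UniformEstimate.
Variables (R : realType) (F : base_field) (m n : nat).
Local Notation T := (scalars R F).

Lemma nbhs_fro_ball (A : 'M[T]_(m, n)) (U : set 'M[T]_(m, n)) : nbhs A U ->
  exists2 r : R, 0 < r & forall B, fro (B - A) < r -> U B.
Proof.
pose ball (r : R) := [set B : 'M[T]_(m, n) | fro (B - A) < r].
pose G := filter_from [set r : R | 0 < r] ball.
have FG : Filter G.
  apply: filter_from_filter; first by exists 1; rewrite /= ltr01.
  move=> r s /= r0 s0; exists (Num.min r s); first by rewrite /= lt_min r0.
  by move=> B; rewrite /ball /= lt_min => /andP[].
have : B @[B --> G] --> A.
  apply/(@cvg_mxP _ _ _ G) => i j; apply/(@cvg_nsqP _ _ _ G); apply/cvgrPdist_lt => e e0.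
  exists e => // B Be; rewrite /= sub0r normrN ger0_norm ?nsq_ge0 //.
  by apply: le_lt_trans Be; have := nsq_le_fro (B - A) i j; rewrite !mxE.
by move=> cA UA; have [r r0 rU] := cA U UA; exists r.
Qed.

(** Heine's theorem on uniform continuity, in terms of [fro]. *)
Lemma compact_unif_dist (Q : set 'M[T]_(m, n)) (u : 'M[T]_(m, n) -> R) e :
  compact Q -> {within Q, continuous u} -> 0 < e ->
  exists2 r, 0 < r & forall A B, Q A -> Q B -> fro (B - A) < r -> `|u A - u B| < e.
Proof.
move=> cQ cu e0; have /compact_near_coveringP := cQ.
move=> /(_ R (0 : R)^'+ (fun r A => Q A -> forall B, Q B -> fro (B - A) < r ->
  `|u A - u B| < e) _) h.
have : \forall r \near (0 : R)^'+, Q `<=` (fun A => Q A -> forall B, Q B -> fro (B - A) < r ->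
  `|u A - u B| < e).
  apply: h => A0 QA0.
  have /within_continuousP /(_ A0 QA0) /cvgrPdist_lt /(_ (e / 2)) := cu.
  rewrite divr_gt0 // => /(_ isT) hn.
  have [r r0 rU] := nbhs_fro_ball hn.
  (* With squared distances below r / 4 from A0 to A and from A to B, [froD_le] keeps B within r of
     A0. *)
  exists ([set A | fro (A - A0) < r / 4], [set s | s < r / 4]); first split => /=.
  - apply: (@open_nbhs_nbhs _ A0); split; last by rewrite /= subrr fro0 divr_gt0.
    apply: (@open_comp _ _ (fun A : 'M[T]_(m, n) => fro (A - A0)) [set y : R | y < r / 4]);
      last exact: open_lt.
    move=> A _; apply: (@cvg_fro _ _ _ (nbhs A)); apply: (@cvg_addmx _ _ _ (nbhs A));
      [exact: cvg_id|exact: cvg_cst].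
  - by apply: nbhs_right_lt; rewrite divr_gt0.
  move=> [A s] [/= As s4] QA B QB Bs.
  have h1 := rU A _ QA; have h2 := rU B _ QB.
  have h1' : `|u A0 - u A| < e / 2 by apply: h1; apply: lt_trans As _; lra.
  have h2' : `|u A0 - u B| < e / 2.
    apply: h2; have -> : B - A0 = (B - A) + (A - A0) by rewrite addrA subrK.
    by apply: le_lt_trans (froD_le _ _) _; lra.
  have -> : u A - u B = (u A0 - u B) - (u A0 - u A) by ring.
  by rewrite [e]splitr; apply: le_lt_trans (ler_normB _ _) _; exact: ltrD.
move=> hr; have : \forall r \near (0 : R)^'+, 0 < r by exact: nbhs_right_gt.
move=> /(filterI hr) /filter_ex [r [rQ r0]]; exists r => // A B QA QB; exact: rQ.
Qed.

(** Near points fall under uniform continuity; for distant ones the difference, at most 2 M, is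
    bounded by 2 M / r times [fro]. A bound linear in [fro] can be integrated by means of the second
    moments. *)
Lemma compact_unif_estimate (Q : set 'M[T]_(m, n)) (u : 'M[T]_(m, n) -> R) e :
  compact Q -> {within Q, continuous u} -> 0 < e ->
  exists2 c, 0 <= c & forall A B, Q A -> Q B -> `|u A - u B| <= e + c * fro (A - B).
Proof.
move=> cQ cu e0; have [r r0 rQ] := compact_unif_dist cQ cu e0.
have /compact_bounded[M0 [_ mrt]] := continuous_compact cu cQ.
pose M := `|M0| + 1.
have uM A : Q A -> `|u A| <= M.
  by move=> QA; apply: (mrt M); [rewrite /M; apply: le_lt_trans (ler_norm _) _;
    rewrite ltrDl|exists A].
have M_0 : 0 <= M by rewrite addr_ge0.
exists (2 * M / r); first by rewrite divr_ge0 ?mulr_ge0 // ltW.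
move=> A B QA QB; have [ABr|rAB] := ltP (fro (B - A)) r.
  apply: le_trans (ltW (rQ A B QA QB ABr)) _; rewrite lerDl mulr_ge0 ?fro_ge0 //.
  by rewrite divr_ge0 ?mulr_ge0 // ltW.
have h : `|u A - u B| <= 2 * M.
  by apply: le_trans (ler_normB _ _) _; have := uM A QA; have := uM B QB; lra.
apply: le_trans h _; rewrite -opprB froN.
have : 2 * M <= 2 * M / r * fro (B - A).
  by rewrite -mulrA ler_peMr ?mulr_ge0 // mulrC ler_pdivlMr // mul1r.
lra.
Qed.

End UniformEstimate.

Section LowerProduct.
Variables (R : realType) (F : base_field) (q m d : nat).
Local Notation T := (scalars R F).

Definition narrow (a : 'I_(q + m)) : 'I_(q + (m + d)) :=
  widen_ord (eq_leq (esym (addnA q m d)) : (q + m + d <= q + (m + d))%N) (lshift d a).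

Lemma enlarge_index_narrow a : enlarge_index (lshift q (narrow a)) = lshift d (lshift q a).
Proof.
rewrite /enlarge_index (unsplitK (inl _)).
have -> : cast_ord (addnA q m d) (narrow a) = lshift d a by exact: val_inj.
by rewrite (unsplitK (inl _)).
Qed.

Lemma enlarge_index_last k : @enlarge_index q m d (rshift (q + (m + d)) k) =
  lshift d (rshift (q + m) k).
Proof. by rewrite /enlarge_index (unsplitK (inr _)). Qed.

Lemma enlarge_index_out (b : 'I_(q + (m + d))) :
  (exists a, b = narrow a) \/ exists z, enlarge_index (lshift q b) = rshift (q + m + q) z.
Proof.
rewrite /enlarge_index (unsplitK (inl _)).
case: (split_ordP (cast_ord (addnA q m d) b)) => y e.
  by left; exists y; apply: val_inj; exact: (congr1 val e).
by right; exists y.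
Qed.

Let enlargeE (g : 'M[T]_(q + m + q)) a b :
  enlarge d g a b = block_mx g 0 0 1%:M (enlarge_index a) (enlarge_index b).
Proof. by rewrite mxE. Qed.

Let drE n (M : 'M[T]_(n + q)) i j : drsubmx M i j = M (rshift n i) (rshift n j).
Proof. by rewrite !mxE. Qed.

Let dlE n (M : 'M[T]_(n + q)) i j : dlsubmx M i j = M (rshift n i) (lshift q j).
Proof. by rewrite !mxE. Qed.

Let urE n (M : 'M[T]_(n + q)) i j : ursubmx M i j = M (lshift q i) (rshift n j).
Proof. by rewrite !mxE. Qed.

Lemma enlarge_dr (g : 'M[T]_(q + m + q)) : drsubmx (enlarge d g) = drsubmx g.
Proof. by apply/matrixP => i j; rewrite !drE enlargeE !enlarge_index_last block_mxEul. Qed.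

(** The matrix of the inclusion [narrow]: enlarging g replaces its block C by C P and its block B by
    P^T B, that is, pads them with zeros. *)
Let P : 'M[T]_(q + m, q + (m + d)) := \matrix_(a, b) (b == narrow a)%:R.

Let narrow_inj : injective narrow.
Proof. by move=> a b /(congr1 val) /= ab; exact: val_inj. Qed.

Let enlarge_dl (g : 'M[T]_(q + m + q)) : dlsubmx (enlarge d g) = dlsubmx g *m P.
Proof.
apply/matrixP => i b; rewrite dlE enlargeE enlarge_index_last [RHS]mxE.
case: (enlarge_index_out b) => [[a ->]|[z bz]].
  rewrite enlarge_index_narrow block_mxEul (bigD1 a) //= dlE mxE eqxx mulr1 big1 ?addr0 //
    => a' aa'.
  by rewrite !mxE (inj_eq narrow_inj) eq_sym (negbTE aa') mulr0.
rewrite bz block_mxEur mxE big1 // => a' _; rewrite !mxE.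
case: eqP => [ba|_]; last by rewrite mulr0.
by move: bz; rewrite ba enlarge_index_narrow => /(congr1 val) /=; have := ltn_ord a'; lia.
Qed.

Let enlarge_ur (g : 'M[T]_(q + m + q)) : ursubmx (enlarge d g) = P^T *m ursubmx g.
Proof.
apply/matrixP => b i; rewrite urE enlargeE enlarge_index_last [RHS]mxE.
case: (enlarge_index_out b) => [[a ->]|[z bz]].
  rewrite enlarge_index_narrow block_mxEul (bigD1 a) //= urE !mxE eqxx mul1r big1 ?addr0 //
    => a' aa'.
  by rewrite !mxE (inj_eq narrow_inj) eq_sym (negbTE aa') mul0r.
rewrite bz block_mxEdl mxE big1 // => a' _; rewrite !mxE.
case: eqP => [ba|_]; last by rewrite mul0r.
by move: bz; rewrite ba enlarge_index_narrow => /(congr1 val) /=; have := ltn_ord a'; lia.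
Qed.

(** The padded blocks C and B meet only the first q + m rows and columns of the upper block of k. *)
Lemma lower_product (g h : 'M[T]_(q + m + q)) k : group_K R F q (m + d) k ->
  drsubmx (enlarge d g *m k *m enlarge d h) =
  dlsubmx g *m mxsub narrow narrow (ulsubmx k) *m ursubmx h + drsubmx g *m drsubmx k *m drsubmx h.
Proof.
move=> [A [V [_ _ _ ->]]]; rewrite block_mxKul block_mxKdr.
have -> : mxsub narrow narrow A = P *m A *m P^T.
  apply/matrixP => a b; rewrite !mxE (bigD1 (narrow b)) //=
    !mxE eqxx mulr1 (bigD1 (narrow a)) //= !mxE eqxx mul1r.
  rewrite [X in _ + X]big1 ?addr0 => [|j jb]; last first.
    by rewrite [X in _ * X](_ : _ = 0) ?mulr0 // !mxE (negbTE jb).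
  by rewrite big1 ?addr0 // => j ja; rewrite !mxE (negbTE ja) mul0r.
rewrite -{1}[enlarge d g]submxK -{1}[enlarge d h]submxK !mulmx_block !(mulmx0, addr0, add0r).
by rewrite block_mxKdr !enlarge_dr enlarge_dl enlarge_ur !mulmxA.
Qed.

End LowerProduct.

Section HaarLimit.
Variables (R : realType) (F : base_field) (q : nat) (q0 : (0 < q)%N).
Local Notation T := (scalars R F).
Local Notation lower := (@lower R F q).
Variable mu : forall n, probability (borel 'M[T]_(q + n + q)) R.
Hypothesis hmu : forall n, (0 < n)%N -> normalized_haar (group_K R F q n) (mu n).
Variables (nu : probability (borel 'M[T]_q) R).
Hypothesis hnu : normalized_haar (group_U R F q) nu.
Variable u : 'M[T]_q -> R.
Hypothesis cu : {within @expanding R F q, continuous u}.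

Local Notation intK n v := (Rintegral (mu n) (group_K R F q n : set (borel 'M[T]_(q + n + q))) v).
Local Notation intU v := (Rintegral nu (group_U R F q : set (borel 'M[T]_q)) v).

Lemma nsq_unitary_le1 N (U : 'M[T]_N) i j : unitary R F N U -> nsq (U i j) <= 1.
Proof.
move=> /unitaryE[_ UU]; have := nsq_le_fro (row i U) 0 j.
by rewrite mxE -{2}[U]mul1mx row_mul fro_unitr // fro_row1.
Qed.

Lemma expanding_product E E' V : expanding E -> expanding E' -> group_U R F q V ->
  expanding (E *m V *m E').
Proof.
move=> xE xE' UV; rewrite -mulmxA; apply: expandingM => //.
by rewrite -[V *m E']mulmx1; apply: unitary_expanding => //; exact: group_U1.
Qed.

Lemma product_continuous E E' : expanding E -> expanding E' ->
  {within group_U R F q, continuous (fun V => u (E *m V *m E'))}.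
Proof.
move=> xE xE'; apply: (@comp_within_continuous _ _ _ (group_U R F q) (@expanding R F q) (fun V =>
  E *m V *m E') u) => //.
  by move=> V; exact: expanding_product.
apply: continuous_subspaceT => V; apply: (@cvg_mulmx _ _ _ (nbhs V)); last exact: cvg_cst.
by apply: (@cvg_mulmx _ _ _ (nbhs V)); [exact: cvg_cst|exact: cvg_id].
Qed.

Section Bound.
Variables (m : nat) (m0 : (0 < m)%N) (g h : 'M[T]_(q + m + q)).
Hypotheses (Gg : group_G R F q m g) (Gh : group_G R F q m h).

(** What matters is that [C] is independent of d. The integral over K becomes one over K_(m + d) of
    a function of the lower block; the two integrands then differ by at most e plus a constant times
    [w k], a sum of (q + m)^2 values of [nsq], each of mean 1 / (q + m + d). *)
Lemma haar_bound e : 0 < e -> exists C, forall d,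
  `|intK (m + d)%N (fun k => u (drsubmx (enlarge d g *m k *m enlarge d h))) -
    intU (fun V => u (drsubmx g *m V *m drsubmx h))| <= e + C * (q + (m + d))%:R^-1.
Proof.
move=> e0.
have xE : expanding (drsubmx g) by rewrite -lower_embed; apply: Ginf_expanding; exact: Ginf_embed.
have xE' : expanding (drsubmx h) by rewrite -lower_embed; apply: Ginf_expanding; exact: Ginf_embed.
(* From two applications of [froM_le] with inner dimension q + m. *)
pose c1 := 2 ^+ (q + m) * ((2 ^+ (q + m) * fro (dlsubmx g)) * fro (ursubmx h)) : R.
have c1_0 : 0 <= c1 by rewrite !mulr_ge0 ?exprn_ge0 ?fro_ge0.
have froN (W : 'M[T]_(q + m)) : fro (dlsubmx g *m W *m ursubmx h) <= c1 * fro W.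
  apply: le_trans (froM_le _ _) _.
  rewrite (_ : c1 * fro W = 2 ^+ (q + m) * (2 ^+ (q + m) * (fro (dlsubmx g) * fro W) * fro
    (ursubmx h))); last by rewrite /c1; ring.
  by rewrite ler_wpM2l ?exprn_ge0 // ler_wpM2r ?fro_ge0 // froM_le.
(* Bounds [fro] of both arguments of u: the corner of k has (q + m)^2 entries with [nsq] at most 1,
   [fro] of the lower block of k is q, and the factor 2 is that of [froD_le]. By [expanding_cartan]
   both arguments then lie in the compact set Q. *)
pose M := 2 * (c1 * ((q + m) * (q + m))%:R + 2 ^+ q * ((2 ^+ q * (fro (drsubmx g) * q%:R)) * fro
  (drsubmx h))).
pose Q := @cartan R F q @` @cartan_box R F q (2 * M).
have cQ : compact Q by apply: continuous_compact; [apply: continuous_subspaceT;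
  exact: cartan_continuous|exact: cartan_box_compact].
have cuQ : {within Q, continuous u} by apply: continuous_subspaceW cu; exact: cartan_expanding.
have [c c0 hc] := compact_unif_estimate cQ cuQ e0.
exists (c * c1 * ((q + m) * (q + m))%:R) => d.
have [n0 md0] : (0 < m + d)%N /\ (0 < q + (m + d))%N by lia.
have hK := hmu n0; have [mu1 _] := hK.
have cK := @group_K_compact R F q (m + d); have clK := @group_K_closed R F q (m + d).
pose E := drsubmx g; pose E' := drsubmx h.
have cuV : {within group_U R F q, continuous (fun V => u (E *m V *m E'))} by exact:
  product_continuous.
rewrite -(haar_K_lower hnu _ hK cuV); last by lia.
pose w (k : 'M[T]_(q + (m + d) + q)) := \sum_(p : 'I_(q + m) * 'I_(q + m)) nsq (k (lshift q
  (narrow d p.1)) (lshift q (narrow d p.2))).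
have wE k : w k = fro (mxsub (@narrow q m d) (@narrow q m d) (ulsubmx k)).
  rewrite /w /fro pair_big /=; apply: eq_bigr => -[a b] _ /=; congr nsq.
  by rewrite !mxE.
have cw : continuous w.
  rewrite (_ : w = fun k => fro (mxsub (@narrow q m d) (@narrow q m d) (ulsubmx k)));
    last exact/funext.
  move=> k; apply: (@cvg_fro _ _ _ (nbhs k)).
  apply/(@cvg_mxP _ _ _ (nbhs k)) => a b; rewrite !mxE; under eq_fun do rewrite !mxE.
  by apply: (@cvg_mx_entry _ _ _ (nbhs k)); exact: cvg_id.
have cw1 : continuous (fun k => c1 * w k) by move=> k; exact: (@cvgM R _ (nbhs k) _ (fun=> c1) w
  c1 (w k) (cvg_cst _) (cw k)).
have cw2 : continuous (fun k => c * (c1 * w k)) by move=> k;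
  exact: (@cvgM R _ (nbhs k) _ (fun=> c) _ c _ (cvg_cst _) (cw1 k)).
have cw3 : continuous (fun k => e + c * (c1 * w k)) by move=> k;
  exact: (@cvgD R R _ (nbhs k) _ (fun=> e) _ e _ (cvg_cst _) (cw2 k)).
pose X k := drsubmx (enlarge d g *m k *m enlarge d h).
have XK k : group_K R F q (m + d) k -> expanding (X k).
  move=> Kk; rewrite /X -lower_embed; apply: Ginf_expanding; apply: Ginf_embed => //.
  by apply: group_GM; [apply: group_GM; [exact: enlarge_G|exact: group_K_G]|exact: enlarge_G].
have cX : continuous X.
  move=> k; apply: (@continuous_comp _ _ _ (fun k => enlarge d g *m k *m enlarge d h));
    last exact: drsubmx_continuous.
  apply: (@cvg_mulmx _ _ _ (nbhs k)); last exact: cvg_cst.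
  by apply: (@cvg_mulmx _ _ _ (nbhs k)); [exact: cvg_cst|exact: cvg_id].
have iw : intK (m + d)%N (fun k => e + c * (c1 * w k)) =
  e + c * c1 * ((q + m) * (q + m))%:R * (q + (m + d))%:R^-1.
  rewrite RintegralD; first rewrite int_cst //.
  - rewrite RintegralZl; first rewrite RintegralZl; first rewrite /w (int_sum cK clK mu1).
    + under eq_bigr do rewrite (second_moment q0 n0 hK).
      by rewrite sumr_const card_prod card_ord -[_ *+ _]mulr_natl !mulrA.
    + by move=> p; apply: continuous_subspaceT; exact: entry_continuous.
    + exact: borel_closed.
    + by apply: (continuous_integrable cK clK mu1); exact: continuous_subspaceT.
    + exact: borel_closed.
    + by apply: (continuous_integrable cK clK mu1); exact: continuous_subspaceT.
  - exact: borel_closed.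
  - by apply: finite_measure_integrable_cst; exact: borel_closed.
  - by apply: (continuous_integrable cK clK mu1); exact: continuous_subspaceT.
rewrite -iw; apply: int_distW.
- exact: borel_closed.
- apply: (continuous_integrable cK clK mu1).
  apply: (@comp_within_continuous _ _ _ (group_K R F q (m + d)) (@expanding R F q) X u) => //.
  exact: continuous_subspaceT.
- apply: (continuous_integrable cK clK mu1).
  apply: (@comp_within_continuous _ _ _ (group_K R F q (m + d)) (group_U R F q) drsubmx (fun V =>
    u (E *m V *m E'))) => //.
    by move=> k; exact: group_K_lower_U.
  by apply: continuous_subspaceT; exact: drsubmx_continuous.
- by apply: (continuous_integrable cK clK mu1); exact: continuous_subspaceT.
move=> k Kk; have UV := group_K_lower_U Kk.
have wle : w k <= ((q + m) * (q + m))%:R.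
  rewrite [leRHS](_ : _ = \sum_(p : 'I_(q + m) * 'I_(q + m)) 1).
    by apply: ler_sum => p _; apply: nsq_unitary_le1; exact: group_K_unitary.
  by rewrite sumr_const card_prod card_ord.
have N1 := froN (mxsub (@narrow q m d) (@narrow q m d) (ulsubmx k)).
have XE := lower_product g h Kk.
have xY := expanding_product xE xE' UV.
set N := dlsubmx g *m _ *m ursubmx h in N1 XE.
have inQ Y : expanding Y -> fro Y <= M -> Q Y.
  by move=> xYY YM; apply: cartan_box_le (expanding_cartan xYY); rewrite ler_pM2l.
have froY : fro (E *m drsubmx k *m E') <= 2 ^+ q * ((2 ^+ q * (fro E * q%:R)) * fro E').
  apply: le_trans (froM_le _ _) _; rewrite ler_wpM2l ?exprn_ge0 // ler_wpM2r ?fro_ge0 //.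
  by apply: le_trans (froM_le _ _) _; rewrite (fro_unitary (unitary_group_U UV)).
have froNM : fro N <= c1 * ((q + m) * (q + m))%:R.
  by apply: le_trans N1 _; rewrite -wE ler_wpM2l.
apply: le_trans (hc (X k) (E *m drsubmx k *m E') _ _) _.
- apply: inQ; first exact: XK.
  by rewrite /X XE; apply: le_trans (froD_le _ _) _; rewrite ler_pM2l // lerD.
- apply: inQ => //; apply: le_trans froY _; rewrite /M mulrDr.
  set b := 2 ^+ q * _; set a := c1 * _.
  have a_0 : 0 <= a by rewrite mulr_ge0.
  have b_0 : 0 <= b by rewrite !mulr_ge0 ?exprn_ge0 ?fro_ge0.
  lra.
rewrite lerD2l ler_wpM2l // /X XE addrK wE; exact: N1.
Qed.

End Bound.

Lemma haar_limit g h : Ginf R F q g -> Ginf R F q h ->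
  (fun n => intK n (fun k => u (lower (infmul (infmul g (embed k)) h)))) @ \oo -->
  intU (fun V => u (lower g *m V *m lower h)).
Proof.
move=> Gg Gh; have [m [m0 /(_ 0%N) [g' [h' []]]]] := Ginf_common Gg Gh.
move: g' h'; rewrite addn0 => g' h' Gg' Gh' -> ->; rewrite !lower_embed.
(* One half of e goes to uniform continuity, the other to C / (q + n) for large n. *)
apply/cvgrPdist_le => e e0; have e2 : 0 < e / 2 by rewrite divr_gt0.
have [C hC] := haar_bound m0 Gg' Gh' e2.
have {}hC d : `|intK (m + d)%N (fun k => u (lower (infmul (infmul (embed g') (embed k)) (embed
  h')))) -
    intU (fun V => u (drsubmx g' *m V *m drsubmx h'))| <= e / 2 + C * (q + (m + d))%:R^-1.
  rewrite -(embed_enlarge d g') -(embed_enlarge d h').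
  by under eq_Rintegral do rewrite !infmul_embed lower_embed.
near=> n; have mn : (m <= n)%N by near: n; exact: nbhs_infty_ge.
rewrite distrC; have := hC (n - m)%N; rewrite subnKC // => /le_trans; apply.
rewrite [leRHS]splitr lerD2l ler_pdivrMr; last by rewrite ltr0n; lia.
apply: le_trans (ler_norm C) _.
have : `|C| / (e / 2) <= n%:R by near: n; exact: nbhs_infty_ger.
rewrite ler_pdivrMr // => /le_trans; apply.
by rewrite mulrC ler_pM2l // ler_nat leq_addl.
Unshelve. all: by end_near.
Qed.

End HaarLimit.

(** * Complex-valued integrals *)

Section ComplexIntegral.
Variable R : realType.

Lemma cvg_complexP {X : Type} (G : set_system X) {FG : Filter G} (f : X -> R[i]) (l : R[i]) :
  f x @[x --> G] --> l <->
  complex.Re (f x) @[x --> G] --> complex.Re l /\ complex.Im (f x) @[x --> G] --> complex.Im l.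
Proof.
have E (z w : R[i]) : @nsq R Complexes (z - w) = (complex.Re z - complex.Re w) ^+ 2 + (complex.Im
  z - complex.Im w) ^+ 2.
  by case: z w => [a b] [c d].
have S (p : X -> R) (a : R) : (p x - a) ^+ 2 @[x --> G] --> (0 : R) -> p x @[x --> G] --> a.
  by move=> h; apply/(@cvg_nsqP R Reals).
split=> [/(@cvg_nsqP R Complexes) h|[hr hi]].
  by split; apply: S; apply: (@squeeze0 _ _ G FG _ _ _ h) => x; rewrite E sqr_ge0 /=
    ?lerDl ?lerDr sqr_ge0.
apply/(@cvg_nsqP R Complexes); under eq_fun do rewrite E.
have hr' : (complex.Re (f x) - complex.Re l) ^+ 2 @[x --> G] --> (0 : R) :=
  iffLR (@cvg_nsqP R Reals X G FG _ _) hr.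
have hi' : (complex.Im (f x) - complex.Im l) ^+ 2 @[x --> G] --> (0 : R) :=
  iffLR (@cvg_nsqP R Reals X G FG _ _) hi.
have h : (complex.Re (f x) - complex.Re l) ^+ 2 + (complex.Im (f x) - complex.Im l) ^+ 2 @[x -->
  G] --> (0 : R).
  by rewrite -[X in _ --> X]addr0; exact: (@cvgD R R X G FG _ _ _ _ hr' hi').
exact: h.
Qed.

Lemma Re_within_continuous (X : topologicalType) (A : set X) (f : X -> R[i]) :
  {within A, continuous f} -> {within A, continuous (fun x => complex.Re (f x))}.
Proof. by move=> cf x; have /(@cvg_complexP _ (nbhs (x : subspace A)))[] := cf x. Qed.

Lemma Im_within_continuous (X : topologicalType) (A : set X) (f : X -> R[i]) :
  {within A, continuous f} -> {within A, continuous (fun x => complex.Im (f x))}.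
Proof. by move=> cf x; have /(@cvg_complexP _ (nbhs (x : subspace A)))[] := cf x. Qed.

Variables (X : ptopologicalType) (mu : probability (borel X) R) (K : set X).
Hypotheses (cK : compact K) (clK : closed K) (muK : mu K = 1%E).

Lemma complex_int_cst c : complex_integral mu (K : set (borel X)) (fun=> c) = c.
Proof. by rewrite /complex_integral !int_cst //; case: c. Qed.

Lemma complex_int_eq (f g : X -> R[i]) : (forall x, K x -> f x = g x) ->
  complex_integral mu (K : set (borel X)) f = complex_integral mu (K : set (borel X)) g.
Proof.
move=> fg; rewrite /complex_integral.
by congr (_ +i* _)%C; apply: eq_Rintegral => x; rewrite inE => /fg ->.
Qed.

Lemma complex_intZ c (f : X -> R[i]) : {within K, continuous f} ->
  complex_integral mu (K : set (borel X)) (fun x => c * f x) =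
  c * complex_integral mu (K : set (borel X)) f.
Proof.
move=> cf; have cr := Re_within_continuous cf; have ci := Im_within_continuous cf.
have mK : measurable (K : set (borel X)) by exact: borel_closed.
have cZ (a : R) (v : X -> R) : {within K, continuous v} ->
  {within K, continuous (fun x => a * v x)}.
  by move=> cv x; apply: cvgM; [exact: cvg_cst|exact: cv].
have I v : {within K, continuous v} -> mu.-integrable (K : set (borel X)) (EFin \o v).
  exact: continuous_integrable.
case: c => a b; rewrite /complex_integral.
rewrite (_ : (fun x => complex.Re _) = (fun x => a * complex.Re (f x) - b * complex.Im (f x)));
  last first.
  by apply/funext => x; case: (f x).
rewrite (_ : (fun x => complex.Im _) = (fun x => a * complex.Im (f x) + b * complex.Re (f x)));
  last first.
  by apply/funext => x; case: (f x).
rewrite RintegralB ?RintegralD ?RintegralZl //; by [apply: I; try exact: cZ|idtac].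
Qed.

End ComplexIntegral.

(** * Multiplication by large scalars *)

Section Scaling.
Variables (R : realType) (F : base_field) (q : nat).
Local Notation T := (scalars R F).

Definition scal (r : R) : 'M[T]_q := (real_scalar F r)%:M.

Lemma scalM r s : scal r *m scal s = scal (r * s).
Proof. by rewrite /scal -scalar_mxM -rmorphM. Qed.

Lemma scal1 : scal 1 = 1%:M.
Proof. by rewrite /scal rmorph1. Qed.

Lemma scalC r (E : 'M[T]_q) : scal r *m E = E *m scal r.
Proof. by rewrite /scal mx_rsC. Qed.

Lemma scal_GL r : 0 < r -> group_GL R F q (scal r).
Proof.
move=> r0; have -> : scal r = rdiag F (const_mx r).
  by apply/matrixP => i j; rewrite rdiagE !mxE; case: eqP => // ->.
by apply: rdiag_GL => i; rewrite mxE.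
Qed.

Lemma scal_expandingM r (E : 'M[T]_q) : 1 <= r -> expanding E -> expanding (scal r *m E).
Proof.
move=> r1 [GE xE]; split; first by apply: group_GLM => //; apply: scal_GL; exact: lt_le_trans r1.
move=> x; rewrite mulmxA /scal mx_rsC -mulmxA fro_rs; apply: le_trans (xE x) _.
by rewrite ler_peMl ?fro_ge0 // expr_ge1 // (le_trans ler01).
Qed.

Lemma expanding1 : expanding (1%:M : 'M[T]_q).
Proof. by split; [rewrite -scal1; exact: scal_GL|move=> x; rewrite mulmx1]. Qed.

Lemma scal_expanding r : 1 <= r -> expanding (scal r).
Proof. by move=> r1; rewrite -[scal r]mulmx1; apply: scal_expandingM => //; exact: expanding1. Qed.

(** The inverse of E0 gives |x|^2 <= C |x E0|^2. A perturbation with [fro] below 1 / (4 C 2^q) still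
    gives |x|^2 <= 4 C |x E|^2, and r = 4 C + 1 satisfies 4 C <= r^2. That one r serves a whole
    neighbourhood is used for the continuity of the extension. *)
Lemma GL_scal_expanding_near (E0 : 'M[T]_q) : group_GL R F q E0 ->
  exists2 r, 1 <= r & nbhs E0 [set E | group_GL R F q E -> expanding (scal r *m E)].
Proof.
move=> GE0; have [h [E0h _]] := group_GL_invertible GE0.
pose C := 2 ^+ q * fro h + 1.
have C1 : 1 <= C by rewrite /C lerDr mulr_ge0 ?exprn_ge0 ?fro_ge0.
have C0 : 0 < C by exact: lt_le_trans C1.
have hC (x : 'rV[T]_q) : fro x <= C * fro (x *m E0).
  rewrite -{1}[x]mulmx1 -E0h mulmxA; apply: le_trans (froM_le _ _) _.
  by rewrite /C mulrDl mul1r [fro _ * fro h]mulrC mulrA lerDl fro_ge0.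
exists (4 * C + 1); first by rewrite lerDr; lra.
have D0 : 0 < 4 * C * 2 ^+ q by rewrite !mulr_gt0 ?exprn_gt0.
have : nbhs E0 [set E : 'M[T]_q | fro (E0 - E) < (4 * C * 2 ^+ q)^-1].
  apply: (@open_nbhs_nbhs _ E0); split; last by rewrite /= subrr fro0 invr_gt0.
  apply: (@open_comp _ _ (fun E : 'M[T]_q => fro (E0 - E)) [set y : R | y < (4 * C * 2 ^+
    q)^-1]); last exact: open_lt.
  move=> E _; apply: (@cvg_fro _ _ _ (nbhs E)); apply: (@cvg_addmx _ _ _ (nbhs E));
    first exact: cvg_cst.
  by apply: (@cvg_oppmx _ _ _ (nbhs E)); exact: cvg_id.
apply: filterS => E /= hE GE; split.
  by apply: group_GLM => //; apply: scal_GL; lra.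
move=> x; rewrite mulmxA /scal mx_rsC -mulmxA fro_rs.
have h1 : fro (x *m E0) <= 2 * (fro (x *m E) + 2 ^+ q * (fro x * fro (E0 - E))).
  rewrite -{1}[E0](subrK E) mulmxDr; apply: le_trans (froD_le _ _) _.
  by rewrite ler_pM2l // addrC lerD2l froM_le.
have h2 : C * (2 ^+ q * (fro x * fro (E0 - E))) <= fro x / 4.
  have hd : fro (E0 - E) * (4 * C * 2 ^+ q) < 1 by rewrite -ltr_pdivlMr // mul1r.
  rewrite (_ : C * _ = fro x / 4 * (fro (E0 - E) * (4 * C * 2 ^+ q))); last by field.
  by apply: ler_piMr; [rewrite divr_ge0 ?fro_ge0|exact: ltW].
have := hC x; have := fro_ge0 x; have := fro_ge0 (x *m E).
have := ler_wpM2l (ltW C0) h1; move: h2.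
set a := fro (x *m E); set b := fro x => h2 h4 a0 b0 bC.
have h3 : b <= 4 * C * a by lra.
apply: le_trans h3 _; rewrite ler_wpM2r //; nra.
Qed.

End Scaling.

(** * Spherical functions of G/K and their values on expanding matrices *)

Section Spherical.
Variables (R : realType) (F : base_field) (q : nat).
Local Notation T := (scalars R F).
Local Notation scal := (@scal R F q).
Variables (nu : probability (borel 'M[T]_q) R).
Hypothesis hnu : normalized_haar (group_U R F q) nu.

Let clU := @group_U_closed R F q.
Let nu1 : nu (group_U R F q) = 1%E. Proof. by case: hnu. Qed.

Lemma expanding_GL (E : 'M[T]_q) : expanding E -> group_GL R F q E.
Proof. by case. Qed.

Lemma GL_scal_expanding (E : 'M[T]_q) : group_GL R F q E ->
  exists2 r, 1 <= r & expanding (scal r *m E).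
Proof.
move=> GE; have [r r1 h] := GL_scal_expanding_near GE; exists r => //.
exact: (nbhs_singleton h).
Qed.

Section Psi.
Variable psi : 'M[T]_q -> R[i].
Hypothesis Spsi : spherical nu psi.

(** At h = 1 the product formula has the constant integrand psi g. *)
Lemma spherical1 : psi 1%:M = 1.
Proof.
have [_ bi [g Gg g0] prod] := Spsi; apply: (mulfI g0).
rewrite (prod g 1%:M Gg); last exact: group_U_GL (group_U1 R F q).
rewrite mulr1 -[RHS](complex_int_cst clU nu1); apply: complex_int_eq => V UV.
rewrite mulmx1 -[g in LHS]mul1mx; apply: bi => //; exact: group_U1.
Qed.

(** As [scal r] is central, biinvariance makes the integrand of the product formula constant. *)
Lemma spherical_scal r E : 0 < r -> group_GL R F q E ->
  psi (scal r *m E) = psi (scal r) * psi E.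
Proof.
move=> r0 GE; have [_ bi _ prod] := Spsi; rewrite prod //; last exact: scal_GL.
rewrite -[LHS](complex_int_cst clU nu1); apply: complex_int_eq => V UV.
have -> : scal r *m V *m E = V *m (scal r *m E) *m 1%:M by rewrite mulmx1 scalC mulmxA.
by rewrite bi //; [exact: group_U1|apply: group_GLM => //; exact: scal_GL].
Qed.

(** The values at r and at 1 / r have product psi(1) = 1. *)
Lemma spherical_scal_neq0 r : 0 < r -> psi (scal r) != 0.
Proof.
move=> r0; apply/eqP => h; have rV : 0 < r^-1 by rewrite invr_gt0.
have := spherical_scal r0 (scal_GL F q rV); rewrite h mul0r scalM mulfV ?gt_eqF // scal1 spherical1.
by move/eqP; rewrite oner_eq0.
Qed.

End Psi.

(** On expanding matrices biinvariance reduces to cosh t. Any other E becomes expanding after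
    multiplication by some r, and psi(r E) = psi(r) psi(E) with psi(r) nonzero. *)
Lemma spherical_unique psi1 psi2 : spherical nu psi1 -> spherical nu psi2 ->
  (forall t, C_B t -> psi1 (cosh_mx F t) = psi2 (cosh_mx F t)) ->
  forall E, group_GL R F q E -> psi1 E = psi2 E.
Proof.
move=> S1 S2 e12.
have exp12 E : expanding E -> psi1 E = psi2 E.
  move=> /expanding_cosh[V [W [t [UV UW tC ->]]]].
  have GE : group_GL R F q (cosh_mx F t) by apply: expanding_GL; exact: cosh_expanding.
  by have [_ b1 _ _] := S1; have [_ b2 _ _] := S2; rewrite b1 // b2 // e12.
move=> E GE; have [r r1 xE] := GL_scal_expanding GE; have r0 : 0 < r by exact: lt_le_trans r1.
apply: (mulfI (spherical_scal_neq0 S1 r0)).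
by rewrite -spherical_scal // exp12 // (spherical_scal S2) // exp12 //; exact: scal_expanding.
Qed.

End Spherical.

(** * Olshanski spherical functions in terms of the lower block *)

Section Olshanski.
Variables (R : realType) (F : base_field) (q : nat) (q0 : (0 < q)%N).
Local Notation T := (scalars R F).
Local Notation lower := (@lower R F q).
Variable mu : forall n, probability (borel 'M[T]_(q + n + q)) R.
Hypothesis hmu : forall n, (0 < n)%N -> normalized_haar (group_K R F q n) (mu n).
Variables (nu : probability (borel 'M[T]_q) R).
Hypothesis hnu : normalized_haar (group_U R F q) nu.

Local Notation int f := (complex_integral nu (group_U R F q : set (borel 'M[T]_q)) f).
Local Notation intK n f := (complex_integral (mu n) (group_K R F q n : set (borel 'M[T]_(q + n +
  q))) f).

Let clU := @group_U_closed R F q.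
Let nu1 : nu (group_U R F q) = 1%E. Proof. by case: hnu. Qed.

Lemma complex_haar_limit (f : 'M[T]_q -> R[i]) g h : {within @expanding R F q, continuous f} ->
  Ginf R F q g -> Ginf R F q h ->
  (fun n => intK n (fun k => f (lower (infmul (infmul g (embed k)) h)))) @ \oo -->
  int (fun V => f (lower g *m V *m lower h)).
Proof.
move=> cf Gg Gh; apply/(@cvg_complexP R _ \oo); split.
- exact: (haar_limit q0 hmu hnu (Re_within_continuous cf) Gg Gh).
- exact: (haar_limit q0 hmu hnu (Im_within_continuous cf) Gg Gh).
Qed.

Lemma biinvariant_corresponds phi (psi : 'M[T]_q -> R[i]) :
  {within Ginf R F q, continuous phi} -> Kinf_biinvariant phi ->
  spherical nu psi -> corresponds phi psi ->
  forall g, Ginf R F q g -> phi g = psi (lower g).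
Proof.
move=> cphi Kphi Spsi cor g Gg; have [f cf fE] := biinvariant_factor q0 cphi Kphi.
have [V [W [t [UV UW tC eg]]]] := expanding_cosh (Ginf_expanding Gg).
have [_ bi _ _] := Spsi; rewrite fE // eg (biinvariant_cosh t q0 Kphi fE UV UW) cor // bi //.
by apply: expanding_GL; exact: cosh_expanding.
Qed.

Lemma spherical_olshanski phi (psi : 'M[T]_q -> R[i]) :
  {within Ginf R F q, continuous phi} -> Kinf_biinvariant phi ->
  spherical nu psi -> (forall g, Ginf R F q g -> phi g = psi (lower g)) ->
  olshanski_spherical mu phi.
Proof.
move=> cphi Kphi Spsi phiE; have [cpsi _ _ prod] := Spsi; split => //.
  exists (embed (1%:M : 'M[T]_(q + 1 + q))).
    by apply: Ginf_embed => //; apply: group_K_G; exact: group_K1.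
  rewrite phiE; last by apply: Ginf_embed => //; apply: group_K_G; exact: group_K1.
  by rewrite lower_embed scalar_mx_block block_mxKdr (spherical1 hnu Spsi) oner_neq0.
move=> g h Gg Gh; rewrite !phiE // prod; try exact: Ginf_lower_GL.
have cpsi' : {within @expanding R F q, continuous psi}.
  by apply: continuous_subspaceW cpsi => E; exact: expanding_GL.
have := complex_haar_limit cpsi' Gg Gh.
(* For n > 0 the points g k h lie in G_infinity, where phi is psi of the lower block. *)
apply: cvg_trans; apply: near_eq_cvg; near=> n; apply: complex_int_eq => k Kk.
rewrite phiE //; apply: GinfM => //; apply: GinfM => //; apply: Kinf_G; apply: Kinf_embed => //.
by near: n; exact: nbhs_infty_gt.
Unshelve. all: by end_near.
Qed.

Lemma spherical_lower_olshanski (psi : 'M[T]_q -> R[i]) : spherical nu psi ->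
  olshanski_spherical mu (psi \o lower).
Proof.
move=> Spsi; have [cpsi bi _ _] := Spsi; apply: (spherical_olshanski _ _ Spsi) => //.
- apply: (@comp_within_continuous _ _ _ (Ginf R F q) (group_GL R F q) lower psi) => //.
    by move=> g; exact: Ginf_lower_GL.
  by apply: continuous_subspaceT; exact: lower_continuous.
- move=> k k' g Kk Kk' Gg /=; rewrite Kinf_lowerM // bi //; last exact: Ginf_lower_GL.
    by have [] := Kinf_lower Kk.
  by have [] := Kinf_lower Kk'.
Qed.

Section FromOlshanski.
Variable phi : infmx R F q -> R[i].
Hypothesis Ophi : olshanski_spherical mu phi.

(** The integrals in the definition also converge to the integral over K, by [complex_haar_limit],
    and limits are unique: this turns the limit formula into a product formula. The value at 1 is
    found as in [spherical1]. *)
Lemma olshanski_factor : exists f : 'M[T]_q -> R[i],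
  [/\ {within @expanding R F q, continuous f},
      forall g, Ginf R F q g -> phi g = f (lower g),
      forall V W E, group_U R F q V -> group_U R F q W -> expanding E -> f (V *m E *m W) = f E,
      f 1%:M = 1 &
      forall E E', expanding E -> expanding E' -> f E * f E' = int (fun V => f (E *m V *m E'))].
Proof.
have [cphi Kphi [g0 Gg0 phi0] prod] := Ophi.
have [f cf fE] := biinvariant_factor q0 cphi Kphi; exists f.
have bi V W E : group_U R F q V -> group_U R F q W -> expanding E -> f (V *m E *m W) = f E.
  move=> UV UW /expanding_cosh[V' [W' [t [UV' UW' tC ->]]]].
  rewrite (biinvariant_cosh t q0 Kphi fE UV' UW') -(biinvariant_cosh t q0 Kphi fE (group_UM UV
    UV') (group_UM UW' UW)).
  by rewrite !mulmxA.
have pr E E' : expanding E -> expanding E' -> f E * f E' = int (fun V => f (E *m V *m E')).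
  move=> /(expanding_lift q0)[g Gg <-] /(expanding_lift q0)[h Gh <-].
  have l1 := prod g h Gg Gh; have l2 := complex_haar_limit cf Gg Gh.
  rewrite -!fE //; apply: (@cvg_unique _ (@norm_hausdorff _ R[i]) _ _ _ _ l1).
  move: l2; apply: cvg_trans; apply: near_eq_cvg; near=> n; apply: complex_int_eq => k Kk.
  rewrite fE //; apply: GinfM => //; apply: GinfM => //; apply: Kinf_G; apply: Kinf_embed => //.
  by near: n; exact: nbhs_infty_gt.
split => //.
have xg := Ginf_expanding Gg0; rewrite fE // in phi0.
apply: (mulfI phi0); rewrite pr //; last exact: expanding1.
rewrite mulr1 -[RHS](complex_int_cst clU nu1); apply: complex_int_eq => V UV.
by rewrite mulmx1 -[lower g0 in LHS]mul1mx bi //; exact: group_U1.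
Unshelve. all: by end_near.
Qed.

End FromOlshanski.

End Olshanski.

(** * Extension from expanding matrices to a spherical function of G/K *)

Section SphericalExtension.
Variables (R : realType) (F : base_field) (q : nat).
Local Notation T := (scalars R F).
Local Notation scal := (@scal R F q).
Variables (nu : probability (borel 'M[T]_q) R).
Hypothesis hnu : normalized_haar (group_U R F q) nu.

Local Notation int f := (complex_integral nu (group_U R F q : set (borel 'M[T]_q)) f).

Let cU := @group_U_compact R F q.
Let clU := @group_U_closed R F q.
Let nu1 : nu (group_U R F q) = 1%E. Proof. by case: hnu. Qed.

Variable f : 'M[T]_q -> R[i].
Hypothesis cf : {within @expanding R F q, continuous f}.
Hypothesis bi : forall V W E, group_U R F q V -> group_U R F q W -> expanding E ->
  f (V *m E *m W) = f E.
Hypothesis f1 : f 1%:M = 1.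
Hypothesis prod : forall E E', expanding E -> expanding E' ->
  f E * f E' = int (fun V => f (E *m V *m E')).

Lemma expanding_scal r E : 1 <= r -> expanding E -> f (scal r *m E) = f (scal r) * f E.
Proof.
move=> r1 xE; rewrite prod //; last exact: scal_expanding.
rewrite -[LHS](complex_int_cst clU nu1); apply: complex_int_eq => V UV.
have -> : scal r *m V *m E = V *m (scal r *m E) *m 1%:M by rewrite mulmx1 scalC mulmxA.
by rewrite bi //; [exact: group_U1|exact: scal_expandingM].
Qed.

Lemma bernoulli (d : R) n : 0 <= d -> 1 + n%:R * d <= (1 + d) ^+ n.
Proof.
move=> d0; elim: n => [|n IH]; first by rewrite mul0r addr0 expr0.
rewrite exprS; have : (1 + d) * (1 + n%:R * d) <= (1 + d) * (1 + d) ^+ n by rewrite ler_wpM2l //;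
  lra.
apply: le_trans; have : 0 <= n%:R * d * d by rewrite !mulr_ge0.
by rewrite -natr1; lra.
Qed.

(* [r |-> f (scal r)] is multiplicative on [1, +oo[ and continuous with value
   1 at 1: a zero r would give zeros at all larger arguments, among them the
   powers of some s > 1 with f (scal s) != 0. *)
Lemma expanding_scal_neq0 r : 1 <= r -> f (scal r) != 0.
Proof.
move=> r1; apply/eqP => fr.
have /within_continuousP /(_ 1%:M (expanding1 R F q)) := cf; rewrite f1 => c1.
have h0 : nbhs (1 : R[i]) [set z | z != 0].
  apply/nbhs_complexP; exists 1 => // z; apply: contraTN => /eqP ->.
  by rewrite sub0r /= oppr0 expr0n addr0 sqrrN expr1n ltxx.
have [rho rho0 hr] := nbhs_fro_ball (c1 _ h0).
pose D := fro (1%:M : 'M[T]_q) + 1.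
have D0 : 0 < D by rewrite /D ltr_wpDl ?fro_ge0.
(* So that [fro (scal (1 + d) - 1%:M)], which is d^2 |1|^2, satisfies d^2 |1|^2 <= d |1|^2 < d D <=
   rho. *)
pose d := Num.min 1 (rho / D).
have d0 : 0 < d by rewrite lt_min ltr01 divr_gt0.
have fd : f (scal (1 + d)) != 0.
  apply: hr; last by apply: scal_expanding; rewrite lerDl ltW.
  have -> : scal (1 + d) - 1%:M = scal d *m 1%:M.
    by rewrite mulmx1 -scal1 /scal -raddfB -rmorphB addrAC subrr add0r.
  rewrite fro_rs; have dD : d * D <= rho by rewrite -ler_pdivlMr // ge_min lexx orbT.
  have d1 : d <= 1 by rewrite ge_min lexx.
  apply: lt_le_trans dD; rewrite /D expr2 mulrDr mulr1.
  rewrite -mulrA; have a0 : 0 <= d * fro (1%:M : 'M[T]_q) by rewrite mulr_ge0 ?fro_ge0 // ltW.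
  by rewrite (le_lt_trans (_ : _ <= d * fro (1%:M : 'M[T]_q))) ?ltrDl // ler_piMl.
have fdn n : f (scal ((1 + d) ^+ n)) = f (scal (1 + d)) ^+ n.
  elim: n => [|n IH]; first by rewrite expr0 scal1 f1.
  rewrite !exprS -scalM expanding_scal ?IH ?lerDl ?(ltW d0) //.
  by apply: scal_expanding; rewrite exprn_ege1 // lerDl ltW.
(* By Bernoulli's inequality any n above r / d will do. *)
have [n hn] : exists n : nat, r <= (1 + d) ^+ n.
  exists (Num.bound (r / d)); apply: le_trans (bernoulli _ (ltW d0)).
  have : r / d < (Num.bound (r / d))%:R by apply: archi_boundP; rewrite divr_ge0 ?ltW //; lra.
  by rewrite ltr_pdivrMr //; lra.
have r0 : 0 < r by exact: lt_le_trans r1.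
have := expf_neq0 n fd; rewrite -fdn.
have -> : (1 + d) ^+ n = r * ((1 + d) ^+ n / r) by rewrite mulrCA mulfV ?mulr1 // gt_eqF.
rewrite -scalM expanding_scal // ?fr ?mul0r ?eqxx //.
by apply: scal_expanding; rewrite ler_pdivlMr // mul1r.
Qed.

(** The choice of r is immaterial by [extensionE]; 0 is a default value where no r exists. *)
Definition extension (E : 'M[T]_q) : R[i] :=
  match pselect (exists2 r, 1 <= r & expanding (scal r *m E)) with
  | left h => f (scal (projT1 (cid2 h)) *m E) / f (scal (projT1 (cid2 h)))
  | right _ => 0
  end.

(** For two admissible scalars r and s, both f(s E) f(r) and f(r E) f(s) equal f(r s E). *)
Lemma extensionE r E : 1 <= r -> expanding (scal r *m E) ->
  extension E = f (scal r *m E) / f (scal r).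
Proof.
move=> r1 xr; rewrite /extension; case: pselect => [h|[]]; last by exists r.
case: (cid2 h) => s s1 xs /=.
apply/eqP; rewrite eqr_div ?expanding_scal_neq0 //; apply/eqP.
rewrite [LHS]mulrC [RHS]mulrC -!expanding_scal //.
by rewrite !mulmxA !scalM mulrC.
Qed.

Lemma extension_expanding E : expanding E -> extension E = f E.
Proof. by move=> xE; rewrite (@extensionE 1) ?scal1 ?mul1mx // f1 divr1. Qed.

(** Near E0 one r serves all matrices of the group, so that the extension is locally f(r E) /
    f(r). *)
Lemma extension_continuous : {within group_GL R F q, continuous extension}.
Proof.
apply/within_continuousP => E0 GE0; have [r r1 hr] := GL_scal_expanding_near GE0.
have xr := nbhs_singleton hr GE0.
have /within_continuousP /(_ _ xr) cfr := cf.
have sc : scal r *m E @[E --> within (group_GL R F q) (nbhs E0)] -->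
  within (@expanding R F q) (nbhs (scal r *m E0)).
  move=> A hA; have : nbhs E0 [set E | expanding (scal r *m E) -> A (scal r *m E)].
    have : scal r *m E @[E --> nbhs E0] --> scal r *m E0.
      by apply: (@cvg_mulmx _ _ _ (nbhs E0)); [exact: cvg_cst|exact: cvg_id].
    by move=> /(_ _ hA).
  move=> h; have : nbhs E0 [set E | group_GL R F q E -> A (scal r *m E)]; last by [].
  by apply: filterS (filterI h hr) => E [h1 h2] GE; apply: h1; exact: h2.
have cfs : f (scal r *m E) / f (scal r) @[E --> within (group_GL R F q) (nbhs E0)] --> extension E0.
  rewrite (extensionE r1 xr); apply: (@cvgTM R Complexes _ (within (group_GL R F q) (nbhs E0))).
    by move=> A hA; exact: (sc _ (cfr _ hA)).
  exact: cvg_cst.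
move: cfs; apply: cvg_trans; apply: near_eq_cvg.
have : nbhs E0 [set E | group_GL R F q E -> f (scal r *m E) / f (scal r) = extension E]; last by [].
by apply: filterS hr => E h GE; rewrite (extensionE r1 (h GE)).
Qed.

(** For the product formula, r g and s h are expanding and r s (g V h) = (r g) V (s h) because
    scalar matrices are central; the constant f(r s) = f(r) f(s) passes through the integral. *)
Lemma extension_spherical : spherical nu extension.
Proof.
split; first exact: extension_continuous.
- move=> V W E UV UW GE; have [r r1 xr] := GL_scal_expanding GE.
  have e : scal r *m (V *m E *m W) = V *m (scal r *m E) *m W.
    by rewrite !mulmxA scalC.
  by rewrite (extensionE r1 xr) (@extensionE r) // e ?bi //; exact: unitary_expanding.
- exists 1%:M; first exact: group_U_GL (group_U1 R F q).
  by rewrite extension_expanding ?f1 ?oner_neq0 //; exact: expanding1.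
move=> g h Gg Gh; have [r r1 xr] := GL_scal_expanding Gg; have [s s1 xs] := GL_scal_expanding Gh.
have rs1 : 1 <= r * s by rewrite mulr_ege1.
have ne := expanding_scal_neq0.
have frs : f (scal (r * s)) = f (scal r) * f (scal s).
  by rewrite -scalM expanding_scal //; exact: scal_expanding.
have xV V : group_U R F q V -> scal (r * s) *m (g *m V *m h) = (scal r *m g) *m V *m (scal s *m h).
  by move=> UV; rewrite -scalM -mulmxA [scal s *m _]mulmxA [scal s *m (g *m V)]scalC !mulmxA.
rewrite (extensionE r1 xr) (extensionE s1 xs) mulrACA prod // -invfM -frs mulrC.
rewrite -(complex_intZ cU clU nu1); last first.
  apply: (@comp_within_continuous _ _ _ (group_U R F q) (@expanding R F q) (fun V => scal r *m g
    *m V *m (scal s *m h)) f) => //.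
    by move=> V UV; exact: expanding_product.
  apply: continuous_subspaceT => V; apply: (@cvg_mulmx _ _ _ (nbhs V)); last exact: cvg_cst.
  by apply: (@cvg_mulmx _ _ _ (nbhs V)); [exact: cvg_cst|exact: cvg_id].
apply: complex_int_eq => V UV; rewrite (@extensionE (r * s)) ?xV // 1?mulrC //.
exact: expanding_product.
Qed.

End SphericalExtension.

Lemma olshanski_corresponds (R : realType) (F : base_field) (q : nat) (q0 : (0 < q)%N)
  (mu : forall n, probability (borel 'M[scalars R F]_(q + n + q)) R)
  (hmu : forall n, (0 < n)%N -> normalized_haar (group_K R F q n) (mu n))
  (nu : probability (borel 'M[scalars R F]_q) R)
  (hnu : normalized_haar (group_U R F q) nu) (phi : infmx R F q -> R[i]) :
  olshanski_spherical mu phi -> exists2 psi, spherical nu psi & corresponds phi psi.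
Proof.
move=> Ophi; have [f [cf fE bi f1 prod]] := olshanski_factor q0 hmu hnu Ophi.
exists (extension f); first exact: (extension_spherical hnu cf bi f1 prod).
move=> t tC; rewrite fE ?lower_a; last exact: a_inf_G.
by rewrite (extension_expanding hnu cf bi f1 prod) //; exact: cosh_expanding.
Qed.

(** All functions are total on matrices, so equality is asked only on D, on G or on G_infinity. The
    last two clauses together express the bijection: each function has a counterpart of the other
    kind, unique on the respective group. *)
Theorem theorem7p2 (R : realType) (F : base_field) (q : nat) (hq : (0 < q)%N)
  (mu : forall n, probability (borel 'M[scalars R F]_(q + n + q)) R)
  (hmu : forall n, (0 < n)%N -> normalized_haar (group_K R F q n) (mu n))
  (nu : probability (borel 'M[scalars R F]_q) R)
  (hnu : normalized_haar (group_U R F q) nu) :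
  [/\ forall (phi : infmx R F q -> R[i]) (phiD : 'M[scalars R F]_q -> R[i]),
        {within Ginf R F q, continuous phi} ->
        Kinf_biinvariant phi ->
        (forall t, C_B t -> phi (a_inf F t) = phiD (cosh_mx F t)) ->
        (olshanski_spherical mu phi <->
         exists2 psi, spherical nu psi & {in set_D R F q, phiD =1 psi}),
      forall psi1 psi2 : 'M[scalars R F]_q -> R[i],
        spherical nu psi1 -> spherical nu psi2 ->
        {in set_D R F q, psi1 =1 psi2} -> {in group_GL R F q, psi1 =1 psi2},
      forall phi : infmx R F q -> R[i], olshanski_spherical mu phi ->
        exists psi, [/\ spherical nu psi, corresponds phi psi &
          forall psi', spherical nu psi' -> corresponds phi psi' ->
            {in group_GL R F q, psi' =1 psi}] &
      forall psi : 'M[scalars R F]_q -> R[i], spherical nu psi ->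
        exists phi, [/\ olshanski_spherical mu phi, corresponds phi psi &
          forall phi', olshanski_spherical mu phi' -> corresponds phi' psi ->
            {in Ginf R F q, phi' =1 phi}]].
Proof.
have inD (psi1 psi2 : 'M[scalars R F]_q -> R[i]) : {in set_D R F q, psi1 =1 psi2} <->
    forall t, C_B t -> psi1 (cosh_mx F t) = psi2 (cosh_mx F t).
  split=> [e t tC|e E]; first by apply: e; rewrite inE; exists t.
  by rewrite inE => -[t tC <-]; exact: e.
split.
- move=> phi phiD cphi Kphi cor; split.
    move=> /(olshanski_corresponds hq hmu hnu)[psi Spsi cpsi]; exists psi => //.
    by apply/inD => t tC; rewrite -cor // cpsi.
  move=> [psi Spsi /inD e]; apply: (spherical_olshanski hq hmu hnu cphi Kphi Spsi).
  apply: (biinvariant_corresponds hq cphi Kphi Spsi) => t tC.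
  by rewrite cor // e.
- move=> psi1 psi2 S1 S2 /inD e E; rewrite inE; exact: (spherical_unique hnu S1 S2 e).
- move=> phi /(olshanski_corresponds hq hmu hnu)[psi Spsi cpsi]; exists psi; split => //.
  move=> psi' Spsi' cpsi' E; rewrite inE; apply: (spherical_unique hnu Spsi' Spsi) => t tC.
  by rewrite -cpsi' // cpsi.
- move=> psi Spsi; exists (psi \o @lower R F q); split.
  + exact: (spherical_lower_olshanski hq hmu hnu Spsi).
  + by move=> t tC; rewrite /= lower_a.
  + move=> phi' [cphi' Kphi' _ _] cor g; rewrite inE.
    exact: (biinvariant_corresponds hq cphi' Kphi' Spsi cor).
Qed.
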